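(* Let $\lambda,\mu>0$, $k\ge1$ an integer and $\nu\in(0,1)$. Let $B^\nu$ be the duration of the busy period of a $\nu$-fractional $M/E_k/1$ queue, let $B^\nu(t)$ be its distribution function and let $\overline{B}^\nu(v)$ be the Laplace transform of the function $t\mapsto B^\nu(t)$. Then $$B^\nu(t)=\sum_{r=0}^{+\infty}C^B_r\,t^{\gamma^B_r-1}E^{\delta^B_r}_{\nu,\gamma^B_r}(-(\lambda+k\mu)t^\nu)$$ and $$\overline{B}^\nu(v)=\sum_{r=0}^{+\infty}C^B_r\frac{v^{\nu\delta^B_r-\gamma^B_r}}{(\lambda+k\mu+v^\nu)^{\delta^B_r}},\qquad v>0,$$ where $$C^B_r=k\mu\, C^0_{k,r},\qquad \delta^B_r=\delta^0_{k,r},\qquad \gamma^B_r=\nu\,\delta^0_{k,r}+1,$$ with $$C^0_{m,r}=\frac{m}{m+r(k+1)}\binom{m+r(k+1)}{m+rk}\lambda^r(k\mu)^{m+rk-1},\qquad \delta^0_{m,r}=m+r(k+1).$$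
   Context: Classical queue: let $\mathcal{S}^*=\{(n,s): n\ge 1,\ 1\le s\le k\}$ ($n,s$ integers) and $\mathcal{S}=\mathcal{S}^*\cup\{(0,0)\}$. The state-phase process $Q(t)=(N(t),S(t))$ of the classical $M/E_k/1$ queue ($N$ = number of customers in the system, $S$ = phase of the customer currently being served, $S=0$ if $N=0$) is the continuous-time Markov chain on $\mathcal{S}$ with transition rates: $(0,0)\to(1,k)$ at rate $\lambda$; $(n,s)\to(n+1,s)$ at rate $\lambda$ for $(n,s)\in\mathcal{S}^*$; $(n,s)\to(n,s-1)$ at rate $k\mu$ for $s\ge2$; $(n,1)\to(n-1,k)$ at rate $k\mu$ for $n\ge2$; $(1,1)\to(0,0)$ at rate $k\mu$. Fractional queue: let $\{\sigma_\nu(t)\}_{t\ge0}$ be a $\nu$-stable subordinator independent of $Q$, with $\mathbb{E}[e^{-v\sigma_\nu(t)}]=e^{-tv^\nu}$ for $v>0$, and let $L_\nu(t)=\inf\{s\ge0:\sigma_\nu(s)>t\}$. The $\nu$-fractional $M/E_k/1$ queue has state-phase process $Q^\nu(t):=Q(L_\nu(t))$. The busy period is the time from the arrival of a customer to the empty system (i.e. from the entrance of $Q^\nu$ into $(1,k)$ from $(0,0)$) until the first subsequent time at which the system is empty again (i.e. $Q^\nu$ is in $(0,0)$). Equivalently, its law is that of the hitting time of $(0,0)$ for $Q^\nu$ started from $(1,k)$. (The busy period may be infinite with positive probability; $B^\nu(t)$ is the probability that it is at most $t<\infty$.) Three-parameter Mittag-Leffler function: $E_{\nu,\gamma}^{\delta}(z)=\sum_{j=0}^{+\infty}\frac{\Gamma(\delta+j)\,z^j}{j!\,\Gamma(\delta)\,\Gamma(\nu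 j+\gamma)}$. *)

(* Defs.v *)
From HB Require Import structures.
From mathcomp Require Import all_boot all_order all_algebra.
From mathcomp Require Import all_classical all_reals all_analysis.
From mathcomp Require Import measurable_realfun.

Set Implicit Arguments.
Unset Strict Implicit.
Unset Printing Implicit Defensive.

Import Order.TTheory GRing.Theory Num.Theory.
Import numFieldNormedType.Exports.

Local Open Scope classical_set_scope.
Local Open Scope ring_scope.

Section SpecialFunctions.
Context {R : realType}.

(* Only meant for x > 0, where the integral converges. *)
Definition Gamma (x : R) : R :=
  Rintegral lebesgue_measure `]0, +oo[ (fun u => u `^ (x - 1) * expR (- u)).

Definition mittag_leffler3 (nu gamma delta z : R) : R :=
  limn (series (fun j : nat =>
    Gamma (delta + j%:R) * z ^+ j
      / (j`!%:R * Gamma delta * Gamma (nu * j%:R + gamma)))).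

Definition laplace (f : R -> R) (v : R) : R :=
  Rintegral lebesgue_measure `[0, +oo[ (fun t => expR (- (v * t)) * f t).

End SpecialFunctions.

(* Processes are indexed by all of R, but only nonnegative times matter. *)
Section Processes.
Context {R : realType} {d : measure_display} {Omega : measurableType d}.
Variable P : probability Omega R.

Definition generated_sigma {d' : measure_display} {T : measurableType d'}
    (X : R -> Omega -> T) : set (set Omega) :=
  <<s [set A | exists (t : R) (B : set T), [/\ 0 <= t, measurable B & A = X t @^-1` B]] >>.

Definition independent_processes {d1 d2 : measure_display}
    {T1 : measurableType d1} {T2 : measurableType d2}
    (X : R -> Omega -> T1) (Y : R -> Omega -> T2) : Prop :=
  forall A B, generated_sigma X A -> generated_sigma Y B ->
    P (A `&` B) = (P A * P B)%E.

Record stable_subordinator (nu : R) (sigma : R -> Omega -> R) : Prop := {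
  subordinator_measurable :
    forall t : R, 0 <= t -> measurable_fun setT (sigma t);
  subordinator_start :
    {ae P, forall w, sigma 0 w = 0};
  subordinator_nondecreasing :
    {ae P, forall w, forall s t : R, 0 <= s -> s <= t -> sigma s w <= sigma t w};
  subordinator_right_continuous :
    {ae P, forall w, forall t : R, 0 <= t ->
      sigma s w @[s --> t^'+] --> sigma t w};
  subordinator_stationary_increments :
    forall (s t : R) (A : set R), 0 <= s -> 0 <= t -> measurable A ->
      P [set w | A (sigma (s + t) w - sigma s w)] = P [set w | A (sigma t w)];
  subordinator_independent_increments :
    forall (n : nat) (t : nat -> R) (A : nat -> set R),
      0 <= t 0%N -> (forall i, (i < n)%N -> t i <= t i.+1) ->
      (forall i, measurable (A i)) ->
      let E i := [set w | A i (sigma (t i.+1) w - sigma (t i) w)] in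
      P (\bigcap_(i < n) E i) = (\prod_(i < n) P (E i))%E;
  subordinator_laplace :
    forall t v : R, 0 <= t -> 0 < v ->
      'E_P[fun w => expR (- (v * sigma t w))%R]%E = (expR (- (t * v `^ nu)))%:E
}.

(* inf is 0 on the empty set; this only affects the paths along which sigma
   stays bounded, a null event for a stable subordinator. *)
Definition inverse_subordinator (sigma : R -> Omega -> R) (t : R) (w : Omega) :
    R :=
  inf [set s | 0 <= s /\ t < sigma s w].

Definition time_change {T : Type} (X : R -> Omega -> T) (L : R -> Omega -> R) :
    R -> Omega -> T :=
  fun t w => X (L t w) w.

(* Extended-real valued: +oo when x is never visited. *)
Definition hitting_time {T : Type} (X : R -> Omega -> T) (x : T) (w : Omega) :
    \bar R :=
  ereal_inf [set t%:E | t in [set t : R | 0 <= t /\ X t w = x]].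

Section MarkovChain.
Context {d' : measure_display} {T : measurableType d'}.

(* Sum over the finitely many y with q x y != 0. *)
Definition exit_rate (q : T -> T -> R) (x : T) : R :=
  \sum_(y \in [set: T]) q x y.

(* Continuous-time Markov chain on a countable state space with transition
   rates q (no absorbing state being accessible from x0), started from x0: the
   jump chain Y moves from x to y with probability q x y / exit_rate q x and,
   given Y, the holding times W i are independent exponential variables of
   parameters exit_rate q (Y i). *)
Definition continuous_time_markov_chain (q : T -> T -> R) (x0 : T)
    (X : R -> Omega -> T) : Prop :=
  (forall t : R, 0 <= t -> measurable_fun setT (X t)) /\
  exists (Y : nat -> Omega -> T) (W : nat -> Omega -> R),
  [/\ forall n, measurable_fun setT (Y n),
      forall n, measurable_fun setT (W n),
      forall (n : nat) (y : nat -> T) (s : nat -> R),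
        (forall i, 0 <= s i) ->
        P [set w | (forall i, (i <= n)%N -> Y i w = y i) /\
                   (forall i, (i < n)%N -> s i < W i w)] =
        ((y 0%N == x0)%:R *
         \prod_(i < n) (q (y i) (y i.+1) / exit_rate q (y i)
                        * expR (- (exit_rate q (y i) * s i))))%:E
    & {ae P, forall w, forall (n : nat) (t : R),
        \sum_(i < n) W i w <= t < \sum_(i < n.+1) W i w -> X t w = Y n w}].

End MarkovChain.

End Processes.

Section ErlangQueue.
Context {R : realType}.
Variables (lambda mu : R) (k : nat).

(* States are pairs (n, s): n customers in the system, phase s of the service
   in progress. *)
Definition busy_state (x : nat * nat) : bool :=
  (1 <= x.1)%N && (1 <= x.2 <= k)%N.

Definition phase_completion (x : nat * nat) : nat * nat :=
  if (2 <= x.2)%N then (x.1, x.2.-1)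
  else if (2 <= x.1)%N then (x.1.-1, k)
  else (0%N, 0%N).

Definition erlang_rate (x y : nat * nat) : R :=
  if x == (0%N, 0%N) then
    if y == (1%N, k) then lambda else 0
  else if busy_state x then
    if y == (x.1.+1, x.2) then lambda
    else if y == phase_completion x then k%:R * mu
    else 0
  else 0.

Definition C0 (m r : nat) : R :=
  m%:R / (m + r * k.+1)%:R * 'C(m + r * k.+1, m + r * k)%:R
    * lambda ^+ r * (k%:R * mu) ^+ (m + r * k - 1).

Definition delta0 (m r : nat) : nat := (m + r * k.+1)%N.

Definition CB (r : nat) : R := k%:R * mu * C0 k r.

Definition deltaB (r : nat) : nat := delta0 k r.

Definition gammaB (nu : R) (r : nat) : R := nu * (delta0 k r)%:R + 1.

End ErlangQueue.

(* Main.v *)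
Require Import Defs.
From HB Require Import structures.
From mathcomp Require Import all_boot all_order all_algebra.
From mathcomp Require Import all_classical all_reals all_analysis.
From mathcomp Require Import measurable_realfun.
From mathcomp Require Import ring lra zify.

Import Order.TTheory GRing.Theory Num.Theory.
Import numFieldNormedType.Exports.

Set Implicit Arguments.
Unset Strict Implicit.
Unset Printing Implicit Defensive.

Local Open Scope classical_set_scope.
Local Open Scope ring_scope.

(** The busy period of the classical queue is the first passage time T of the
    chain to (0,0), and the inverse of the subordinator sends it to
    B = sigma(T-). Since sigma is independent of Q and
    E[exp (- v sigma(t))] = exp (- t v^nu), the transform of B at v is the
    transform of T at theta = v^nu; the equality is obtained by squeezing both
    between the same sums over a grid {j eps} of values of T.

    All busy states have the same exit rate c = lambda + k mu, so the transform
    of T is the sum over n of (c / (c + theta))^n P(first passage at step n).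
    The number of phases left performs a walk with jumps +k and -1, and its
    first passage probabilities are given by the ballot numbers of C0.

    For the distribution function, the double series in (r, j) has signed terms
    a_rj t^(nu (delta_r + j)), dominated through t^p <= e^(t+1) Gamma(p + 1) by
    a summable family times exp (v t). It is thus continuous, may be transformed
    term by term, and has the transform found above for large v. Injectivity of
    the Laplace transform, for a monotone against a continuous function,
    concludes. *)

(** The passage time T is a function of [Y] and [W], while independence is assumed for the
    sigma-algebra of [Q]. The transfer therefore uses events seen in [Q] at countably many times
    rather than conditioning on T. Both sigma(j eps) at v and the constant j eps at theta = v^nu
    have transform exp (- j eps theta), so v times the transform of B and theta times the transform
    of T obey the same bounds. Transforms are taken of distribution functions because T and B may be
    infinite with positive probability.

    The coefficients are never estimated. With v1^nu = 2 c + 1 the majorant of the double series,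
    summed over j, is C_r / (c + 1)^delta_r, which is the r-th term of the transform of B at v = 1
    and hence summable. The expansion in j requires v^nu > c, so inversion only uses large v,
    whereas the formula for the transform at every v > 0 comes from the chain. Injectivity is silent
    at t = 0, where the absence of an atom is read off the decay of v times the transform.

    In the final series r counts the arrivals during the busy period, and delta_r = k + r (k + 1)
    its jumps. *)

Section Gamma_function.
Context {R : realType}.
Local Notation mu := (@lebesgue_measure R).

Let scale (c : R) : measurableTypeR R -> measurableTypeR R := fun x => c * x.

(** The left-hand side is a measure in [A] that gives half-open intervals their length, which
    determines Lebesgue measure. This is the linear change of variables behind the rescaled Gamma
    integrals. *)
Lemma lebesgue_measure_scale (c : R) (A : set R) : 0 < c -> measurable A ->
  (c%:E * pushforward mu (scale c) A = mu A)%E.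
Proof.
move=> c0 mA.
have mM : measurable_fun [set: measurableTypeR R]
    (scale c) by exact: measurable_funM.
have [m mE] : exists m : {measure set (measurableTypeR R) -> \bar R},
    forall B, m B = (c%:E * pushforward mu (scale c) B)%E.
  by unshelve eexists (mscale (NngNum (ltW c0)) (pushforward mu (scale c))).
rewrite -mE; apply/esym/lebesgue_measure_unique => //.
move=> _ [[a b]] _ <-; rewrite mE /pushforward.
rewrite (_ : _ @^-1` _ = `]a / c, b / c]%classic); last first.
  apply/seteqP; split => x /=; rewrite !in_itv/= ltr_pdivrMr// ler_pdivlMr//;
  by rewrite (mulrC x).
rewrite !lebesgue_measure_itv/= !lte_fin ltr_pM2r ?invr_gt0//.
case: ifPn => _; last by rewrite mule0.
by rewrite -!EFinB -EFinM; congr EFin; field; rewrite gt_eqF.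
Qed.

Lemma ge0_integral_scale (c : R) (f : R -> \bar R) : 0 < c ->
  measurable_fun setT f -> (forall x, (0 <= f x)%E) ->
  (\int[mu]_(x in `[0%R, +oo[) f (c * x)%R =
   (c^-1)%:E * \int[mu]_(x in `[0%R, +oo[) f x)%E.
Proof.
move=> c0 mf f0.
have mM : measurable_fun [set: measurableTypeR R]
    (scale c) by exact: measurable_funM.
have -> : `[0%R, +oo[%classic =
    (scale c) @^-1` `[0%R, +oo[%classic.
  by apply/seteqP; split => x /=; rewrite !in_itv/= !andbT pmulr_rge0.
rewrite -(@ge0_integral_pushforward _ _ _ _ _ _ mM mu `[0%R, +oo[%classic f)//=;
  last exact: measurable_funTS.
rewrite (_ : _ @^-1` _ = `[0%R, +oo[%classic); last first.
  by apply/seteqP; split => x /=; rewrite !in_itv/= !andbT pmulr_rge0.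
have c10 : 0 <= c^-1 by rewrite invr_ge0 ltW.
rewrite (@eq_measure_integral _ _ _ _ (mscale (NngNum c10) mu)); last first.
  move=> A mA _; rewrite /= /mscale/= -(lebesgue_measure_scale c0 mA).
  by rewrite muleA -EFinM mulVf ?gt_eqF// mul1e.
by rewrite ge0_integral_mscale//; exact: measurable_funTS.
Qed.

Lemma integral_expR_scale (c : R) : 0 < c ->
  (\int[mu]_(x in `[0%R, +oo[) (expR (- (c * x)))%:E = (c^-1)%:E)%E.
Proof.
move=> c0; have := integral_exponential_pdf c0.
rewrite (_ : (fun x => _) = (fun x => (c * expR (- c * x))%:E) \_ `[0%R, +oo[); last first.
  by apply/funext => x; rewrite /exponential_pdf /patch; case: ifP.
rewrite -integral_mkcond.
under eq_integral do rewrite EFinM mulNr.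
rewrite ge0_integralZl//; last by rewrite lee_fin ltW.
- move=> H; rewrite -[LHS]mul1e -(mulVf (lt0r_neq0 c0)) EFinM -muleA H mule1.
  by [].
- by apply/measurable_EFinP/measurableT_comp => //; apply: measurableT_comp => //.
Qed.

Lemma ler_powR_base (a x y : R) : 0 <= a -> 0 <= x -> x <= y -> x `^ a <= y `^ a.
Proof.
by move=> a0 x0 xy; apply: ge0_ler_powR; rewrite ?nnegrE// (le_trans x0).
Qed.

(** Writing u = b (u / b) with b = 2 a + 1, the inequality ln x < x bounds (u / b)^a by exp (a u /
    b), and a / b is at most 1/2. Half of the exponential decay remains to make u^a exp (- u)
    integrable. *)
Lemma powR_le_expR (a : R) : 0 <= a ->
  exists2 M, 0 <= M & forall u, 0 <= u -> u `^ a <= M * expR (u / 2).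
Proof.
move=> a0; pose b := 2 * a + 1.
have b1 : 1 <= b by rewrite lerDr mulr_ge0.
have b0 : 0 < b by apply: lt_le_trans b1.
exists (b `^ a); first exact: powR_ge0.
move=> u; rewrite le_eqVlt => /predU1P[<-|u0].
  rewrite mul0r expR0 mulr1.
  by rewrite ler_powR_base// ltW.
have -> : u = b * (u / b) by rewrite mulrC divfK ?gt_eqF.
have ub0 : 0 < u / b by rewrite divr_gt0.
rewrite (powRM _ (ltW b0) (ltW ub0)) ler_pM2l ?powR_gt0//.
rewrite {1}/powR gt_eqF ?divr_gt0// ler_expR.
apply: (@le_trans _ _ (a * (u / b))).
  by rewrite ler_wpM2l// ltW// ln_sublinear.
rewrite -subr_ge0 (_ : _ - _ = (u / b) / 2).
  by apply: divr_ge0 => //; exact: ltW.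
by rewrite /b; field; rewrite gt_eqF.
Qed.

Lemma measurable_expRN (v : R) (D : set R) :
  measurable_fun D (fun u => expR (- (v * u))).
Proof.
apply: measurable_funTS; apply: measurableT_comp => //.
by apply: measurableT_comp => //; exact: measurable_funM.
Qed.

Lemma measurable_powR_expR (a v : R) (D : set R) :
  measurable_fun D (fun u => u `^ a * expR (- (v * u))).
Proof.
apply: measurable_funTS; apply: measurable_funM; first exact: measurable_powR.
by apply: measurableT_comp => //; apply: measurableT_comp => //; exact: measurable_funM.
Qed.

Lemma measurable_Gamma_integrand (a : R) (D : set R) :
  measurable_fun D (fun u => u `^ a * expR (- u)).
Proof.
apply: measurable_funTS; apply: measurable_funM; first exact: measurable_powR.
by apply: measurableT_comp => //; exact: measurableT_comp.
Qed.

Lemma integrable_expR (v : R) : 0 < v ->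
  mu.-integrable `[0%R, +oo[ (fun u => (expR (- (v * u)))%:E).
Proof.
move=> v0; apply/integrableP; split.
  apply/measurable_EFinP/measurable_funTS.
  by apply: measurableT_comp => //; apply: measurableT_comp => //; exact: measurable_funM.
under eq_integral do rewrite gee0_abs ?lee_fin ?expR_ge0//.
by rewrite integral_expR_scale// ltry.
Qed.

Lemma integrable_Gamma (a : R) : 0 <= a ->
  mu.-integrable `[0%R, +oo[ (fun u => (u `^ a * expR (- u))%:E).
Proof.
move=> a0; have [M M0 HM] := powR_le_expR a0.
have iM : mu.-integrable `[0%R, +oo[ (fun u => M%:E * (expR (- (2^-1 * u)))%:E)%E.
  by apply: integrableZl => //; apply: integrable_expR.
apply: le_integrable iM => //.
- by apply/measurable_EFinP; exact: measurable_Gamma_integrand.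
- move=> u /=; rewrite in_itv/= andbT => u0.
  rewrite lee_fin ger0_norm ?mulr_ge0 ?powR_ge0 ?expR_ge0//.
  rewrite ger0_norm ?mulr_ge0 ?expR_ge0//.
  apply: (le_trans (ler_wpM2r (expR_ge0 _) (HM _ u0))).
  rewrite -mulrA -expRD (_ : u / 2 + - u = - (2^-1 * u))//.
  by field.
Qed.

Lemma GammaE (a : R) : 0 <= a ->
  (\int[mu]_(u in `[0%R, +oo[) (u `^ a * expR (- u))%:E = (Gamma (a + 1))%:E)%E.
Proof.
move=> a0; rewrite /Gamma /Rintegral addrK fineK.
  rewrite integral_itv_obnd_cbnd//.
  by apply/measurable_EFinP; exact: measurable_Gamma_integrand.
rewrite integral_itv_obnd_cbnd; first exact/integrable_fin_num/integrable_Gamma.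
by apply/measurable_EFinP; exact: measurable_Gamma_integrand.
Qed.

(** On the unit interval from t to t + 1 the Gamma integrand is at least t^a exp (- (t + 1)). The
    bound trades a power of t for a Gamma factor that cancels the one in the denominator of the
    Mittag-Leffler terms; at t = 1 it also yields positivity of [Gamma]. *)
Lemma Gamma_ge (a t : R) : 0 <= a -> 0 <= t ->
  t `^ a <= expR (t + 1) * Gamma (a + 1).
Proof.
move=> a0 t0; rewrite -ler_pdivrMl ?expR_gt0// -expRN -lee_fin -GammaE//.
apply: (@le_trans _ _ (\int[mu]_(u in `[t, (t + 1)%R]) (t `^ a * expR (- (t + 1)))%:E)%E).
  rewrite integral_cst//= lebesgue_measure_itv/= lte_fin ltrDl ltr01.
  by rewrite -EFinD [t + 1]addrC addrK mule1 lee_fin mulrC.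
apply: (@le_trans _ _ (\int[mu]_(u in `[t, (t + 1)%R]) (u `^ a * expR (- u))%:E)%E).
  apply: ge0_le_integral => //.
  - by move=> x _; rewrite lee_fin mulr_ge0 ?powR_ge0 ?expR_ge0.
  - by apply/measurable_EFinP; exact: measurable_Gamma_integrand.
  - move=> x /=; rewrite in_itv/= => /andP[tx xt]; rewrite lee_fin.
    apply: ler_pM; rewrite ?powR_ge0 ?expR_ge0//.
      exact: ler_powR_base.
    by rewrite ler_expR lerN2.
apply: ge0_subset_integral => //.
- by apply/measurable_EFinP; exact: measurable_Gamma_integrand.
- by move=> x _; rewrite lee_fin mulr_ge0 ?powR_ge0 ?expR_ge0.
- by move=> x /=; rewrite !in_itv/= andbT => /andP[tx _]; exact: le_trans tx.
Qed.

Lemma Gamma_gt0 (a : R) : 0 <= a -> 0 < Gamma (a + 1).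
Proof.
move=> a0; have := @Gamma_ge a 1 a0 ler01; rewrite powR1 => H.
by have := lt_le_trans ltr01 H; rewrite pmulr_rgt0// expR_gt0.
Qed.

Lemma integral_powR_expR (a v : R) : 0 <= a -> 0 < v ->
  (\int[mu]_(u in `[0%R, +oo[) (u `^ a * expR (- (v * u)))%:E
   = (Gamma (a + 1) / v `^ (a + 1))%:E)%E.
Proof.
move=> a0 v0.
have -> : (\int[mu]_(u in `[0%R, +oo[) (u `^ a * expR (- (v * u)))%:E =
   \int[mu]_(u in `[0%R, +oo[) ((v `^ a)^-1%:E * ((v * u) `^ a * expR (- (v * u)))%:E))%E.
  apply: eq_integral => u; rewrite inE/= in_itv/= andbT => u0.
  by rewrite -EFinM (powRM _ (ltW v0) u0) -mulrA mulKf// gt_eqF ?powR_gt0.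
rewrite ge0_integralZl//; last first.
- by rewrite lee_fin invr_ge0 powR_ge0.
- by move=> u _; rewrite lee_fin mulr_ge0 ?powR_ge0 ?expR_ge0.
- apply/measurable_EFinP/measurable_funTS; apply: (@measurableT_comp _ _ _ _ _ _
    (fun u => u `^ a * expR (- u)) _ (fun u => v * u)); last exact: measurable_funM.
  exact: measurable_Gamma_integrand.
rewrite (@ge0_integral_scale v (fun u => (u `^ a * expR (- u))%:E))//; last first.
- by move=> u; rewrite lee_fin mulr_ge0 ?powR_ge0 ?expR_ge0.
- by apply/measurable_EFinP; exact: measurable_Gamma_integrand.
rewrite GammaE// -!EFinM powRD; last by rewrite (gt_eqF v0) implybT.
rewrite powRr1 ?ltW// invfM; congr EFin; ring.
Qed.

End Gamma_function.

(** Dominated convergence applied to partial sums. The majorant bounds the partial sums and not the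
    terms; each term is integrable as the difference of two consecutive partial sums. *)
Lemma cvg_series_Rintegral {R : realType} d (T : measurableType d)
    (m : {measure set T -> \bar R}) (D : set T) (f : nat -> T -> R) (S M : T -> R) :
  measurable D -> (forall n, measurable_fun D (f n)) ->
  (forall x, D x -> series (f^~ x) @ \oo --> S x) ->
  (forall n x, D x -> `|series (f^~ x) n| <= M x) ->
  m.-integrable D (EFin \o M) ->
  m.-integrable D (EFin \o S) /\
  series (fun n => Rintegral m D (f n)) @ \oo --> Rintegral m D S.
Proof.
move=> mD mf fS fM iM.
have mser n : measurable_fun D (fun x => series (f^~ x) n).
  rewrite /series/=; apply: measurable_sum => i; exact: mf.
have mS : measurable_fun D S.
  by apply: (@measurable_fun_cvg _ _ _ D (fun n x => series (f^~ x) n)).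
have iser n : m.-integrable D (EFin \o (fun x => series (f^~ x) n)).
  apply: le_integrable iM => //; first exact/measurable_EFinP.
  move=> x Dx /=; rewrite lee_fin (le_trans (fM _ _ Dx))// ler_norm//.
have if_ n : m.-integrable D (EFin \o f n).
  have -> : EFin \o f n = ((EFin \o (fun x => series (f^~ x) n.+1)) \- (EFin \o (fun x => series (f^~ x) n)))%E.
    by apply/funext => x /=; rewrite -EFinB seriesSB.
  exact: integrableB.
have [iS _ cS] : [/\ m.-integrable D (EFin \o S),
   [sequence (\int[m]_(x in D) `|(EFin \o (fun x => series (f^~ x) n)) x - (EFin \o S) x|)%E]_n @ \oo --> 0%E
   & [sequence (\int[m]_(x in D) (EFin \o (fun x => series (f^~ x) n)) x)%E]_n @ \oo
      --> (\int[m]_(x in D) (EFin \o S) x)%E].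
  apply: (@dominated_convergence _ _ _ m D mD _ _ (EFin \o M)) => //.
  - by move=> n; apply/measurable_EFinP.
  - exact/measurable_EFinP.
  - by apply: aeW => x Dx; apply: cvg_EFin; [exact: nearW|exact: fS].
  - by apply: aeW => x n Dx; rewrite /= lee_fin fM.
split=> //.
have -> : series (fun n => Rintegral m D (f n)) =
    fine \o [sequence (\int[m]_(x in D) (EFin \o (fun x => series (f^~ x) n)) x)%E]_n.
  apply/funext => n /=; elim: n => [|n IH].
    rewrite /series/= big_geq//; under eq_integral do rewrite big_geq//.
    by rewrite integral0.
  rewrite seriesSr IH.
  under [in RHS]eq_integral do rewrite seriesSr EFinD.
  by rewrite (integralD mD (iser n) (if_ n))
    (fineD (integrable_fin_num mD (iser n)) (integrable_fin_num mD (if_ n))).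
apply: fine_cvg; rewrite fineK//; exact: (integrable_fin_num mD iS).
Qed.

(** * Injectivity of the Laplace transform *)

Section Laplace_uniqueness.
Context {R : realType}.
Local Notation mu := (@lebesgue_measure R).

Lemma bernoulli_ineq (y : R) (N : nat) : 0 <= y <= 1 -> 1 - N%:R * y <= (1 - y) ^+ N.
Proof.
move=> /andP[y0 y1]; elim: N => [|N IH]; first by rewrite mul0r subr0 expr0.
rewrite exprSr; apply: le_trans (ler_wpM2r _ IH); last by rewrite subr_ge0.
rewrite -subr_ge0 -natr1 (_ : _ - _ = N%:R * y ^+ 2); last by ring.
by rewrite mulr_ge0// sqr_ge0.
Qed.

Lemma bernoulli_ineq_add (y : R) (N : nat) : 0 <= y -> 1 + N%:R * y <= (1 + y) ^+ N.
Proof.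
move=> y0; elim: N => [|N IH]; first by rewrite mul0r addr0 expr0.
rewrite exprSr; apply: le_trans (ler_wpM2r _ IH); last by rewrite addr_ge0.
rewrite -subr_ge0 -natr1 (_ : _ - _ = N%:R * y ^+ 2); last by ring.
by rewrite mulr_ge0// sqr_ge0.
Qed.

(** Bernoulli's inequality bounds the expression below by 1 - 2^n x^n, and (2 x)^n tends to 0. *)
Lemma cvg_threshold1 (x : R) : 0 <= x -> 2 * x < 1 ->
  (1 - x ^+ n) ^+ (2 ^ n) @[n --> \oo] --> (1 : R).
Proof.
move=> x0 x2.
have x1 : x <= 1 by lra.
apply: (@squeeze_cvgr _ _ _ _ (fun n => 1 - (2 * x) ^+ n) (fun=> 1)).
- apply: nearW => n; have y0 : 0 <= x ^+ n by exact: exprn_ge0.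
  have y1 : x ^+ n <= 1 by exact: exprn_ile1.
  rewrite exprMn -natrX bernoulli_ineq ?y0 ?y1//=.
  by apply: exprn_ile1; [rewrite subr_ge0|rewrite gerBl].
- rewrite -[X in _ --> X]subr0; apply: cvgB; first exact: cvg_cst.
  by apply: cvg_expr; rewrite ger0_norm ?mulr_ge0.
- exact: cvg_cst.
Qed.

(** With y = x^n and N = 2^n, Bernoulli gives (1 - y)^N N y <= (1 - y)^N (1 + y)^N = (1 - y^2)^N <=
    1, and N y = (2 x)^n tends to infinity. *)
Lemma cvg_threshold0 (x : R) : 0 < x -> x <= 1 -> 1 < 2 * x ->
  (1 - x ^+ n) ^+ (2 ^ n) @[n --> \oo] --> (0 : R).
Proof.
move=> x0 x1 x2.
apply: (@squeeze_cvgr _ _ _ _ (fun=> 0) (fun n => ((2 * x)^-1) ^+ n)).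
- apply: nearW => n; have y0 : 0 <= x ^+ n by rewrite exprn_ge0// ltW.
  have y1 : x ^+ n <= 1 by rewrite exprn_ile1// ltW.
  have q0 : 0 <= (1 - x ^+ n) ^+ (2 ^ n) by rewrite exprn_ge0// subr_ge0.
  rewrite q0/= exprVn -[leRHS]mul1r ler_pdivlMr ?exprn_gt0 ?mulr_gt0//.
  rewrite exprMn -natrX.
  apply: (@le_trans _ _ ((1 - x ^+ n) ^+ (2 ^ n) * (1 + x ^+ n) ^+ (2 ^ n))).
    rewrite ler_wpM2l//.
    by apply: le_trans (bernoulli_ineq_add _ y0); rewrite lerDr.
  rewrite -exprMn -subr_sqr expr1n exprn_ile1//.
    by rewrite subr_ge0 exprn_ile1.
  by rewrite gerBl sqr_ge0.
- exact: cvg_cst.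
- apply: cvg_expr; rewrite ger0_norm ?invf_lt1 ?invr_ge0 ?mulr_ge0//; lra.
Qed.

Variables (h : R -> R) (v1 : R).
Hypothesis mh : measurable_fun setT h.
Hypothesis ih : mu.-integrable `[0%R, +oo[ (fun t => (expR (- (v1 * t)) * h t)%:E).
Hypothesis h0 : forall v, v1 <= v ->
  Rintegral mu `[0%R, +oo[ (fun t => expR (- (v * t)) * h t) = 0.

Let g (v c : R) (m : nat) t := expR (- (v * t)) * (1 - expR (- (c * t))) ^+ m * h t.

Let mexp (v : R) : measurable_fun setT (fun t : R => expR (- (v * t))).
Proof. exact: measurable_expRN. Qed.

Let mg v c m : measurable_fun setT (g v c m).
Proof.
apply: measurable_funM => //; apply: measurable_funM => //.
by apply: measurable_funX; apply: measurable_funB.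
Qed.

Let gle v c m t : v1 <= v -> 0 <= c -> 0 <= t -> `|g v c m t| <= `|expR (- (v1 * t)) * h t|.
Proof.
move=> vv c0 t0; rewrite /g 2!normrM [leRHS]normrM ler_wpM2r//.
have e1 : expR (- (c * t)) <= 1 by rewrite -expR0 ler_expR oppr_le0 mulr_ge0.
rewrite !ger0_norm ?expR_ge0// ?mulr_ge0 ?expR_ge0 ?exprn_ge0 ?subr_ge0//.
rewrite -[leRHS]mulr1 ler_pM ?expR_ge0 ?exprn_ge0 ?subr_ge0//.
  by rewrite ler_expR lerN2 ler_wpM2r.
by rewrite exprn_ile1 ?subr_ge0// gerBl expR_ge0.
Qed.

Let ig v c m : v1 <= v -> 0 <= c -> mu.-integrable `[0%R, +oo[ (EFin \o g v c m).
Proof.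
move=> vv c0; apply: le_integrable ih => //.
  by apply/measurable_EFinP; apply: measurable_funTS; exact: mg.
by move=> t /=; rewrite in_itv/= andbT => t0; rewrite lee_fin gle.
Qed.

(** Expanding one factor 1 - exp (- c t) turns [g v c m.+1] into [g v c m] minus [g (v + c) c m].
    The rates only grow, so vanishing of the transform on the half-line from [v1] is enough. *)
Let ig0 v c m : v1 <= v -> 0 <= c -> Rintegral mu `[0%R, +oo[ (g v c m) = 0.
Proof.
elim: m v => [|m IH] v vv c0.
  by rewrite -[RHS](h0 vv); apply: eq_Rintegral => t _; rewrite /g expr0 mulr1.
have vc : v1 <= v + c by rewrite (le_trans vv)// lerDl.
rewrite -[RHS]subr0 -[X in _ = X - _](IH _ vv c0) -[X in _ = _ - X](IH _ vc c0).
rewrite -RintegralB//; [|exact: ig|exact: ig].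
apply: eq_Rintegral => t _; rewrite /g exprS.
rewrite (_ : - ((v + c) * t) = - (v * t) + - (c * t)) ?expRD; ring.
Qed.

(* The polynomials (1 - x^n)^(2^n) in x = exp (- s t) tend to the indicator of
   2 x < 1, that is of t > a for s = ln 2 / a. *)
Lemma laplace0_tail (a : R) : 0 < a ->
  (\int[mu]_(t in `]a, +oo[) (expR (- (v1 * t)) * h t)%:E = 0)%E.
Proof.
move=> a0; pose s := ln 2 / a.
have ln20 : 0 < ln 2 :> R by rewrite ln_gt0// ltr1n.
have s0 : 0 < s by rewrite divr_gt0.
(* The null point [a] is removed: there x = 1/2, and the thresholds tend to 1/e, neither 0 nor 1. *)
pose D := `[0%R, +oo[%classic `\ a.
have mD : measurable D by apply: measurableD.
pose F t := if a < t then expR (- (v1 * t)) * h t else 0.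
have cF t : D t -> g v1 (n%:R * s) (2 ^ n) t @[n --> \oo] --> F t.
  move=> [/=]; rewrite in_itv/= andbT => t0 /eqP ta.
  have E n : expR (- (n%:R * s * t)) = expR (- (s * t)) ^+ n.
    by rewrite -expRM_natl; congr expR; ring.
  have -> : (fun n => g v1 (n%:R * s) (2 ^ n) t) =
      (fun n => (expR (- (v1 * t)) * h t) * (1 - expR (- (s * t)) ^+ n) ^+ (2 ^ n)).
    by apply/funext => n; rewrite /g E mulrAC.
  rewrite /F; case: ltgtP ta => // tat _.
  - rewrite -[X in _ --> X]mulr1; apply: cvgM; first exact: cvg_cst.
    apply: cvg_threshold1; first exact: expR_ge0.
    rewrite mulrC -ltr_pdivlMr// mul1r -[ltRHS]lnK ?posrE ?invr_gt0//.
    by rewrite ltr_expR lnV ?posrE// ltrN2 /s mulrAC ltr_pdivlMr// ltr_pM2l.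
  - rewrite -[X in _ --> X](mulr0 (expR (- (v1 * t)) * h t)).
    apply: cvgM; first exact: cvg_cst.
    apply: cvg_threshold0; first exact: expR_gt0.
      by rewrite -expR0 ler_expR oppr_le0 mulr_ge0 ?(ltW s0).
    rewrite mulrC -ltr_pdivrMr// mul1r -[ltLHS]lnK ?posrE ?invr_gt0//.
    by rewrite ltr_expR lnV ?posrE// ltrN2 /s mulrAC ltr_pdivrMr// ltr_pM2l.
have mF : measurable_fun setT F.
  apply: measurable_fun_ifT => //.
    exact: measurable_fun_ltr.
  exact: measurable_funM.
have ns n : 0 <= n%:R * s by rewrite mulr_ge0// ltW.
have [_ _] : [/\ mu.-integrable D (EFin \o F),
   [sequence (\int[mu]_(x in D) `|(EFin \o g v1 (n%:R * s) (2 ^ n)) x - (EFin \o F) x|)%E]_n @ \oo --> 0%E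
   & [sequence (\int[mu]_(x in D) (EFin \o g v1 (n%:R * s) (2 ^ n)) x)%E]_n @ \oo
      --> (\int[mu]_(x in D) (EFin \o F) x)%E].
  apply: (@dominated_convergence _ _ _ mu D mD _ _ (fun t => `|(expR (- (v1 * t)) * h t)%:E|)%E).
  - by move=> n; apply/measurable_EFinP; apply: measurable_funTS; exact: mg.
  - by apply/measurable_EFinP; apply: measurable_funTS.
  - by apply: aeW => x Dx; apply: cvg_EFin; [exact: nearW|exact: cF].
  - apply: integrable_abse; apply: integrableS ih => //; exact: subDsetl.
  - apply: aeW => t n [/=]; rewrite in_itv/= andbT => t0 _.
    by rewrite lee_fin gle.
have -> : [sequence (\int[mu]_(x in D) (EFin \o g v1 (n%:R * s) (2 ^ n)) x)%E]_n = fun=> 0%E.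
  apply/funext => n /=; rewrite integral_setD1//; last first.
    by apply/measurable_EFinP; apply: measurable_funTS; exact: mg.
  have := integrable_fin_num _ (@ig v1 (n%:R * s) (2 ^ n)%N (lexx _) (ns n)).
  move=> /(_ _) /fineK => <-//; congr EFin; exact: ig0.
move=> /(cvg_unique _ (cvg_cst _)) => /(_ (@ereal_hausdorff _)) H.
rewrite [RHS]H [RHS]integral_mkcond [LHS]integral_mkcond; apply: eq_integral => t _.
rewrite /patch /F; have -> : t \in D = (0 <= t) && (t != a).
  apply/idP/idP => [/set_mem[/=]|/andP[t0 ta]].
    by rewrite in_itv/= andbT => -> /eqP ->.
  by apply/mem_set; split; [rewrite /= in_itv/= t0|exact/eqP].
rewrite mem_setE in_itv/= andbT.
case: ltP => // at_; last by case: ifP.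
by rewrite (le_trans (ltW a0) (ltW at_)) gt_eqF.
Qed.

(** The tails beyond [a] and beyond [b] both vanish, hence so does the integral over []a, b]], which
    a lower bound [m] on [h] would make at least exp (- v1 b) m (b - a). *)
Lemma laplace0_not_pos (a b m : R) : 0 <= v1 -> 0 < a -> a < b -> 0 < m ->
  ~ (forall t, a <= t <= b -> m <= h t).
Proof.
move=> v10 a0 ab m0 hm; pose hh t := expR (- (v1 * t)) * h t.
have iS (A : set R) : measurable A -> A `<=` `[0%R, +oo[%classic -> mu.-integrable A (EFin \o hh).
  by move=> mA A0; apply: integrableS ih.
have T c : 0 < c -> Rintegral mu `]c, +oo[ hh = 0.
  by move=> c0; rewrite /Rintegral laplace0_tail.
have s0 : `]a, b]%classic `<=` `[0%R, +oo[%classic.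
  by move=> t /=; rewrite !in_itv/= andbT => /andP[/ltW/(le_trans (ltW a0))].
have ab0 : Rintegral mu `]a, b] hh = 0.
  have := @Rintegral_itvB _ hh (BRight a) +oo%O b.
  rewrite T// T ?(lt_trans a0)// sub0r => H.
  apply/eqP; rewrite -oppr_eq0; apply/eqP; apply: H => //; last by rewrite bnd_simp ltW.
  by apply: iS => // t /=; rewrite !in_itv/= !andbT => /ltW/(le_trans (ltW a0)).
have : 0 < (expR (- (v1 * b)) * m) * (b - a).
  by rewrite !mulr_gt0 ?expR_gt0// subr_gt0.
apply/negP; rewrite -leNgt -ab0.
have -> : expR (- (v1 * b)) * m * (b - a) =
    Rintegral mu `]a, b] (fun=> expR (- (v1 * b)) * m).
  by rewrite Rintegral_cst//= lebesgue_measure_itv/= lte_fin ab.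
apply: le_Rintegral => //.
- apply: measurable_bounded_integrable => //.
    by rewrite /= lebesgue_measure_itv/= lte_fin ab -EFinD ltry.
  exact: bounded_cst.
- exact: iS.
- move=> t /=; rewrite in_itv/= => /andP[/ltW at_ tb].
  apply: ler_pM; [exact: expR_ge0|exact: ltW| |by apply: hm; rewrite at_ tb].
  by rewrite ler_expR lerN2 ler_wpM2l.
Qed.
End Laplace_uniqueness.

Section Laplace_injective.
Context {R : realType}.
Local Notation mu := (@lebesgue_measure R).

(** A gap at one point spreads to an interval: if F t > G t, monotonicity of [F] keeps half of the
    gap to the right of [t]; if F t < G t, to the left. Equality thus holds at every positive [t],
    and not merely almost everywhere. *)
Lemma laplace_inj_nondecreasing (F G : R -> R) (v1 : R) : 0 < v1 ->
  {homo F : x y / x <= y} -> measurable_fun (`[0%R, +oo[%classic : set R) G ->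
  {in `]0, +oo[, continuous G} ->
  mu.-integrable `[0%R, +oo[ (fun t => (expR (- (v1 * t)) * F t)%:E) ->
  mu.-integrable `[0%R, +oo[ (fun t => (expR (- (v1 * t)) * G t)%:E) ->
  (forall v, v1 <= v -> laplace F v = laplace G v) ->
  forall t, 0 < t -> F t = G t.
Proof.
move=> v10 ndF mG cG iF iG FG t t0.
(* The indicator makes [h] measurable on the whole line, as [G] is controlled on the half-line
   only. *)
pose h s := (F s - G s) * \1_(`[0%R, +oo[%classic : set R) s.
have hE s : 0 <= s -> h s = F s - G s.
  by move=> s0; rewrite /h indicE mem_set ?mulr1//= in_itv/= andbT.
have mh : measurable_fun setT h.
  rewrite (_ : h = (fun s => F s - G s) \_ (`[0%R, +oo[%classic : set R)); last first.
    by apply/funext => s; rewrite /h /patch indicE; case: ifP; rewrite ?mulr1 ?mulr0.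
  apply/(@measurable_restrictT _ _ _ _ _ (fun s => F s - G s)) => //.
  by apply: measurable_funB => //; apply: measurable_funTS; exact: nondecreasing_measurable.
have ihv v : v1 <= v -> mu.-integrable `[0%R, +oo[ (fun t => (expR (- (v * t)) * F t)%:E) /\
    mu.-integrable `[0%R, +oo[ (fun t => (expR (- (v * t)) * G t)%:E).
  move=> v1v.
  have me : measurable_fun (`[0%R, +oo[%classic : set R) (fun s : R => expR (- (v * s))).
    exact: measurable_expRN.
  split; [apply: le_integrable iF|apply: le_integrable iG] => //.
  - apply/measurable_EFinP/measurable_funM => //; apply: measurable_funTS.
    exact: nondecreasing_measurable.
  - move=> s /=; rewrite in_itv/= andbT => s0; rewrite lee_fin !normrM ler_wpM2r//.
    by rewrite !ger0_norm ?expR_ge0// ler_expR lerN2 ler_wpM2r.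
  - by apply/measurable_EFinP/measurable_funM.
  - move=> s /=; rewrite in_itv/= andbT => s0; rewrite lee_fin !normrM ler_wpM2r//.
    by rewrite !ger0_norm ?expR_ge0// ler_expR lerN2 ler_wpM2r.
have ih : mu.-integrable `[0%R, +oo[ (fun t => (expR (- (v1 * t)) * h t)%:E).
  apply: (@eq_integrable _ _ _ mu `[0%R, +oo[ _ _ _ _ (integrableB _ iF iG)) => // s.
  by rewrite inE/= in_itv/= andbT => s0; rewrite hE// mulrBr EFinB.
have h0 v : v1 <= v -> Rintegral mu `[0%R, +oo[ (fun t => expR (- (v * t)) * h t) = 0.
  move=> vv; have [iFv iGv] := ihv _ vv.
  rewrite -[RHS](subrr (laplace F v)) [X in _ = _ - X]FG// /laplace -RintegralB//.
  apply: eq_Rintegral => s.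
  by rewrite inE/= in_itv/= andbT => s0; rewrite hE// mulrBr.
have mNh : measurable_fun setT (- h) by exact: measurableT_comp.
have iNh : mu.-integrable `[0%R, +oo[ (fun t => (expR (- (v1 * t)) * (- h) t)%:E).
  apply: (@eq_integrable _ _ _ mu `[0%R, +oo[ _ _ _ _ (integrableN ih)) => // s _.
  by rewrite /= mulrN EFinN.
have h0N v : v1 <= v -> Rintegral mu `[0%R, +oo[ (fun t => expR (- (v * t)) * (- h) t) = 0.
  move=> vv; have [iFv iGv] := ihv _ vv.
  rewrite -[RHS](subrr (laplace F v)) [X in _ = X - _]FG// /laplace -RintegralB//.
  apply: eq_Rintegral => s.
  rewrite inE/= in_itv/= andbT => s0.
  by rewrite -[(- h) s]/(- h s) hE// -mulrBr opprB.
have nearG e : 0 < e -> exists2 d, 0 < d & forall s, `|s - t| <= d -> 0 < s /\ `|G s - G t| < e.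
  move=> e0.
  have /cvgrPdist_lt /(_ _ e0) : G x @[x --> t] --> G t.
    by apply: cG; rewrite in_itv/= t0.
  move=> /nbhs_ballP[d /= d0 Hd]; exists (Num.min (d / 2) (t / 2)).
    by rewrite lt_min !divr_gt0.
  move=> s; rewrite le_min => /andP[sd st]; split.
    have := ler_norm (t - s); rewrite distrC => /le_trans/(_ st) ?; lra.
  rewrite distrC; apply: Hd; rewrite /ball/= distrC (le_lt_trans sd)//.
  by rewrite ltr_pdivrMr// ltr_pMr// ltr1n.
apply/eqP; rewrite eq_le !leNgt; apply/andP; split; apply/negP => lt_.
- have e0 : 0 < (F t - G t) / 2 by rewrite divr_gt0// subr_gt0.
  have [d d0 Hd] := nearG _ e0.
  apply: (@laplace0_not_pos _ h v1 mh ih h0 t (t + d) _ (ltW v10) t0 _ e0).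
    by rewrite ltrDl.
  move=> s /andP[ts sd].
  have /Hd[s0 Gs] : `|s - t| <= d by rewrite ger0_norm ?subr_ge0// lerBlDl.
  rewrite hE ?ltW//; have := ndF _ _ ts; move: Gs; rewrite ltr_norml => /andP[? ?] ?; lra.
- have e0 : 0 < (G t - F t) / 2 by rewrite divr_gt0// subr_gt0.
  have [d d0 Hd] := nearG _ e0.
  have [td0 _] : 0 < t - d /\ `|G (t - d) - G t| < (G t - F t) / 2.
    by apply: Hd; rewrite addrAC subrr sub0r normrN gtr0_norm.
  apply: (@laplace0_not_pos _ (- h) v1 mNh iNh h0N (t - d) t _ (ltW v10) td0 _ e0).
    by rewrite gtrBl.
  move=> s /andP[ts sd].
  have /Hd[s0 Gs] : `|s - t| <= d by rewrite ler0_norm ?subr_le0// opprB lerBlDr -lerBlDl.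
  rewrite -[(- h) s]/(- h s) hE ?ltW//; have := ndF _ _ sd.
  move: Gs; rewrite ltr_norml => /andP[? ?] ?; lra.
Qed.
End Laplace_injective.

(** * Mittag-Leffler series *)

Section series_lemmas.
Context {R : realType}.

Lemma series_tail_le (f m : nat -> R) (n N : nat) : (N <= n)%N ->
  (forall n, `|f n| <= m n) ->
  `|series f n - series f N| <= series m n - series m N.
Proof.
move=> Nn fm; rewrite !sub_series_geq//.
by apply: le_trans (ler_norm_sum _ _ _) _; exact: ler_sum.
Qed.

Lemma dominated_series_cvg (f m : nat -> R) :
  (forall n, `|f n| <= m n) -> cvgn (series m) -> cvgn (series f).
Proof.
move=> fm cm; apply: normed_cvg; apply: (series_le_cvg _ _ fm cm) => n.
  exact: normr_ge0.
exact: le_trans (fm n).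
Qed.

Lemma series_norm_le (f m : nat -> R) n :
  (forall n, `|f n| <= m n) -> cvgn (series m) -> `|series f n| <= limn (series m).
Proof.
move=> fm cm; have := @series_tail_le f m n 0 (leq0n n) fm.
rewrite [series f 0]/series/= big_geq// subr0 => /le_trans; apply.
rewrite [series m 0]/series/= big_geq// subr0; apply: nondecreasing_cvgn_le => //.
by apply/nondecreasing_seqP => k; rewrite seriesSr lerDl (le_trans _ (fm k)).
Qed.

Lemma series_limn_tail_le (f m : nat -> R) N :
  (forall n, `|f n| <= m n) -> cvgn (series m) ->
  `|limn (series f) - series f N| <= limn (series m) - series m N.
Proof.
move=> fm cm; have cf := dominated_series_cvg fm cm.
have H : (fun n => `|series f n - series f N|) @ \oo --> `|limn (series f) - series f N|.
  by apply: cvg_norm; apply: cvgB => //; exact: cvg_cst.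
have H' : (fun n => series m n - series m N) @ \oo --> limn (series m) - series m N.
  by apply: cvgB => //; exact: cvg_cst.
rewrite -(cvg_lim _ H)// -(cvg_lim _ H')//.
apply: ler_lim; [by apply/cvg_ex; eexists; exact: H|by apply/cvg_ex; eexists; exact: H'|].
by near=> n; apply: series_tail_le => //; near: n; exact: nbhs_infty_ge.
Unshelve. all: by end_near. Qed.

(** Weierstrass test on a ball: the tail of [m] controls the remainders at [s] and at [t], and the
    partial sums up to [N] are continuous. A local form is needed because the majorants used below
    grow exponentially in the variable. *)
Lemma continuous_limn_series (f : nat -> R -> R) (m : nat -> R) (t d : R) : 0 < d ->
  (forall n s, `|s - t| < d -> `|f n s| <= m n) -> cvgn (series m) ->
  (forall n, {for t, continuous (f n)}) ->
  {for t, continuous (fun s => limn (series (f^~ s)))}.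
Proof.
move=> d0 fm cm cf; apply/cvgrPdist_lt => e e0.
have e3 : 0 < e / 3 by rewrite divr_gt0.
have [N HN] : exists N, limn (series m) - series m N < e / 3.
  have /cvgrPdist_lt /(_ _ e3) [N _ HN] := cm; exists N.
  by apply: le_lt_trans (HN N (leqnn N)); exact: ler_norm.
have cN k : series (f^~ s) k @[s --> t] --> series (f^~ t) k.
  elim: k => [|k IH].
    rewrite [X in _ --> X]/series/= big_geq// (_ : (fun _ => _) = fun=> 0).
      exact: cvg_cst.
    by apply/funext => s; rewrite /series/= big_geq.
  rewrite seriesSr (_ : (fun _ => _) = (fun s => series (f^~ s) k + f k s)).
    by apply: cvgD => //; exact: cf.
  by apply/funext => s; rewrite seriesSr.
have /cvgrPdist_lt /(_ _ e3) HcN := cN N.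
have T s : `|s - t| < d -> `|limn (series (f^~ s)) - series (f^~ s) N| < e / 3.
  by move=> st; apply: le_lt_trans HN; apply: series_limn_tail_le => // n; exact: fm.
near=> s.
have st : `|s - t| < d.
  by rewrite distrC; near: s; exists d => //= s; rewrite /ball/=.
have tt : `|t - t| < d by rewrite subrr normr0.
have H1 := T _ st; have H2 := T _ tt.
have H3 : `|series (f^~ t) N - series (f^~ s) N| < e / 3 by near: s.
rewrite (_ : limn _ - limn _ = (limn (series (f^~ t)) - series (f^~ t) N) +
  (series (f^~ t) N - series (f^~ s) N) - (limn (series (f^~ s)) - series (f^~ s) N)); last by ring.
apply: le_lt_trans (ler_normB _ _) _; apply: le_lt_trans (lerD (ler_normD _ _) (lexx _)) _.
lra.
Unshelve. all: by end_near. Qed.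

Lemma continuous_powR (p t : R) : 0 < t -> {for t, continuous (fun s : R => s `^ p)}.
Proof.
move=> t0; apply: differentiable_continuous; apply/derivable1_diffP.
by apply: derivable_powR; rewrite in_itv/= t0.
Qed.

End series_lemmas.

Section negative_binomial.
Context {R : realType}.
Local Notation mu := (@lebesgue_measure R).

Lemma powR_addn (a u : R) (j : nat) : 0 <= a -> 0 <= u ->
  u `^ (a + j%:R) = u `^ a * u ^+ j.
Proof.
case: j => [|j] a0 u0; first by rewrite addr0 mulr1.
rewrite powRD ?powR_mulrn// gt_eqF//=.
by rewrite ltr_wpDl// ltr0n.
Qed.

Lemma series_exp_coeff_le (x : R) n : `|series (exp_coeff x) n| <= expR `|x|.
Proof.
apply: series_norm_le; last exact: is_cvg_series_exp_coeff.
by move=> k; rewrite /exp_coeff normrM normrX [`|_^-1|]ger0_norm// invr_ge0.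
Qed.

(* Integrate the exponential series of exp (y u) against u^a exp (- u). *)
Lemma negative_binomial_series (a y : R) : 0 <= a -> `|y| < 1 ->
  series (fun j => Gamma (a + 1 + j%:R) * y ^+ j / (j`!%:R * Gamma (a + 1))) @ \oo
    --> ((1 - y) `^ (a + 1))^-1.
Proof.
move=> a0 y1.
pose f j u := u `^ a * expR (- u) * exp_coeff (y * u) j.
pose S u := u `^ a * expR (- ((1 - y) * u)).
pose M u := u `^ a * expR (- ((1 - `|y|) * u)).
have ypos : 0 < 1 - y by rewrite subr_gt0 (le_lt_trans (ler_norm _)).
have int_ (v : R) : 0 < v -> mu.-integrable `[0%R, +oo[ (EFin \o (fun u => u `^ a * expR (- (v * u)))).
  move=> v0; apply/integrableP; split.
    apply/measurable_EFinP; exact: measurable_powR_expR.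
  under eq_integral do rewrite gee0_abs ?lee_fin ?mulr_ge0 ?powR_ge0 ?expR_ge0//.
  by rewrite integral_powR_expR// ltry.
have serE u n : series (f^~ u) n = u `^ a * expR (- u) * series (exp_coeff (y * u)) n.
  by rewrite /series/= big_distrr.
have mf n : measurable_fun (`[0%R, +oo[%classic : set R) (f n).
  apply: measurable_funM; first exact: measurable_Gamma_integrand.
  apply: measurable_funM => //; apply: measurable_funX; exact: measurable_funM.
have [|||_] := @cvg_series_Rintegral R _ _ mu `[0%R, +oo[%classic f S M (measurable_itv _) mf.
- move=> u /=; rewrite in_itv/= andbT => u0.
  rewrite (_ : series (f^~ u) = (fun n => u `^ a * expR (- u) * series (exp_coeff (y * u)) n)); last first.
    by apply/funext => n; rewrite serE.
  rewrite (_ : S u = u `^ a * expR (- u) * expR (y * u)).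
    by apply: cvgM; [exact: cvg_cst|exact: is_cvg_series_exp_coeff].
  by rewrite /S -mulrA -expRD; congr (_ * expR _); ring.
- move=> n u /=; rewrite in_itv/= andbT => u0; rewrite serE normrM.
  rewrite [X in X * _]ger0_norm ?mulr_ge0 ?powR_ge0 ?expR_ge0//.
  rewrite /M (_ : - ((1 - `|y|) * u) = - u + `|y| * u); last by ring.
  rewrite expRD mulrA ler_wpM2l ?mulr_ge0 ?powR_ge0 ?expR_ge0//.
  by rewrite (le_trans (series_exp_coeff_le _ _))// normrM (ger0_norm u0).
- by apply: int_; rewrite subr_gt0.
have RS : Rintegral mu `[0%R, +oo[ S = Gamma (a + 1) / (1 - y) `^ (a + 1).
  by rewrite /Rintegral integral_powR_expR.
have Rf n : Rintegral mu `[0%R, +oo[ (f n) = Gamma (a + 1 + n%:R) * y ^+ n / n`!%:R.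
  have an0 : 0 <= a + n%:R by rewrite addr_ge0.
  transitivity (Rintegral mu `[0%R, +oo[ (fun u => (y ^+ n / n`!%:R) * (u `^ (a + n%:R) * expR (- u)))).
    apply: eq_Rintegral => u; rewrite inE/= in_itv/= andbT => u0.
    by rewrite powR_addn// /f /exp_coeff/= exprMn; ring.
  rewrite RintegralZl//; last exact: integrable_Gamma.
  rewrite /Rintegral GammaE//= (_ : a + n%:R + 1 = a + 1 + n%:R); ring.
rewrite RS => H.
have G0 := Gamma_gt0 a0.
rewrite (_ : series _ = fun n => (Gamma (a + 1))^-1 * series (fun n => Rintegral mu `[0%R, +oo[ (f n)) n).
  rewrite -[X in _ --> X](mulKf (lt0r_neq0 G0)).
  by apply: cvgM; [exact: cvg_cst|exact: H].
apply/funext => n; rewrite /series/= big_distrr/=; apply: eq_bigr => j _.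
by rewrite Rf invfM; ring.
Qed.
End negative_binomial.

(** * Term-by-term inversion of a sum of terms C_r / (v (c + v^nu)^delta_r) *)

Section Mittag_Leffler_inversion.
Context {R : realType}.
Local Notation mu := (@lebesgue_measure R).
Variables (nu c : R) (C : nat -> R) (dl : nat -> nat) (F : R -> R).
Hypotheses (nu0 : 0 < nu) (c0 : 0 < c).
Hypothesis C0 : forall r, 0 <= C r.
Hypothesis dl0 : forall r, (0 < dl r)%N.
Hypothesis F_nd : {homo F : x y / x <= y}.
Hypothesis F01 : forall t, 0 <= F t <= 1.
Hypothesis laplaceF : forall v, 0 < v ->
  series (fun r => C r / v / (c + v `^ nu) ^+ dl r) @ \oo --> laplace F v.

Let p r j : R := nu * ((dl r)%:R + j%:R).
Let a r j := C r * (Gamma ((dl r)%:R + j%:R) * (- c) ^+ j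
  / (j`!%:R * Gamma (dl r)%:R * Gamma (p r j + 1))).
Let term r j t := a r j * t `^ p r j.
Let g r t := limn (series (fun j => term r j t)).
Let G t := limn (series (fun r => g r t)).
(** Chosen so that v1^nu = 2 c + 1: the ratio c / v1^nu is below 1/2, and v1^nu - c = c + 1, whence
    the sum of [m r j] over [j] is exactly [M r]. *)
Let v1 : R := (2 * c + 1) `^ nu^-1.
Let m r j := C r / (v1 `^ nu) ^+ dl r *
  (Gamma ((dl r)%:R + j%:R) * (c / v1 `^ nu) ^+ j / (j`!%:R * Gamma (dl r)%:R)).
(** This is the r-th term of [laplaceF] at v = 1, so that its summability is part of the
    hypothesis. *)
Let M r := C r / (c + 1) ^+ dl r.

Let dlE r : exists2 b : R, 0 <= b & (dl r)%:R = b + 1.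
Proof.
exists (dl r).-1%:R => //.
by rewrite -[in LHS](prednK (dl0 r)) -natr1.
Qed.

Let Gamma_pos (b : R) : 1 <= b -> 0 < Gamma b.
Proof. by move=> b1; rewrite -(subrK 1 b) Gamma_gt0// subr_ge0. Qed.

Let dl1 r : 1 <= (dl r)%:R :> R.
Proof. by rewrite ler1n. Qed.

Let factR j : j`!%:R != 0 :> R.
Proof. by rewrite pnatr_eq0 -lt0n fact_gt0. Qed.

Let p_gt0 r j : 0 < p r j.
Proof. by rewrite mulr_gt0// ltr_wpDr// ltr0n. Qed.

Let v10 : 0 < v1.
Proof. by rewrite powR_gt0// ltr_wpDl// mulr_ge0// ltW. Qed.

Let v1nu : v1 `^ nu = 2 * c + 1.
Proof.
rewrite /v1 -powRrM mulVf ?gt_eqF// powRr1//.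
by rewrite addr_ge0// mulr_ge0// ltW.
Qed.

Let powR_p (v : R) r j : 0 <= v -> v `^ p r j = (v `^ nu) ^+ dl r * (v `^ nu) ^+ j.
Proof.
by move=> v0; rewrite /p powRrM -natrD powR_mulrn ?powR_ge0// exprD.
Qed.

Let m_ge0 r j : 0 <= m r j.
Proof.
rewrite /m mulr_ge0 ?divr_ge0 ?mulr_ge0 ?exprn_ge0 ?powR_ge0//.
- by apply/ltW/Gamma_pos; rewrite (le_trans (dl1 r))// lerDl.
- by rewrite divr_ge0 ?powR_ge0// ltW.
- exact/ltW/Gamma_pos.
Qed.

(** [Gamma_ge] is applied at v1 t instead of t: the extra factor v1^(- p) is what makes the
    coefficients decay geometrically in [j], at the price of growth exp (v1 t) in time. *)
Let abs_term r j t : 0 <= t -> `|term r j t| <= expR (v1 * t + 1) * m r j.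
Proof.
move=> t0.
have G1 : 0 < Gamma ((dl r)%:R + j%:R : R).
  by apply: Gamma_pos; rewrite (le_trans (dl1 r))// lerDl.
have G2 : 0 < Gamma ((dl r)%:R : R) by exact: Gamma_pos.
have G3 : 0 < Gamma (p r j + 1) by apply: Gamma_gt0; exact: ltW.
have v1p : 0 < v1 `^ p r j by rewrite powR_gt0.
have H : t `^ p r j <= expR (v1 * t + 1) * (Gamma (p r j + 1) / v1 `^ p r j).
  rewrite mulrA ler_pdivlMr// mulrC -(powRM _ (ltW v10) t0).
  by apply: Gamma_ge; [exact: ltW|rewrite mulr_ge0// ltW].
rewrite /term normrM [`|t `^ _|]ger0_norm ?powR_ge0//.
apply: le_trans (ler_wpM2l _ H) _ => //.
rewrite /a !normrM normfV !normrM normrX normrN (gtr0_norm c0).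
rewrite (ger0_norm (C0 r)) (gtr0_norm G1) (gtr0_norm G2) (gtr0_norm G3) normr_nat.
rewrite powR_p; last exact: ltW.
rewrite /m expr_div_n le_eqVlt; apply/orP; left; apply/eqP.
have v1d : v1 `^ nu ^+ dl r != 0 by rewrite expf_neq0// gt_eqF// powR_gt0.
have v1j : v1 `^ nu ^+ j != 0 by rewrite expf_neq0// gt_eqF// powR_gt0.
move: (factR j) (lt0r_neq0 G2) (lt0r_neq0 G3) v1d v1j.
move: (expR _) (Gamma (_ + j%:R)) (Gamma (dl r)%:R) (Gamma (p r j + 1)) (j`!%:R) (_ ^+ dl r) (_ ^+ j) (c ^+ j).
by move=> E g1 g2 g3 f x y z f0 g20 g30 x0 y0; field; rewrite f0 g20 g30 x0 y0.
Qed.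

(** Used twice: x = v1^nu and y = c sum the majorant, while x = v^nu and y = - c sum the transforms
    of the terms. The condition |y| < x is what restricts the second use to large [v]. *)
Let coef_series (x y : R) r : 0 < x -> `|y| < x ->
  series (fun j => C r / x ^+ dl r * (Gamma ((dl r)%:R + j%:R) * (y / x) ^+ j
      / (j`!%:R * Gamma (dl r)%:R))) @ \oo
   --> C r / (x - y) ^+ dl r.
Proof.
move=> x0 yx; have [b b0 bE] := dlE r.
have yx1 : `|y / x| < 1 by rewrite normrM normfV (gtr0_norm x0) ltr_pdivrMr// mul1r.
have := negative_binomial_series b0 yx1; rewrite -bE => H.
have xy0 : 0 < x - y by rewrite subr_gt0 (le_lt_trans (ler_norm _)).
have -> : C r / (x - y) ^+ dl r = C r / x ^+ dl r * ((1 - y / x) `^ (dl r)%:R)^-1.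
  have -> : 1 - y / x = (x - y) / x by rewrite mulrBl divff// gt_eqF.
  rewrite powR_mulrn ?divr_ge0 ?(ltW xy0) ?(ltW x0)// expr_div_n; field.
  by rewrite !expf_neq0 ?gt_eqF.
rewrite (_ : series _ = fun n => C r / x ^+ dl r * series (fun j => Gamma ((dl r)%:R + j%:R) * (y / x) ^+ j
      / (j`!%:R * Gamma (dl r)%:R)) n).
  by apply: cvgM; [exact: cvg_cst|exact: H].
by apply/funext => n; rewrite /series/= big_distrr.
Qed.

Let m_series r : series (m r) @ \oo --> M r.
Proof.
rewrite /M (_ : c + 1 = v1 `^ nu - c); last by rewrite v1nu; ring.
apply: coef_series; first by rewrite powR_gt0.
by rewrite v1nu gtr0_norm//; have := c0; lra.
Qed.

Let M_series : series M @ \oo --> laplace F 1.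
Proof.
have := laplaceF ltr01; rewrite powR1.
by rewrite (_ : (fun r => _) = M)//; apply/funext => r; rewrite divr1.
Qed.

Let M_ge0 r : 0 <= M r.
Proof. by rewrite divr_ge0 ?exprn_ge0 ?addr_ge0 ?(ltW c0). Qed.

Let cvg_term r t : 0 <= t -> series (fun j => term r j t) @ \oo --> g r t.
Proof.
move=> t0; apply: (@dominated_series_cvg _ _ (fun j => expR (v1 * t + 1) * m r j)).
  by move=> j; exact: abs_term.
by apply/is_cvg_seriesZ/cvg_ex; eexists; exact: m_series.
Qed.

Let limn_Zm r (k : R) : limn (series (fun j => k * m r j)) = k * M r.
Proof.
rewrite -[LHS]/(limn (series (k *: m r))) lim_seriesZ; last by apply/cvg_ex; eexists; exact: m_series.
by congr (_ * _); apply/cvg_lim => //; exact: m_series.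
Qed.

Let abs_g_partial r n t : 0 <= t ->
  `|series (fun j => term r j t) n| <= expR (v1 * t + 1) * M r.
Proof.
move=> t0; rewrite -limn_Zm; apply: series_norm_le => [j|]; first exact: abs_term.
by apply/is_cvg_seriesZ/cvg_ex; eexists; exact: m_series.
Qed.

Let abs_g r t : 0 <= t -> `|g r t| <= expR (v1 * t + 1) * M r.
Proof.
move=> t0.
have H : (fun n => `|series (fun j => term r j t) n|) @ \oo --> `|g r t|.
  by apply: cvg_norm; exact: cvg_term.
rewrite -(cvg_lim _ H)//; apply: limr_le; first by apply/cvg_ex; eexists; exact: H.
by apply: nearW => n; exact: abs_g_partial.
Qed.

Let cvg_g t : 0 <= t -> series (fun r => g r t) @ \oo --> G t.
Proof.
move=> t0; apply: (@dominated_series_cvg _ _ (fun r => expR (v1 * t + 1) * M r)).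
  by move=> r; exact: abs_g.
by apply/is_cvg_seriesZ/cvg_ex; eexists; exact: M_series.
Qed.

Let abs_G_partial n t : 0 <= t ->
  `|series (fun r => g r t) n| <= expR (v1 * t + 1) * laplace F 1.
Proof.
move=> t0.
have -> : expR (v1 * t + 1) * laplace F 1 = limn (series (fun r => expR (v1 * t + 1) * M r)).
  rewrite -[RHS]/(limn (series (expR (v1 * t + 1) *: M))) lim_seriesZ; last first.
    by apply/cvg_ex; eexists; exact: M_series.
  by congr (_ * _); apply/esym/cvg_lim => //; exact: M_series.
apply: series_norm_le => [r|]; first exact: abs_g.
by apply/is_cvg_seriesZ/cvg_ex; eexists; exact: M_series.
Qed.

Let continuous_g r t : 0 < t -> {for t, continuous (g r)}.
Proof.
(* A ball of radius [t] keeps [s] between 0 and 2 t, hence the constant majorant with 2 t in the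
   exponent. *)
move=> t0; apply: (@continuous_limn_series _ (term r) (fun j => expR (v1 * (2 * t) + 1) * m r j) _ t) => //.
- move=> j s; rewrite ltr_norml => /andP[s1 s2].
  have s0 : 0 <= s by lra.
  apply: le_trans (@abs_term r j s s0) _; rewrite ler_wpM2r//.
  by rewrite ler_expR lerD2r ler_wpM2l ?(ltW v10)//; lra.
- by apply/is_cvg_seriesZ/cvg_ex; eexists; exact: m_series.
- by move=> j; apply: cvgM; [exact: cvg_cst|exact: continuous_powR].
Qed.

Let continuous_G t : 0 < t -> {for t, continuous G}.
Proof.
move=> t0; apply: (@continuous_limn_series _ g (fun r => expR (v1 * (2 * t) + 1) * M r) _ t) => //.
- move=> r s; rewrite ltr_norml => /andP[s1 s2].
  have s0 : 0 <= s by lra.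
  apply: le_trans (@abs_g r s s0) _; rewrite ler_wpM2r//.
  by rewrite ler_expR lerD2r ler_wpM2l ?(ltW v10)//; lra.
- by apply/is_cvg_seriesZ/cvg_ex; eexists; exact: M_series.
- by move=> r; exact: continuous_g.
Qed.

Let Rp := (`[0%R, +oo[%classic : set R).

Let measurable_g r : measurable_fun Rp (g r).
Proof.
apply: (@measurable_fun_cvg _ _ _ Rp (fun n t => series (fun j => term r j t) n)).
  move=> n; rewrite /series/=; apply: measurable_sum => j.
  by apply: measurable_funM => //; apply: measurable_funTS; exact: measurable_powR.
by move=> t; rewrite /Rp/= in_itv/= andbT => t0; exact: cvg_term.
Qed.

Let measurable_G : measurable_fun Rp G.
Proof.
apply: (@measurable_fun_cvg _ _ _ Rp (fun n t => series (fun r => g r t) n)).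
  by move=> n; rewrite /series/=; apply: measurable_sum.
by move=> t; rewrite /Rp/= in_itv/= andbT => t0; exact: cvg_g.
Qed.

Let integrable_dom (v K : R) : v1 < v ->
  mu.-integrable Rp (EFin \o (fun t => K * expR (- ((v - v1) * t)))).
Proof.
move=> v1v; rewrite (_ : _ \o _ = fun t => (K%:E * (expR (- ((v - v1) * t)))%:E)%E)//.
by apply: integrableZl; [exact: measurable_itv|apply: integrable_expR; rewrite subr_gt0].
Qed.

Let expR_dom (v t K x : R) : `|x| <= expR (v1 * t + 1) * K ->
  `|expR (- (v * t)) * x| <= (expR 1 * K) * expR (- ((v - v1) * t)).
Proof.
move=> xK; rewrite normrM ger0_norm ?expR_ge0//.
apply: le_trans (ler_wpM2l (expR_ge0 _) xK) _.
rewrite le_eqVlt; apply/orP; left; apply/eqP.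
rewrite (_ : - ((v - v1) * t) = - (v * t) + v1 * t); last by ring.
by rewrite !expRD; ring.
Qed.

Let laplace_term (v : R) r j : 0 < v ->
  Rintegral mu Rp (fun t => expR (- (v * t)) * term r j t) =
  v^-1 * (C r / (v `^ nu) ^+ dl r * (Gamma ((dl r)%:R + j%:R) * (- c / v `^ nu) ^+ j
      / (j`!%:R * Gamma (dl r)%:R))).
Proof.
move=> v0.
have pj0 := ltW (p_gt0 r j).
have E : mu.-integrable Rp (EFin \o (fun u => u `^ p r j * expR (- (v * u)))).
  apply/integrableP; split.
    apply/measurable_EFinP; exact: measurable_powR_expR.
  under eq_integral do rewrite gee0_abs ?lee_fin ?mulr_ge0 ?powR_ge0 ?expR_ge0//.
  by rewrite integral_powR_expR// ltry.
transitivity (Rintegral mu Rp (fun t => a r j * (t `^ p r j * expR (- (v * t))))).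
  by apply: eq_Rintegral => t _; rewrite /term; ring.
rewrite RintegralZl; [|exact: measurable_itv|exact: E].
rewrite /Rintegral integral_powR_expR//= powRD; last by rewrite (gt_eqF v0) implybT.
rewrite powRr1 ?(ltW v0)// powR_p ?(ltW v0)// /a expr_div_n.
have G2 : 0 < Gamma ((dl r)%:R : R) by exact: Gamma_pos.
have G3 : 0 < Gamma (p r j + 1) by apply: Gamma_gt0.
have vd : v `^ nu ^+ dl r != 0 by rewrite expf_neq0// gt_eqF// powR_gt0.
have vj : v `^ nu ^+ j != 0 by rewrite expf_neq0// gt_eqF// powR_gt0.
move: (factR j) (lt0r_neq0 G2) (lt0r_neq0 G3) vd vj (lt0r_neq0 v0).
move: (Gamma (_ + j%:R)) (Gamma (dl r)%:R) (Gamma (p r j + 1)) (j`!%:R) (_ ^+ dl r) (_ ^+ j) ((- c) ^+ j).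
move=> g1 g2 g3 f x y z f0 g20 g30 x0 y0 v0'.
by field; rewrite f0 g20 g30 x0 y0 v0'.
Qed.

Let laplace_g (v : R) r : v1 < v ->
  mu.-integrable Rp (EFin \o (fun t => expR (- (v * t)) * g r t)) /\
  laplace (g r) v = C r / v / (c + v `^ nu) ^+ dl r.
Proof.
move=> v1v; have v0 : 0 < v by exact: lt_trans v1v.
have serE t n : series (fun j => expR (- (v * t)) * term r j t) n =
    expR (- (v * t)) * series (fun j => term r j t) n.
  by rewrite /series/= big_distrr.
have [||||iS H] := @cvg_series_Rintegral R _ _ mu Rp
   (fun j t => expR (- (v * t)) * term r j t)
   (fun t => expR (- (v * t)) * g r t) (fun t => (expR 1 * M r) * expR (- ((v - v1) * t))) (measurable_itv _).
- move=> j; apply: measurable_funM; first exact: measurable_expRN.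
  by apply: measurable_funM => //; apply: measurable_funTS; exact: measurable_powR.
- move=> t; rewrite /Rp/= in_itv/= andbT => t0.
  rewrite (_ : series _ = fun n => expR (- (v * t)) * series (fun j => term r j t) n).
    by apply: cvgM; [exact: cvg_cst|exact: cvg_term].
  by apply/funext => n; rewrite serE.
- move=> n t; rewrite /Rp/= in_itv/= andbT => t0; rewrite serE.
  by apply: expR_dom; exact: abs_g_partial.
- exact: integrable_dom.
split=> //; rewrite -[LHS](cvg_lim _ H)//; apply/cvg_lim => //.
rewrite (_ : C r / v / _ = v^-1 * (C r / (v `^ nu - - c) ^+ dl r)); last first.
  by rewrite opprK [v `^ nu + c]addrC; ring.
rewrite (_ : series _ = fun n => v^-1 * series (fun j => C r / (v `^ nu) ^+ dl r * (Gamma ((dl r)%:R + j%:R) * (- c / v `^ nu) ^+ j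
      / (j`!%:R * Gamma (dl r)%:R))) n).
  apply: cvgM; first exact: cvg_cst.
  apply: coef_series; first by rewrite powR_gt0.
  rewrite normrN gtr0_norm// (@lt_le_trans _ _ (v1 `^ nu))//.
    by rewrite v1nu; have := c0; lra.
  by apply: ler_powR_base; rewrite ltW.
by apply/funext => n; rewrite /series/= big_distrr/=; apply: eq_bigr => j _; exact: laplace_term.
Qed.

Let laplace_G (v : R) : v1 < v ->
  mu.-integrable Rp (EFin \o (fun t => expR (- (v * t)) * G t)) /\
  laplace F v = laplace G v.
Proof.
move=> v1v; have v0 : 0 < v by exact: lt_trans v1v.
have serE t n : series (fun r => expR (- (v * t)) * g r t) n =
    expR (- (v * t)) * series (fun r => g r t) n.
  by rewrite /series/= big_distrr.
have [||||iS H] := @cvg_series_Rintegral R _ _ mu Rp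
   (fun r t => expR (- (v * t)) * g r t)
   (fun t => expR (- (v * t)) * G t) (fun t => (expR 1 * laplace F 1) * expR (- ((v - v1) * t))) (measurable_itv _).
- by move=> r; apply: measurable_funM; [exact: measurable_expRN|exact: measurable_g].
- move=> t; rewrite /Rp/= in_itv/= andbT => t0.
  rewrite (_ : series _ = fun n => expR (- (v * t)) * series (fun r => g r t) n).
    by apply: cvgM; [exact: cvg_cst|exact: cvg_g].
  by apply/funext => n; rewrite serE.
- move=> n t; rewrite /Rp/= in_itv/= andbT => t0; rewrite serE.
  by apply: expR_dom; exact: abs_G_partial.
- exact: integrable_dom.
split=> //; rewrite -[RHS](cvg_lim _ H)//; apply/esym/cvg_lim => //.
rewrite (_ : series _ = series (fun r => C r / v / (c + v `^ nu) ^+ dl r)); first exact: laplaceF.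
by congr series; apply/funext => r; have [_] := @laplace_g v r v1v.
Qed.

Let integrable_laplaceF v : 0 < v -> mu.-integrable Rp (EFin \o (fun t => expR (- (v * t)) * F t)).
Proof.
move=> v0; apply: le_integrable (integrable_expR v0) => //.
  apply/measurable_EFinP/measurable_funM; first exact: measurable_expRN.
  by apply: measurable_funTS; exact: nondecreasing_measurable.
move=> t _; have /andP[Ft0 Ft1] := F01 t.
by rewrite /= lee_fin !ger0_norm ?mulr_ge0 ?expR_ge0// ler_piMr ?expR_ge0.
Qed.

Let F_eq_G t : 0 < t -> F t = G t.
Proof.
(* The majorant grows like exp (v1 t), so the transform of [G] is obtained only for v > v1; the
   comparison starts at v1 + 1. *)
have v12 : v1 < v1 + 1 by rewrite ltrDl.
have v20 : 0 < v1 + 1 by rewrite (lt_trans v10).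
move: t; apply: (laplace_inj_nondecreasing v20) => //.
- by move=> t; rewrite in_itv/= andbT => t0; exact: continuous_G.
- exact: integrable_laplaceF.
- by have [] := laplace_G v12.
- by move=> v vv; have [] := laplace_G (lt_le_trans v12 vv).
Qed.

(** The series vanishes at t = 0, so [F] must have no atom there. Monotonicity gives F 0 <= v
    laplace F v. Since every [dl r] is at least 1, comparing the series at v >= 1 with the one at 1
    term by term bounds the right-hand side by (c + 1) / (c + v^nu) times the transform at 1, which
    tends to 0. *)
Let F0 : F 0 = 0.
Proof.
apply/eqP; rewrite eq_le; have /andP[F00 _] := F01 0; rewrite F00 andbT.
have key v : 1 <= v -> F 0 <= (c + 1) / (c + v `^ nu) * laplace F 1.
  move=> v1_; have v0 : 0 < v by rewrite (lt_le_trans ltr01).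
  have nn : 1 <= v `^ nu by have := ler_powR_base (ltW nu0) ler01 v1_; rewrite powR1.
  have c1 : 0 < c + 1 by rewrite addr_gt0.
  have c2 : 0 < c + v `^ nu by rewrite addr_gt0// powR_gt0.
  apply: (@le_trans _ _ (v * laplace F v)).
    rewrite -ler_pdivrMl//.
    have -> : v^-1 * F 0 = Rintegral mu Rp (fun t => F 0 * expR (- (v * t))).
      rewrite RintegralZl//; [|exact: measurable_itv|exact: integrable_expR].
      by rewrite /Rintegral integral_expR_scale//= mulrC.
    apply: le_Rintegral; [exact: measurable_itv| |exact: integrable_laplaceF|].
      rewrite (_ : _ \o _ = fun t => ((F 0)%:E * (expR (- (v * t)))%:E)%E)//.
      by apply: integrableZl; [exact: measurable_itv|exact: integrable_expR].
    move=> t; rewrite /Rp/= in_itv/= andbT => t0.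
    by rewrite mulrC ler_wpM2l ?expR_ge0// F_nd.
  rewrite -ler_pdivlMl//.
  have H2 : series (fun r => v^-1 * ((c + 1) / (c + v `^ nu)) * M r) @ \oo -->
      v^-1 * ((c + 1) / (c + v `^ nu)) * laplace F 1.
    rewrite (_ : series _ = fun n => v^-1 * ((c + 1) / (c + v `^ nu)) * series M n).
      by apply: cvgM; [exact: cvg_cst|exact: M_series].
    by apply/funext => n; rewrite /series/= big_distrr.
  rewrite mulrA -(cvg_lim _ H2)// -(cvg_lim _ (laplaceF v0))//.
  apply: ler_lim; [by apply/cvg_ex; eexists; exact: laplaceF|by apply/cvg_ex; eexists; exact: H2|].
  apply: nearW => n; apply: ler_sum => r _; rewrite /M.
  rewrite [leLHS](_ : _ = v^-1 * C r * ((c + v `^ nu) ^+ dl r)^-1); last by ring.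
  rewrite [leRHS](_ : _ = v^-1 * C r * ((c + 1) / (c + v `^ nu) / (c + 1) ^+ dl r)); last by ring.
  rewrite ler_wpM2l ?mulr_ge0 ?invr_ge0 ?(ltW v0)//.
  rewrite -(prednK (dl0 r)) !exprS !invfM mulrACA mulrA.
  rewrite [X in _ <= X * _](_ : _ = (c + v `^ nu)^-1); last by field; rewrite !gt_eqF.
  rewrite ler_wpM2l ?invr_ge0 ?(ltW c2)// lef_pV2 ?posrE ?exprn_gt0//.
  by rewrite lerXn2r ?nnegrE ?(ltW c1) ?(ltW c2)// lerD2l.
rewrite leNgt; apply/negP => F0p.
have L0 : 0 <= laplace F 1.
  apply: Rintegral_ge0 => t _; rewrite mulr_ge0 ?expR_ge0//.
  by have /andP[] := F01 t.
(* At v^nu = K + 1 the bound [key] equals K F 0 / (c + K + 1), which is strictly below F 0. *)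
pose K := (c + 1) * laplace F 1 / F 0.
have K0 : 0 <= K by rewrite /K !mulr_ge0 ?invr_ge0 ?addr_ge0 ?(ltW c0).
have h1 : 1 <= (K + 1) `^ nu^-1.
  have := @ler_powR_base _ nu^-1 1 (K + 1); rewrite powR1; apply => //; last by rewrite lerDr.
  by rewrite invr_ge0 ltW.
have := key _ h1.
rewrite -powRrM mulVf ?gt_eqF// powRr1 ?addr_ge0//.
have cK : 0 < c + (K + 1) by have := c0; lra.
apply/negP; rewrite -ltNge mulrAC ltr_pdivrMr//.
rewrite [ltRHS]mulrC -ltr_pdivrMr// -/K; have := c0; lra.
Qed.

Lemma mittag_leffler_inversion (t : R) : 0 <= t ->
  series (fun r => C r * t `^ (nu * (dl r)%:R + 1 - 1) *
    mittag_leffler3 nu (nu * (dl r)%:R + 1) (dl r)%:R (- (c * t `^ nu))) @ \oo --> F t.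
Proof.
rewrite le_eqVlt => /predU1P[<-|t0].
  rewrite F0 (_ : series _ = fun=> 0); first exact: cvg_cst.
  apply/funext => n; rewrite /series/= big1// => r _.
  rewrite addrK [X in _ * X * _]powR0 ?mulr0 ?mul0r//.
  by rewrite mulf_neq0 ?gt_eqF// ltr0n.
rewrite F_eq_G// (_ : (fun r => _) = (fun r => g r t)); first exact/cvg_g/ltW.
apply/funext => r; rewrite addrK /mittag_leffler3.
set K := C r * _.
(* The Mittag-Leffler series is the series of [g r t] divided by [K]. Only C r >= 0 is assumed, so
   the case C r = 0 is kept apart from the division. *)
have H : series (fun j => Gamma ((dl r)%:R + j%:R) * (- (c * t `^ nu)) ^+ j /
     (j`!%:R * Gamma (dl r)%:R * Gamma (nu * j%:R + (nu * (dl r)%:R + 1)))) @ \oo --> K^-1 * g r t \/ K = 0 /\ g r t = 0.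
  have [Cr0|Cr0] := eqVneq (C r) 0.
    right; rewrite /K Cr0 mul0r; split => //.
    rewrite /g (_ : series _ = fun=> 0); first exact: lim_cst.
    by apply/funext => n; rewrite /series/= big1// => j _; rewrite /term /a Cr0 !mul0r.
  left; rewrite (_ : series _ = fun n => K^-1 * series (fun j => term r j t) n).
    by apply: cvgM; [exact: cvg_cst|exact/cvg_term/ltW].
  apply/funext => n; rewrite /series/= big_distrr/=; apply: eq_bigr => j _.
  rewrite /K /term /a powR_p ?(ltW t0)// powRrM powR_mulrn ?powR_ge0//.
  rewrite (_ : nu * j%:R + _ = p r j + 1); last by rewrite /p; ring.
  rewrite -mulNr exprMn.
  have G2 : 0 < Gamma ((dl r)%:R : R) by exact: Gamma_pos.
  have G3 : 0 < Gamma (p r j + 1) by apply: Gamma_gt0; exact: ltW.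
  have td : t `^ nu ^+ dl r != 0 by rewrite expf_neq0// gt_eqF// powR_gt0.
  move: (factR j) (lt0r_neq0 G2) (lt0r_neq0 G3) td.
  move: (Gamma (_ + j%:R)) (Gamma (dl r)%:R) (Gamma (p r j + 1)) (j`!%:R) (_ ^+ dl r) (_ ^+ j) ((- c) ^+ j).
  move=> g1 g2 g3 f x y z f0 g20 g30 x0.
  by field; rewrite Cr0 f0 g20 g30 x0.
case: H => [H|[-> ->]]; last by rewrite mul0r.
have [K0|K0] := eqVneq K 0; last by rewrite (cvg_lim _ H)// mulVKf.
rewrite K0 mul0r; move/eqP: K0; rewrite /K mulf_eq0 (gt_eqF (powR_gt0 _ t0)) orbF => /eqP Cr0.
rewrite /g (_ : series _ = fun=> 0); first by rewrite lim_cst.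
by apply/funext => n; rewrite /series/= big1// => j _; rewrite /term /a Cr0 !mul0r.
Qed.
End Mittag_Leffler_inversion.

(** * Exponential clocks and the law of the chain *)

Section exponential_layers.
Context {R : realType} {d : measure_display} {Omega : measurableType d}.
Variable P : probability Omega R.
Local Notation mu := (@lebesgue_measure R).

Lemma measurable_bool_set (f : Omega -> bool) :
  measurable_fun setT f -> measurable [set w | f w].
Proof. by move=> mf; rewrite -[X in measurable X]setTI; exact: (mf measurableT [set true]). Qed.

Lemma measurable_bool_natr (f : Omega -> bool) : measurable_fun setT f ->
  measurable_fun setT (fun w => (f w)%:R : R).
Proof.
move=> mf; rewrite (_ : (fun _ => _) = fun w => if f w then 1 else 0).
  exact: measurable_fun_ifT.
by apply/funext => w; case: (f w).
Qed.

Lemma integral_bool_natr (f : Omega -> bool) : measurable_fun setT f ->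
  (\int[P]_w ((f w)%:R : R)%:E = P [set w | f w])%E.
Proof.
move=> mf.
have mS := measurable_bool_set mf.
transitivity (\int[P]_w (\1_[set w | f w] w)%:E)%E; last by rewrite integral_indic// setIT.
apply: eq_integral => w _; rewrite indicE; congr ((nat_of_bool _)%:R%:E).
by apply/idP/idP => [fw|/set_mem//]; apply/mem_set.
Qed.

Lemma integral_expR_tail (c x : R) : 0 < c -> 0 <= x ->
  (\int[mu]_(s in `[x, +oo[) (c * expR (- (c * s)))%:E = (expR (- (c * x)))%:E)%E.
Proof.
move=> c0 x0.
have cE : continuous (fun z : R => expR (- (c * z))).
  move=> z; apply: continuous_comp; last exact: continuous_expR.
  by apply: cvgN; apply: cvgM; [exact: cvg_cst|exact: cvg_id].
rewrite (@ge0_continuous_FTC2y _ _ (fun s => - expR (- (c * s))) _ 0)//.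
- by rewrite sub0e EFinN oppeK.
- by move=> s _; rewrite mulr_ge0 ?expR_ge0 ?ltW.
- apply: continuous_subspaceT => z; apply: cvgM; first exact: cvg_cst.
  exact: cE.
- rewrite -oppr0; apply: cvgN.
  apply: (@cvg_comp _ _ _ (fun z => c * z) (fun z : R => expR (- z)) _ (pinfty_nbhs R)).
    exact: gt0_cvgMry.
  exact: cvgr_expR.
- by apply: cvgN; apply/cvg_at_right_filter; exact: cE.
- move=> z _; rewrite derive1_comp// derive1N// derive1_id mulN1r derive1_comp// derive1E.
  have /funeqP -> := @derive_expR R.
  rewrite derive1N// derive1Ml// derive1_id mulr1; ring.
Qed.

(** Tonelli, with exp (- theta x) written as the integral of theta exp (- theta s) over s >= x. As
    [s] is nonnegative, this representation is valid only for x >= 0, and [Z] has to vanish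
    elsewhere. *)
Lemma laplace_layer (Z X : Omega -> R) (theta : R) : 0 < theta ->
  measurable_fun setT Z -> measurable_fun setT X -> (forall w, 0 <= Z w) ->
  (forall w, X w < 0 -> Z w = 0) ->
  (\int[mu]_(s in `[0%R, +oo[) ((theta * expR (- (theta * s)))%:E *
     \int[P]_w (Z w * (X w <= s)%R%:R)%:E) =
   \int[P]_w (Z w * expR (- (theta * X w)))%:E)%E.
Proof.
move=> t0 mZ mX Z0 XZ.
pose f (z : Omega * R) : R := Z z.1 * (theta * expR (- (theta * z.2))) *
  ((0 <= z.2)%R && (X z.1 <= z.2)%R)%:R.
have mf : measurable_fun [set: Omega * R] f.
  apply: measurable_funM.
    apply: measurable_funM; first exact: measurableT_comp mZ measurable_fst.
    apply: measurable_funM => //.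
    by apply: (measurableT_comp (@measurable_expRN R theta setT)).
  rewrite (_ : (fun _ => _) = fun z : Omega * R => if (0 <= z.2) && (X z.1 <= z.2) then 1 else 0).
    apply: measurable_fun_ifT => //; apply: measurable_and.
      exact: measurable_fun_ler.
    apply: measurable_fun_ler => //; exact: measurableT_comp mX measurable_fst.
  by apply/funext => z; case: (_ && _).
have f0 z : (0 <= (f z)%:E)%E.
  by rewrite lee_fin /f !mulr_ge0 ?expR_ge0// ltW.
have mEf : measurable_fun [set: Omega * R] (EFin \o f) by exact/measurable_EFinP.
have := @fubini_tonelli _ _ _ _ R P mu (EFin \o f) mEf f0.
have -> : (\int[mu]_y \int[P]_x (EFin \o f) (x, y) =
    \int[mu]_(s in `[0%R, +oo[) ((theta * expR (- (theta * s)))%:E *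
     \int[P]_w (Z w * (X w <= s)%R%:R)%:E))%E.
  rewrite [RHS]integral_mkcond; apply: eq_integral => s _.
  rewrite /patch mem_setE in_itv/= andbT /f/=; case: ifPn => s0; last first.
    by under eq_integral do rewrite mulr0; rewrite integral0.
  rewrite -ge0_integralZl//; last 3 first.
  - apply/measurable_EFinP/measurable_funM => //; apply: measurable_bool_natr.
    exact: measurable_fun_ler.
  - by move=> w _; rewrite lee_fin mulr_ge0.
  - by rewrite lee_fin mulr_ge0 ?expR_ge0// ltW.
  by apply: eq_integral => w _; rewrite -EFinM; congr EFin; ring.
move=> <-; apply: eq_integral => w _.
have [Xw|Xw] := ltP (X w) 0.
  by rewrite /f/= XZ// mul0r; under eq_integral do rewrite !mul0r; rewrite integral0.
transitivity ((Z w)%:E * \int[mu]_(s in `[X w, +oo[) (theta * expR (- (theta * s)))%:E)%E.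
  rewrite [in RHS]integral_mkcond -ge0_integralZl//; last 3 first.
  - apply/(measurable_restrictT _ _).1 => //; apply/measurable_EFinP/measurable_funM => //.
    exact: measurable_expRN.
  - move=> s _; rewrite /patch; case: ifP => // _.
    by rewrite lee_fin mulr_ge0 ?expR_ge0// ltW.
  - by rewrite lee_fin.
  apply: eq_integral => s _; rewrite /patch mem_setE in_itv/= andbT /f/=.
  case: (leP (X w) s) => Xs; last by rewrite andbF mulr0 mule0.
  by rewrite (le_trans Xw Xs)/= mulr1 EFinM.
by rewrite integral_expR_tail// EFinM.
Qed.

(** Under the measure of density [Z], the variable [W] has the tail of an exponential variable of
    rate [c] and total mass [K]. The transform follows from this tail through [laplace_layer],
    without constructing the law of [W]. *)
Lemma exponential_clock (Z W : Omega -> R) (K c theta : R) : 0 < theta -> 0 <= c ->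
  measurable_fun setT Z -> measurable_fun setT W -> (forall w, 0 <= Z w) ->
  (forall s : R, (0 <= s)%R -> \int[P]_w (Z w * (s < W w)%R%:R)%:E = (K * expR (- (c * s)))%:E)%E ->
  (\int[P]_w (Z w * (if (0 < W w)%R then expR (- (theta * W w)) else 0))%:E =
   (K * (c / (c + theta)))%:E)%E.
Proof.
move=> t0 c0 mZ mW Z0 HK.
have ct0 : 0 < theta + c by rewrite ltr_pwDl.
pose Z' w := Z w * (0 < W w)%R%:R.
have Z'0 w : 0 <= Z' w by rewrite mulr_ge0.
have mZ' : measurable_fun setT Z'.
  by apply: measurable_funM => //; apply: measurable_bool_natr; exact: measurable_fun_ltr.
have mle s : measurable_fun setT (fun w => Z' w * (W w <= s)%R%:R).
  by apply: measurable_funM => //; apply: measurable_bool_natr; exact: measurable_fun_ler.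
have mlt s : measurable_fun setT (fun w => Z w * (s < W w)%R%:R).
  by apply: measurable_funM => //; apply: measurable_bool_natr; exact: measurable_fun_ltr.
have K0 : 0 <= K.
  have := HK 0 (lexx _); rewrite mulr0 oppr0 expR0 mulr1 => HK0.
  by rewrite -lee_fin -HK0 integral_ge0// => w _; rewrite lee_fin mulr_ge0.
have Hs s : 0 <= s -> (\int[P]_w (Z' w * (W w <= s)%R%:R)%:E = (K - K * expR (- (c * s)))%:E)%E.
  move=> s0.
  have : (\int[P]_w (Z' w)%:E = K%:E)%E.
    by rewrite HK// mulr0 oppr0 expR0 mulr1.
  have -> : (\int[P]_w (Z' w)%:E = \int[P]_w (Z' w * (W w <= s)%R%:R)%:E + \int[P]_w (Z w * (s < W w)%R%:R)%:E)%E.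
    rewrite -ge0_integralD//; last 4 first.
    - by move=> w _; rewrite lee_fin mulr_ge0.
    - by apply/measurable_EFinP; exact: mle.
    - by move=> w _; rewrite lee_fin mulr_ge0.
    - by apply/measurable_EFinP; exact: mlt.
    apply: eq_integral => w _; rewrite -EFinD; congr EFin; rewrite /Z'.
    case: (leP (W w) s) => Ws; rewrite ?mulr0 ?mulr1 ?addr0 ?add0r//.
    by rewrite (le_lt_trans s0 Ws) mulr1.
  rewrite HK// => H; rewrite EFinB -H.
  by rewrite addeK.
have -> : (\int[P]_w (Z w * (if (0 < W w)%R then expR (- (theta * W w)) else 0))%:E =
    \int[P]_w (Z' w * expR (- (theta * W w)))%:E)%E.
  apply: eq_integral => w _; congr EFin; rewrite /Z'.
  by case: ifP; rewrite ?mulr1 ?mulr0 ?mul0r.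
rewrite -laplace_layer//; last first.
  by move=> w Ww; rewrite /Z' ltNge (ltW Ww) mulr0.
have i1 := integrable_expR t0; have i2 := integrable_expR ct0.
transitivity (\int[mu]_(s in `[0%R, +oo[)
   ((K * theta)%:E * ((expR (- (theta * s)))%:E - (expR (- ((theta + c) * s)))%:E)))%E.
  apply: eq_integral => s; rewrite inE/= in_itv/= andbT => s0.
  rewrite Hs// -EFinB -!EFinM; congr EFin.
  by rewrite (_ : - ((theta + c) * s) = - (theta * s) + - (c * s)) ?expRD; ring.
rewrite integralZl//; last exact: integrableB.
rewrite integralB_EFin// !integral_expR_scale// -EFinB -EFinM; congr EFin.
by field; rewrite addrC !gt_eqF.
Qed.
End exponential_layers.

Section measurability.
Context {d : measure_display} {Omega : measurableType d}.

Lemma measurable_fun_forall_ord (m : nat) (f : 'I_m -> Omega -> bool) :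
  (forall i, measurable_fun setT (f i)) ->
  measurable_fun setT (fun w => [forall i, f i w]).
Proof.
move=> mf; rewrite (_ : (fun _ => _) = fun w => all (f^~ w) (enum 'I_m)).
  elim: (enum 'I_m) => [|i r IH] //=; exact: measurable_and.
apply/funext => w; apply/forallP/allP => [H i _|H i]; first exact: H.
by apply: H; rewrite mem_enum.
Qed.
Lemma measurable_eq_state (X : Omega -> nat * nat) (y : nat * nat) :
  measurable_fun setT X -> measurable_fun setT (fun w => X w == y).
Proof.
move=> mX; apply: (measurable_fun_bool true); rewrite setTI.
rewrite (_ : _ @^-1` _ = X @^-1` ([set y.1] `*` [set y.2])); last first.
  apply/seteqP; split => w /=; first by move=> /eqP ->.
  by move=> XY; apply/eqP; move: XY; case: (X w) y => [a b] [a' b'] [/= -> ->].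
by rewrite -[Y in measurable Y]setTI; apply: mX => //; exact: measurableX.
Qed.
End measurability.

Lemma prod_bool_natr (R : comNzRingType) (I : finType) (f : pred I) :
  \prod_i ((f i)%:R : R) = [forall i, f i]%:R.
Proof.
case: (boolP [forall i, f i]) => [/forallP H|]; first by rewrite big1// => i _; rewrite H.
by rewrite negb_forall => /existsP[i fi]; rewrite (bigD1 i)//= (negbTE fi) mul0r.
Qed.

Section path_law.
Context {R : realType} {d : measure_display} {Omega : measurableType d}.
Variable P : probability Omega R.
Variables (T : eqType) (q : T -> T -> R) (e : T -> R) (x0 : T).
Variables (Y : nat -> Omega -> T) (W : nat -> Omega -> R).
Hypothesis mY : forall n y, measurable_fun setT (fun w => Y n w == y).
Hypothesis mW : forall n, measurable_fun setT (W n).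
Hypothesis e0 : forall x, 0 <= e x.
Hypothesis joint : forall (n : nat) (y : nat -> T) (s : nat -> R), (forall i, 0 <= s i) ->
  P [set w | (forall i, (i <= n)%N -> Y i w = y i) /\ (forall i, (i < n)%N -> s i < W i w)] =
  ((y 0%N == x0)%:R * \prod_(i < n) (q (y i) (y i.+1) / e (y i) * expR (- (e (y i) * s i))))%:E.

Definition follows (y : nat -> T) (n : nat) (w : Omega) := [forall i : 'I_n.+1, Y i w == y i].

(** The value 0 at x <= 0 reflects that [joint], even with all thresholds 0, describes the holding
    times only on the event where they are positive. *)
Definition killed_exp (theta x : R) : R := if 0 < x then expR (- (theta * x)) else 0.

Lemma killed_exp_ge0 theta x : 0 <= killed_exp theta x.
Proof. by rewrite /killed_exp; case: ifP => // _; exact: expR_ge0. Qed.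

Lemma measurable_killed_exp theta n : measurable_fun setT (fun w => killed_exp theta (W n w)).
Proof.
apply: measurable_fun_ifT => //; first exact: measurable_fun_ltr.
exact: (measurableT_comp (@measurable_expRN R theta setT)).
Qed.

Lemma measurable_follows y n : measurable_fun setT (follows y n).
Proof. by apply: measurable_fun_forall_ord => i; exact: mY. Qed.

Lemma followsP y n w : reflect (forall i, (i <= n)%N -> Y i w = y i) (follows y n w).
Proof.
apply: (iffP forallP) => [H i il|H i]; first by apply/eqP; exact: (H (Ordinal (il : (i < n.+1)%N))).
by apply/eqP/H; rewrite -ltnS.
Qed.

Let phi y n theta m (s : nat -> R) w : R := (follows y n w)%:R *
  \prod_(i < n) (if (i < m)%N then killed_exp theta (W i w) else (s i < W i w)%R%:R).

(* Induction on m: the indicators of s i < W i are turned, one coordinate at a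
   time, into exponentials of the holding times. *)
Let integral_phi y n theta m s : 0 < theta -> (m <= n)%N -> (forall i, 0 <= s i) ->
  (\int[P]_w (phi y n theta m s w)%:E = ((y 0%N == x0)%:R *
   \prod_(i < n) (q (y i) (y i.+1) / e (y i) *
     (if (i < m)%N then e (y i) / (e (y i) + theta) else expR (- (e (y i) * s i)))))%:E)%E.
Proof.
move=> t0; elim: m s => [|m IH] s mn s0.
  have ms : measurable_fun setT (fun w => [forall i : 'I_n, s i < W i w]).
    by apply: measurable_fun_forall_ord => i; exact: measurable_fun_ltr.
  have -> : (\int[P]_w (phi y n theta 0 s w)%:E =
      \int[P]_w ((follows y n w && [forall i : 'I_n, (s i < W i w)%R])%:R)%:E)%E.
    apply: eq_integral => w _; rewrite /phi/= prod_bool_natr.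
    by case: (follows _ _ _) => /=; rewrite ?mul1r ?mul0r.
  rewrite integral_bool_natr; last by apply: measurable_and => //; exact: measurable_follows.
  rewrite -joint//; congr (P _); apply/seteqP; split=> w /=.
    move=> /andP[/followsP H1 /forallP H2]; split=> // i il.
    exact: (H2 (Ordinal il)).
  by move=> [H1 H2]; apply/andP; split; [exact/followsP|apply/forallP => i; exact: H2].
pose im := Ordinal mn.
pose fac (sig : nat -> R) w (i : nat) : R := if (i < m)%N then killed_exp theta (W i w) else (sig i < W i w)%R%:R.
pose Z w := (follows y n w)%:R * \prod_(i < n | i != im) fac s w i.
pose facr (sig : nat -> R) (i : nat) : R := q (y i) (y i.+1) / e (y i) *
     (if (i < m)%N then e (y i) / (e (y i) + theta) else expR (- (e (y i) * sig i))).
pose K := (y 0%N == x0)%:R * \prod_(i < n | i != im) facr s i * (q (y m) (y m.+1) / e (y m)).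
have nim (i : 'I_n) : i != im -> (i == m :> nat) = false.
  by move=> iim; apply/negbTE.
have -> : (\int[P]_w (phi y n theta m.+1 s w)%:E =
    \int[P]_w (Z w * (if (0 < W m w)%R then expR (- (theta * W m w)) else 0))%:E)%E.
  apply: eq_integral => w _; congr EFin; rewrite /phi (bigD1 im)//= ltnSn -/(killed_exp theta (W m w)).
  rewrite /Z -mulrA [killed_exp _ _ * _]mulrC; congr (_ * (_ * _)).
  by apply: eq_bigr => i iim; rewrite /fac ltnS leq_eqVlt nim.
rewrite (@exponential_clock _ _ _ P Z (W m) K (e (y m)))//.
- congr EFin; rewrite /K [in RHS](bigD1 im)//= ltnSn.
  rewrite [in RHS](eq_bigr (fun i : 'I_n => facr s i)); last first.
    by move=> i iim; rewrite /facr ltnS leq_eqVlt nim.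
  by move: (bigop _ _ _) => A; ring.
- apply: measurable_funM; first exact/measurable_bool_natr/measurable_follows.
  rewrite (_ : (fun _ => _) = fun w =>
      \prod_(i <- [seq i <- index_enum 'I_n | i != im]) fac s w i); last first.
    by apply/funext => w; rewrite big_filter.
  apply: measurable_prod => i _; rewrite /fac; case: (i < m)%N.
    exact: measurable_killed_exp.
  by apply: measurable_bool_natr; exact: measurable_fun_ltr.
- move=> w; rewrite mulr_ge0// prodr_ge0// => i _; rewrite /fac; case: ifP => // _.
  exact: killed_exp_ge0.
(* Replacing the m-th threshold by an arbitrary [s'] in the induction hypothesis yields the whole
   tail of [W m]; the induction is general in [s] for this purpose. *)
move=> s' s'0; pose s2 i := if i == m then s' else s i.
have s20 i : 0 <= s2 i by rewrite /s2; case: ifP.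
have := IH s2 (ltnW mn) s20.
have -> : (\int[P]_w (phi y n theta m s2 w)%:E = \int[P]_w (Z w * (s' < W m w)%R%:R)%:E)%E.
  apply: eq_integral => w _; congr EFin; rewrite /phi (bigD1 im)//= ltnn /s2 eqxx.
  rewrite /Z -mulrA [(s' < _)%R%:R * _]mulrC; congr (_ * (_ * _)).
  by apply: eq_bigr => i iim; rewrite /fac nim.
move=> ->; congr EFin; rewrite (bigD1 im)//= ltnn /s2 eqxx /K.
rewrite [in LHS](eq_bigr (fun i : 'I_n => facr s i)); last first.
  by move=> i iim; rewrite /facr nim.
by move: (bigop _ _ _) => A; ring.
Qed.

Lemma integral_follows y n theta : 0 < theta ->
  (\int[P]_w ((follows y n w)%:R * \prod_(i < n) killed_exp theta (W i w))%:E =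
   ((y 0%N == x0)%:R * \prod_(i < n) (q (y i) (y i.+1) / e (y i) *
     (e (y i) / (e (y i) + theta))))%:E)%E.
Proof.
move=> t0; have := @integral_phi y n theta n (fun=> 0) t0 (leqnn n) (fun=> lexx 0).
have -> : (\int[P]_w (phi y n theta n (fun=> 0%R) w)%:E =
    \int[P]_w ((follows y n w)%:R * \prod_(i < n) killed_exp theta (W i w))%:E)%E.
  by apply: eq_integral => w _; congr (_ * _)%:E; apply: eq_bigr => i _; rewrite ltn_ord.
by move=> ->; congr (_ * _)%:E; apply: eq_bigr => i _; rewrite ltn_ord.
Qed.
End path_law.

(** * The jump chain of the Erlang queue and its killed transition operator *)

Section Erlang_chain.
Context {R : realType}.
Variables (lambda mu : R) (k : nat).
Hypotheses (lambda0 : 0 < lambda) (mu0 : 0 < mu) (k1 : (1 <= k)%N).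

Let T := (nat * nat)%type.
Let zero : T := (0%N, 0%N).
Let x0 : T := (1%N, k).
Let q := erlang_rate lambda mu k.
Let c : R := lambda + k%:R * mu.
Definition arrival (x : nat * nat) : nat * nat := (x.1.+1, x.2).
Let down := phase_completion k.

Definition erlang_step (x y : nat * nat) : bool :=
  if x == (0%N, 0%N) then y == (1%N, k) else (y == arrival x) || (y == phase_completion k x).

Definition erlang_state (x : nat * nat) : bool := (x == (0%N, 0%N)) || busy_state k x.

Lemma kmu_gt0 : 0 < k%:R * mu.
Proof. by rewrite mulr_gt0// ltr0n. Qed.

Let c0 : 0 < c. Proof. by rewrite addr_gt0// kmu_gt0. Qed.

Lemma busy_neq0 x : busy_state k x -> x != (0%N, 0%N).
Proof. by case: x => [[|n] s]. Qed.

(** The two successors of a busy state are distinct, so their rates add up to c and their path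
    events are disjoint. *)
Lemma arrival_neq_completion x : arrival x != phase_completion k x.
Proof.
case: x => n s; rewrite /arrival /phase_completion/=; apply/eqP.
case: ifP => _ [] //; first by move=> /eqP; rewrite -[_ == _]/(n.+1 == n)%N gtn_eqF.
case: ifP => // _ [] /eqP; case: n => // n; by rewrite gtn_eqF.
Qed.

Lemma erlang_state_step x y : erlang_state x -> erlang_step x y -> erlang_state y.
Proof.
rewrite /erlang_state /erlang_step; case: ifP => [_ _ /eqP ->|_ /=].
  by rewrite /busy_state/= k1 leqnn ?orbT.
case: x => n s; rewrite /busy_state /arrival /phase_completion/= => /andP[n1 /andP[s1 sk]].
case/orP => /eqP ->; first by rewrite /= s1 sk ?orbT.
case: ifP => s2; first by case: s s2 s1 sk => [|[|s]]//= _ _ sk; rewrite n1 (ltnW sk) ?orbT.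
by case: ifP => // n2; case: n n2 n1 => [|[|n]]//= _ _; rewrite k1 leqnn ?orbT.
Qed.

Lemma rate_arrival x : busy_state k x -> q x (arrival x) = lambda.
Proof. by move=> bx; rewrite /q /erlang_rate (negbTE (busy_neq0 bx)) bx eqxx. Qed.

Lemma rate_completion x : busy_state k x -> q x (phase_completion k x) = k%:R * mu.
Proof.
move=> bx; rewrite /q /erlang_rate (negbTE (busy_neq0 bx)) bx eqxx.
by rewrite eq_sym (negbTE (arrival_neq_completion x)).
Qed.

Lemma rate_empty : q (0%N, 0%N) (1%N, k) = lambda.
Proof. by rewrite /q /erlang_rate !eqxx. Qed.

Lemma exit_rate_busy x : busy_state k x -> exit_rate q x = lambda + k%:R * mu.
Proof.
move=> bx; rewrite /exit_rate (@fsbigE _ _ _ _ _ [:: arrival x; phase_completion k x])//=.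
- by rewrite !big_cons big_nil !mem_setT addr0 rate_arrival// rate_completion.
- by rewrite inE arrival_neq_completion.
- move=> y _; rewrite !inE negb_or => /andP[ya yd].
  rewrite /q /erlang_rate (negbTE (busy_neq0 bx)) bx.
  by rewrite -[(x.1.+1, x.2)]/(arrival x) (negbTE ya) (negbTE yd).
Qed.

Lemma exit_rate_empty : exit_rate q (0%N, 0%N) = lambda.
Proof.
rewrite /exit_rate (@fsbigE _ _ _ _ _ [:: (1%N, k)])//=.
- by rewrite big_cons big_nil mem_setT addr0 rate_empty.
- by move=> y _; rewrite !inE => yk; rewrite /q /erlang_rate eqxx (negbTE yk).
Qed.

Lemma exit_rate_ge0 x : 0 <= exit_rate q x.
Proof.
have [->|x0_] := eqVneq x (0%N, 0%N); first by rewrite exit_rate_empty ltW.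
have [bx|bx] := boolP (busy_state k x); first by rewrite exit_rate_busy// ltW.
rewrite /exit_rate fsbig1// => y _.
by rewrite /q /erlang_rate (negbTE x0_) (negbTE bx).
Qed.

(** Transition operator of the jump chain killed at the empty state: its n-th iterate sends [g] to
    the expectation of g(Y_n) on the event that Y_0, ..., Y_(n-1) are not empty. For [g] the
    indicator of the empty state this is the probability of first passage at step n; for g = 1, of
    staying busy before step n. *)
Definition backward (g : nat * nat -> R) (x : nat * nat) : R :=
  if x == (0%N, 0%N) then 0
  else lambda / (lambda + k%:R * mu) * g (arrival x) +
       k%:R * mu / (lambda + k%:R * mu) * g (phase_completion k x).

Lemma iter_backward_le1 n x : 0 <= iter n backward (fun=> 1) x <= 1.
Proof.
elim: n x => [|n IH] x /=; first by rewrite ler01 lexx.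
rewrite {1 3}/backward; case: ifP => _; first by rewrite lexx ler01.
have /andP[a0 a1] := IH (arrival x); have /andP[b0 b1] := IH (phase_completion k x).
have l0 : 0 <= lambda / (lambda + k%:R * mu) by rewrite divr_ge0 ?(ltW lambda0)// ltW.
have m0 : 0 <= k%:R * mu / (lambda + k%:R * mu) by rewrite divr_ge0 ?(ltW kmu_gt0)// ltW.
apply/andP; split; first by apply: addr_ge0; apply: mulr_ge0.
apply: (le_trans (lerD (ler_wpM2l l0 a1) (ler_wpM2l m0 b1))).
by rewrite !mulr1 -mulrDl divff// gt_eqF.
Qed.

Section law.
Context {d : measure_display} {Omega : measurableType d}.
Variable P : probability Omega R.
Variables (Y : nat -> Omega -> T) (W : nat -> Omega -> R).
Hypothesis mY' : forall n, measurable_fun setT (Y n).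
Hypothesis mW : forall n, measurable_fun setT (W n).
Hypothesis joint : forall (n : nat) (y : nat -> T) (s : nat -> R), (forall i, 0 <= s i) ->
  P [set w | (forall i, (i <= n)%N -> Y i w = y i) /\ (forall i, (i < n)%N -> s i < W i w)] =
  ((y 0%N == x0)%:R * \prod_(i < n) (q (y i) (y i.+1) / exit_rate q (y i)
     * expR (- (exit_rate q (y i) * s i))))%:E.

Let mY n y : measurable_fun setT (fun w => Y n w == y).
Proof. exact: measurable_eq_state. Qed.

Let event n (y : nat -> T) := [set w | (forall i, (i <= n)%N -> Y i w = y i) /\
  (forall i, (i < n)%N -> 0 < W i w)].

Let mevent n y : measurable (event n y).
Proof.
rewrite (_ : event n y = [set w | follows Y y n w && [forall i : 'I_n, 0 < W i w]]).
  apply: measurable_bool_set; apply: measurable_and; first exact: measurable_follows.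
  by apply: measurable_fun_forall_ord => i; exact: measurable_fun_ltr.
apply/seteqP; split => w /=.
  by move=> [H1 H2]; apply/andP; split; [exact/followsP|apply/forallP => i; exact: H2].
move=> /andP[/followsP H1 /forallP H2]; split=> // i il.
exact: (H2 (Ordinal il)).
Qed.

Let Pevent n y : P (event n y) =
  ((y 0%N == x0)%:R * \prod_(i < n) (q (y i) (y i.+1) / exit_rate q (y i)))%:E.
Proof.
rewrite (joint n y (fun=> lexx 0)); congr (_ * _)%:E.
by apply: eq_bigr => i _; rewrite mulr0 oppr0 expR0 mulr1.
Qed.

Definition extend_path (y : nat -> T) j x i := if i == j.+1 then x else y i.

Let Pevent_extendend n y x : P (event n.+1 (extend_path y n x)) =
  (P (event n y) * (q (y n) x / exit_rate q (y n))%:E)%E.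
Proof.
rewrite !Pevent big_ord_recr/= /extend_path eqxx [n == n.+1]ltn_eqF// -EFinM mulrA.
congr (_ * _ * _)%:E; apply: eq_bigr => i _.
by rewrite !ltn_eqF// ltnS// ltnW.
Qed.

Let event_extend n y x : event n.+1 (extend_path y n x) `<=` event n y.
Proof.
move=> w [H1 H2]; split=> i il; last by apply: H2; rewrite ltnS ltnW.
by rewrite H1 ?(leq_trans il)// /extend_path ltn_eqF.
Qed.

Let valid n w := Y 0%N w = x0 /\
  forall i, (i < n)%N -> erlang_step (Y i w) (Y i.+1 w) /\ 0 < W i w.

(* The extensions of y by its possible successors carry all the mass of y. *)
Let step_ae n (y : nat -> T) : erlang_state (y n) ->
  {ae P, forall w, event n y w -> erlang_step (Y n w) (Y n.+1 w) /\ 0 < W n w}.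
Proof.
move=> yS.
have [A [mA AE PA]] : exists A, [/\ measurable A,
    A `<=` [set w | event n y w /\ (erlang_step (Y n w) (Y n.+1 w) /\ 0 < W n w)] & P A = P (event n y)].
  have sub x : erlang_step (y n) x -> event n.+1 (extend_path y n x) `<=`
      [set w | event n y w /\ (erlang_step (Y n w) (Y n.+1 w) /\ 0 < W n w)].
    move=> yx w Ew; split; first exact: event_extend Ew.
    have [H1 H2] := Ew; split; last exact: H2.
    by rewrite !H1// /extend_path eqxx ltn_eqF.
  have [y0|y0] := eqVneq (y n) zero.
    exists (event n.+1 (extend_path y n (1%N, k))); split => //.
      by apply: sub; rewrite y0 /erlang_step eqxx.
    by rewrite Pevent_extendend y0 rate_empty exit_rate_empty divff ?gt_eqF// mule1.
  have by_ : busy_state k (y n) by move: yS; rewrite /erlang_state (negbTE y0).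
  exists (event n.+1 (extend_path y n (arrival (y n))) `|` event n.+1 (extend_path y n (down (y n)))); split.
  - exact: measurableU.
  - by rewrite subUset; split; apply: sub; rewrite /erlang_step (negbTE y0) eqxx ?orbT.
  - transitivity (P (event n.+1 (extend_path y n (arrival (y n)))) + P (event n.+1 (extend_path y n (down (y n)))))%E.
      apply: measureU => //; apply/seteqP; split => // w [[H1 _] [H2 _]].
      have := H1 n.+1 (leqnn _); rewrite H2// /extend_path eqxx => E.
      by have := arrival_neq_completion (y n); rewrite -E eqxx.
    rewrite !Pevent_extendend rate_arrival// rate_completion// exit_rate_busy//.
    rewrite -ge0_muleDr ?lee_fin ?divr_ge0 ?(ltW lambda0) ?(ltW kmu_gt0) ?(ltW c0)//.
    by rewrite -EFinD -mulrDl divff ?gt_eqF// mule1.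
exists (event n y `\` A); split.
- exact: measurableD.
- have -> : P (event n y `\` A) = (P (event n y) - P (event n y `&` A))%E.
    by apply: measureD => //; rewrite ltey_eq fin_num_measure.
  rewrite (_ : event n y `&` A = A) ?PA ?subee ?fin_num_measure//.
  by apply/seteqP; split=> w; [case|move=> Aw; split => //; case: (AE _ Aw)].
- move=> w /= H; apply: contrapT => H2; apply: H => Ew.
  by apply: contrapT => H3; apply: H2; split => // /AE[].
Qed.

Let path_state n w : valid n w -> forall i, (i <= n)%N -> erlang_state (Y i w).
Proof.
move=> [H0 H]; elim=> [_|i IH il].
  by rewrite H0 /erlang_state /busy_state/= k1 leqnn ?orbT.
by apply: (@erlang_state_step (Y i w)); [exact/IH/ltnW|have [] := H _ il].
Qed.

(** The prefix actually followed is one of countably many tuples of states, enumerated by [pickle],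
    so the exceptional null sets of [step_ae] can be united over all prefixes, and then over n. *)
Lemma chain_valid : {ae P, forall w, Y 0%N w = (1%N, k) /\
  forall i, erlang_step (Y i w) (Y i.+1 w) /\ 0 < W i w}.
Proof.
have H n : {ae P, forall w, valid n w}.
  elim: n => [|n IH].
    exists (~` event 0 (fun=> x0)); split.
    - exact: measurableC.
    - by rewrite probability_setC// Pevent big_ord0 eqxx mulr1 subee.
    - by move=> w /= H Ew; apply: H; have [/(_ 0%N) H1 _] := Ew; split; [exact: H1|].
  have : {ae P, forall w (m : nat), match (unpickle m : option (n.+1.-tuple T)) with
      | Some t => erlang_state (nth zero t n) -> event n (nth zero t) w ->
         erlang_step (Y n w) (Y n.+1 w) /\ 0 < W n w
      | None => True end}.
    apply: ae_foralln => m; case: unpickle => [t|]; last exact: aeW.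
    have [tS|tS] := boolP (erlang_state (nth zero t n)); last exact: aeW.
    by apply: filterS (step_ae tS) => w Hw _; exact: Hw.
  apply: filterS2 IH => w [H0 Hv] Hw; split=> // i; rewrite ltnS leq_eqVlt => /predU1P[->|]; last exact: Hv.
  pose t : n.+1.-tuple T := [tuple Y i w | i < n.+1].
  have tE j : (j <= n)%N -> nth zero t j = Y j w.
    move=> jn; rewrite -[j]/(val (Ordinal (jn : (j < n.+1)%N))) -tnth_nth.
    by rewrite tnth_mktuple.
  have := Hw (pickle t); rewrite pickleK; apply.
    by rewrite tE//; apply: (@path_state n w).
  by split=> j jn; [rewrite tE|have [] := Hv _ jn].
apply: filterS (ae_foralln H) => w Hw; split; first by have [] := Hw 0%N.
by move=> i; have [_ /(_ _ (ltnSn i))] := Hw i.+1.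
Qed.

Variable theta : R.
Hypothesis theta0 : 0 < theta.

Let st (g : T -> R) j r w : R := (all (fun i => Y i w != zero) (iota j r))%:R * g (Y (j + r)%N w) *
  \prod_(i < j + r) killed_exp theta (W i w).

Let st_step g j r w : st g j r.+1 w = (Y j w != zero)%:R * st g j.+1 r w.
Proof.
rewrite /st/= -addSnnS; case: (Y j w != zero) => /=; by rewrite ?mul1r// !mul0r.
Qed.

Let measurable_all (s : seq nat) : measurable_fun setT (fun w => all (fun i => Y i w != zero) s).
Proof.
elim: s => [|i s IH]//=; apply: measurable_and => //; exact: measurable_neg.
Qed.

Let measurable_st (g : T -> R) j r : measurable_fun setT (g \o Y (j + r)%N) -> measurable_fun setT (st g j r).
Proof.
move=> mg; apply: measurable_funM; first by apply: measurable_funM => //; exact: measurable_bool_natr.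
by apply: measurable_prod => i _; exact: measurable_killed_exp.
Qed.

Let st_ge0 (g : T -> R) j r w : (forall x, 0 <= g x) -> 0 <= st g j r w.
Proof.
move=> g0; rewrite /st !mulr_ge0// prodr_ge0// => i _; exact: killed_exp_ge0.
Qed.

(** Induction on the number [r] of free steps after a fixed prefix of length [j]. The next state is
    almost surely one of two successors; moving it into the prefix splits the integral exactly as
    [backward] does. Along a busy prefix every exit rate is c, so each holding time contributes the
    same factor c / (c + theta). *)
Let integral_st (g : T -> R) (r j : nat) (y : nat -> T) : (forall x, 0 <= g x) ->
  (forall n, measurable_fun setT (g \o Y n)) ->
  y 0%N = x0 -> (forall i, (i < j)%N -> busy_state k (y i)) -> erlang_state (y j) ->
  (\int[P]_w ((follows Y y j w)%:R * st g j r w)%:E =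
    (\prod_(i < j) (q (y i) (y i.+1) / c) * (c / (c + theta)) ^+ (j + r) * iter r backward g (y j))%:E)%E.
Proof.
move=> g0 mg; elim: r j y => [|r IH] j y y0 yb yS.
  have -> : (\int[P]_w ((follows Y y j w)%:R * st g j 0 w)%:E = \int[P]_w ((g (y j))%:E *
      ((follows Y y j w)%:R * \prod_(i < j) killed_exp theta (W i w))%:E))%E.
    apply: eq_integral => w _; rewrite -EFinM /st addn0/=; congr EFin.
    case: (followsP Y y j w) => [H|_]; last by rewrite !mul0r mulr0.
    by rewrite H// !mul1r.
  rewrite ge0_integralZl//; last 3 first.
  - apply/measurable_EFinP; apply: measurable_funM.
      by apply: measurable_bool_natr; exact: measurable_follows.
    by apply: measurable_prod => i _; exact: measurable_killed_exp.
  - move=> w _; rewrite lee_fin mulr_ge0// prodr_ge0// => i _; exact: killed_exp_ge0.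
  - by rewrite lee_fin.
  rewrite (integral_follows mY mW exit_rate_ge0 joint)// y0 eqxx mul1r -EFinM addn0/=.
  congr EFin; rewrite mulrC; congr (_ * _).
  rewrite (eq_bigr (fun i : 'I_j => (q (y i) (y i.+1) / c) * (c / (c + theta)))).
    by rewrite big_split/= big_const_ord iter_mulr_1.
  by move=> i _; rewrite exit_rate_busy// yb.
have [yj|yj] := eqVneq (y j) zero.
  have -> : iter r.+1 backward g (y j) = 0 by rewrite iterS {1}/backward yj eqxx.
  rewrite mulr0; apply: integral0_eq => w _.
  rewrite st_step; case: (followsP Y y j w) => [H|_]; last by rewrite mul0r.
  by rewrite H// yj eqxx mul0r mulr0.
have bj : busy_state k (y j) by move: yS; rewrite /erlang_state (negbTE yj).
pose F x w := ((follows Y (extend_path y j x) j.+1 w)%:R * st g j.+1 r w)%:E.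
have mF x : measurable_fun setT (F x).
  apply/measurable_EFinP; apply: measurable_funM.
    by apply: measurable_bool_natr; exact: measurable_follows.
  exact: measurable_st.
have F0 x w : (0 <= F x w)%E by rewrite lee_fin mulr_ge0// st_ge0.
have IF x : erlang_step (y j) x -> (\int[P]_w F x w = (\prod_(i < j) (q (y i) (y i.+1) / c) * (q (y j) x / c) *
    (c / (c + theta)) ^+ (j.+1 + r) * iter r backward g x)%:E)%E.
  move=> yx; rewrite IH.
  - congr (_ * _ * _)%:E; last by rewrite /extend_path eqxx.
    rewrite big_ord_recr/= /extend_path eqxx ltn_eqF//; congr (_ * _).
    by apply: eq_bigr => i _; rewrite !ltn_eqF// ltnS// ltnW.
  - by rewrite /extend_path.
  - move=> i; rewrite ltnS leq_eqVlt => /predU1P[->|ij]; rewrite /extend_path ltn_eqF//.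
      exact: yb.
    by rewrite ltnS ltnW.
  - by rewrite /extend_path eqxx; apply: erlang_state_step yx.
transitivity (\int[P]_w (F (arrival (y j)) w + F (down (y j)) w))%E.
  apply: ge0_ae_eq_integral => //.
  - apply/measurable_EFinP; apply: measurable_funM.
      by apply: measurable_bool_natr; exact: measurable_follows.
    exact: measurable_st.
  - exact: emeasurable_funD.
  - by move=> w _; rewrite lee_fin mulr_ge0// st_ge0.
  - by move=> w _; rewrite adde_ge0.
  apply: filterS chain_valid => w [_ /(_ j)[+ _]] _; rewrite /F -EFinD -mulrDl st_step mulrA.
  move=> Hst; congr (_ * _)%:E.
  case: (followsP Y y j w) => [H|H]; last first.
    rewrite mul0r; case: followsP => [H2|_].
      by exfalso; apply: H => i ij; rewrite H2 ?(leq_trans ij)// /extend_path ltn_eqF.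
    case: followsP => [H2|_]; last by rewrite addr0.
    by exfalso; apply: H => i ij; rewrite H2 ?(leq_trans ij)// /extend_path ltn_eqF.
  have fE x : follows Y (extend_path y j x) j.+1 w = (Y j.+1 w == x).
    apply/followsP/eqP => [/(_ j.+1 (leqnn _)) ->|Yx i]; first by rewrite /extend_path eqxx.
    by rewrite leq_eqVlt => /predU1P[->|il]; rewrite /extend_path ?eqxx// ltn_eqF// H.
  rewrite mul1r H// yj !fE; move: Hst; rewrite H// /erlang_step (negbTE yj) => /orP[]/eqP ->.
    by rewrite eqxx (negbTE (arrival_neq_completion _)) addr0.
  by rewrite eqxx eq_sym (negbTE (arrival_neq_completion _)) add0r.
rewrite ge0_integralD// !IF ?/erlang_step ?(negbTE yj) ?eqxx ?orbT//.
rewrite rate_arrival// rate_completion// -EFinD addSnnS; congr EFin.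
have -> : iter r.+1 backward g (y j) = lambda / c * iter r backward g (arrival (y j)) +
    k%:R * mu / c * iter r backward g (down (y j)).
  by rewrite iterS {1}/backward (negbTE yj).
ring.
Qed.

Lemma integral_killed (g : T -> R) n : (forall x, 0 <= g x) ->
  (forall n, measurable_fun setT (g \o Y n)) ->
  (\int[P]_w ((all (fun i => Y i w != (0%N, 0%N)) (iota 0 n))%:R * g (Y n w) *
     \prod_(i < n) killed_exp theta (W i w))%:E =
   (((lambda + k%:R * mu) / (lambda + k%:R * mu + theta)) ^+ n * iter n backward g (1%N, k))%:E)%E.
Proof.
move=> g0 mg.
have xS : erlang_state x0 by rewrite /erlang_state /busy_state/= k1 leqnn ?orbT.
have := @integral_st g n 0%N (fun=> x0) g0 mg erefl (fun i => ltac:(by [])) xS.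
rewrite big_ord0 mul1r => <-; apply: ge0_ae_eq_integral => //.
- by apply/measurable_EFinP; apply: measurable_st.
- apply/measurable_EFinP; apply: measurable_funM.
    by apply: measurable_bool_natr; exact: measurable_follows.
  exact: measurable_st.
- by move=> w _; rewrite lee_fin; apply: (st_ge0 0 n w g0).
- by move=> w _; rewrite lee_fin mulr_ge0// st_ge0.
apply: filterS chain_valid => w [H0 _] _; rewrite -[LHS]/((st g 0 n w)%:E).
case: followsP => [_|H]; first by rewrite mul1r.
by exfalso; apply: H => i; rewrite leqn0 => /eqP ->.
Qed.

End law.
End Erlang_chain.

(** * Ballot numbers *)

Section hit_weight.
Context {R : realType}.
Variable k : nat.

(* The number of phases still to be served determines the passage law: it jumps
   by +k at an arrival and by -1 at a phase completion. *)
Definition phases (x : nat * nat) : nat := if x.1 is n.+1 then (n * k + x.2)%N else 0%N.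

Lemma phases_arrival x : busy_state k x -> phases (arrival x) = (phases x + k)%N.
Proof. by case: x => [[|n] s]//= _; rewrite /phases/= mulSn; lia. Qed.

Lemma phases_completion x : busy_state k x ->
  phases x = (phases (phase_completion k x)).+1.
Proof.
case: x => [[|n] [|s]]//=; rewrite /phase_completion/phases/= ?andbF//= => _.
by case: s => [|s]/=; case: n => [|n]/=; rewrite ?mulSn; lia.
Qed.

Variables a b : R.

(** Total weight of the walks from [m] that reach 0 for the first time at step [n], an upward jump
    of [k] weighing [a] and a downward unit step [b]. *)
Fixpoint hit_weight (m n : nat) : R :=
  if n is n'.+1 then
    if m is m'.+1 then a * hit_weight (m + k) n' + b * hit_weight m' n' else 0
  else (m == 0%N)%:R.

(** A walk with r upward jumps needs m + r k downward steps to reach 0, hence m + r (k + 1) steps in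
    all. *)
Lemma hit_weight_eq0 n m : (forall r, n <> m + r * k.+1)%N -> hit_weight m n = 0.
Proof.
elim: n m => [|n IH] [|m] H//=.
- by have := H 0%N.
- rewrite !IH ?mulr0 ?addr0// => r E.
    by apply: (H r); rewrite addSn E.
  by apply: (H r.+1); rewrite mulSn; lia.
Qed.

(** Ballot formula, by decomposition on the first step. The side condition excludes m = r = 0, where
    the weight is 1 but the quotient m / n is 0 / 0, that is 0; it still allows m = 0 with r > 0,
    which the downward step reaches. *)
Lemma hit_weightE n m r : n = (m + r * k.+1)%N -> (0 < m)%N || (0 < r)%N ->
  hit_weight m n = m%:R / n%:R * 'C(n, r)%:R * a ^+ r * b ^+ (m + r * k).
Proof.
elim: n m r => [|n IH] [|m] r E mr.
- by move: E mr; rewrite add0n; case: r.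
- by [].
- by rewrite /= !mul0r.
have nE : n = (m + r * k.+1)%N by move: E; rewrite addSn => -[].
have n1 : n.+1%:R != 0 :> R by rewrite pnatr_eq0.
rewrite /=; case: r => [|r] in E mr nE *.
  rewrite mul0n addn0 in nE; subst n.
  rewrite bin0 expr0 !mulr1 mul0n addn0 divff// mul1r.
  rewrite hit_weight_eq0 ?mulr0 ?add0r; last by move=> r'; lia.
  case: m => [|m] in IH E mr n1 *; first by rewrite /= ?eqxx mulr1 ?expr1.
  rewrite (IH m.+1 0%N) ?mul0n ?addn0// divff ?pnatr_eq0//.
  by rewrite bin0 expr0 !mulr1 ?mul1r -exprS.
have n0 : (0 < n)%N by lia.
have n0R : n%:R != 0 :> R by rewrite pnatr_eq0 -lt0n.
rewrite (IH (m.+1 + k)%N r); [|by lia|by []].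
rewrite (IH m r.+1); [|by []|by rewrite orbT].
(* Both binomials of the recursion are expressed through C(n + 1, r + 1), which reduces the claim to
   an identity of rational functions. *)
have E1 : 'C(n, r)%:R = r.+1%:R / n.+1%:R * 'C(n.+1, r.+1)%:R :> R.
  apply: (mulfI n1); rewrite -natrM (mul_bin_diag n.+1 r) natrM.
  by rewrite mulrA [X in _ = X * _]mulrCA mulfV// mulr1.
have E2 : 'C(n, r.+1)%:R = (n.+1%:R - r.+1%:R) / n.+1%:R * 'C(n.+1, r.+1)%:R :> R.
  apply: (mulfI n1); rewrite -natrM (mul_bin_down n.+1 r.+1) natrM natrB; last by lia.
  by rewrite mulrA [X in _ = X * _]mulrCA mulfV// mulr1.
have -> : (m.+1 + r.+1 * k)%N = (m.+1 + k + r * k)%N by rewrite mulSn; lia.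
have -> : b * (m%:R / n%:R * 'C(n, r.+1)%:R * a ^+ r.+1 * b ^+ (m + r.+1 * k)) =
  m%:R / n%:R * 'C(n, r.+1)%:R * a ^+ r.+1 * b ^+ (m.+1 + k + r * k).
  rewrite (_ : (m.+1 + k + r * k) = (m + r.+1 * k).+1)%N ?exprS; first by ring.
  by rewrite mulSn; lia.
rewrite E1 E2 exprS.
have -> : n.+1%:R = m.+1%:R + r.+1%:R * k.+1%:R :> R by rewrite E natrD natrM.
have nER : n%:R = m%:R + r.+1%:R * k.+1%:R :> R by rewrite nE natrD natrM.
have d0 : m.+1%:R + r.+1%:R * k.+1%:R != 0 :> R by rewrite -natrM -natrD pnatr_eq0.
move: (b ^+ _) (a ^+ r) ('C(_, _)%:R) => bb aa cc.
rewrite nER in n0R *; rewrite natrD -!natr1 in n0R d0 *; field.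
by rewrite n0R d0.
Qed.
End hit_weight.

Section first_passage.
Context {R : realType}.
Variables (lambda mu : R) (k : nat).
Hypotheses (lambda0 : 0 < lambda) (mu0 : 0 < mu) (k1 : (1 <= k)%N).
Let c := lambda + k%:R * mu.

Lemma iter_backward_hit n x : erlang_state k x ->
  iter n (backward lambda mu k) (fun x => (x == (0%N, 0%N))%:R) x =
  hit_weight k (lambda / c) (k%:R * mu / c) (phases k x) n.
Proof.
have k0x y : erlang_state k y -> (phases k y == 0%N) = (y == (0%N, 0%N)).
  case/orP => [/eqP ->|by_]; first by rewrite !eqxx.
  by rewrite (phases_completion by_) (negbTE (busy_neq0 by_)).
elim: n x => [|n IH] x xS; first by rewrite /= k0x.
rewrite iterS {1}/backward; case: ifP => [/eqP ->//|x0].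
have bx : busy_state k x by move: xS; rewrite /erlang_state x0.
have xa : erlang_step k x (arrival x) by rewrite /erlang_step x0 eqxx.
have xc : erlang_step k x (phase_completion k x) by rewrite /erlang_step x0 eqxx orbT.
rewrite !IH; [|exact: erlang_state_step xc|exact: erlang_state_step xa].
by rewrite phases_arrival// (phases_completion bx).
Qed.

(** The partial sums of the sparse series are those of [f] at the indices k + r (k + 1), hence a
    subsequence of a convergent sequence. *)
Lemma series_sparse (f : nat -> R) (l : R) :
  (forall n, (forall r, n <> k + r * k.+1)%N -> f n = 0) ->
  series f @ \oo --> l -> series (fun r => f (k + r * k.+1)%N) @ \oo --> l.
Proof.
move=> f0 fl.
have E r : series f (k + r * k.+1)%N = series (fun r => f (k + r * k.+1)%N) r.
  elim: r => [|r IH].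
    rewrite mul0n addn0 [RHS]/series/= big_geq// /series/= big_nat big1// => i /andP[_ ik].
    by apply: f0 => r; lia.
  rewrite seriesSr -IH (_ : k + r.+1 * k.+1 = k + (k + r * k.+1).+1)%N; last by rewrite mulSn; lia.
  rewrite series_addn seriesSr big_nat big1 ?addr0// => i /andP[i1 i2].
  apply: f0 => r'; have [rr|rr] := leqP r' r.
    have : (r' * k.+1 <= r * k.+1)%N by rewrite leq_mul2r rr orbT.
    by lia.
  have : (r.+1 * k.+1 <= r' * k.+1)%N by rewrite leq_mul2r rr orbT.
  by rewrite mulSn; lia.
have -> : series (fun r => f (k + r * k.+1)%N) = series f \o (fun r => k + r * k.+1)%N.
  by apply/funext => r /=; rewrite E.
apply: cvg_comp fl; apply/cvgnyPge => A; exists A => // n /= An.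
by rewrite mulnS; lia.
Qed.

Lemma passage_series (theta l : R) : 0 <= theta ->
  series (fun n => (c / (c + theta)) ^+ n *
    iter n (backward lambda mu k) (fun x => (x == (0%N, 0%N))%:R) (1%N, k)) @ \oo --> l ->
  series (fun r => CB lambda mu k r / (c + theta) ^+ deltaB k r) @ \oo --> l.
Proof.
move=> theta0.
have xS : erlang_state k (1%N, k) by rewrite /erlang_state /busy_state/= k1 leqnn ?orbT.
have c0 : 0 < c by rewrite addr_gt0// mulr_gt0// ltr0n.
have ct : 0 < c + theta by rewrite ltr_pwDl.
have kE : phases k (1%N, k) = k by rewrite /phases/= mul0n add0n.
move=> /series_sparse H.
rewrite (_ : (fun r => _) = (fun r => (c / (c + theta)) ^+ (k + r * k.+1) *
    iter (k + r * k.+1) (backward lambda mu k) (fun x => (x == (0%N, 0%N))%:R) (1%N, k))).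
  by apply: H => n nr; rewrite iter_backward_hit// kE hit_weight_eq0 ?mulr0.
apply/funext => r; rewrite iter_backward_hit// kE (@hit_weightE _ _ _ _ _ k r)// ?k1//.
rewrite /CB /C0 /deltaB /delta0.
have -> : 'C(k + r * k.+1, k + r * k) = 'C(k + r * k.+1, r).
  rewrite -(@bin_sub (k + r * k.+1) r) ?mulnS; last by lia.
  by congr 'C(_, _); lia.
(* The truncated subtraction is exact because k >= 1; the missing power is restored by the factor k
   mu in [CB]. *)
have -> : (k%:R * mu) ^+ (k + r * k - 1) = (k%:R * mu) ^+ (k + r * k) / (k%:R * mu).
  rewrite -[in RHS](@subnK 1 (k + r * k)); last by lia.
  by rewrite addn1 exprSr mulfK// mulf_neq0 ?gt_eqF// ltr0n.
have -> : (c / (c + theta)) ^+ (k + r * k.+1) = c ^+ r * c ^+ (k + r * k) / (c + theta) ^+ (k + r * k.+1).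
  by rewrite expr_div_n -exprD; congr (_ ^+ _ / _); rewrite mulnS; lia.
rewrite !expr_div_n.
have n0 : (k + r * k.+1)%:R != 0 :> R by rewrite pnatr_eq0; lia.
have cr0 : c ^+ r != 0 by rewrite expf_neq0// gt_eqF.
have ck0 : c ^+ (k + r * k) != 0 by rewrite expf_neq0// gt_eqF.
have ct0 : (c + theta) ^+ (k + r * k.+1) != 0 by rewrite expf_neq0// gt_eqF.
have km0 : k%:R * mu != 0 by rewrite mulf_neq0 ?gt_eqF// ltr0n.
move: n0 cr0 ck0 ct0 km0.
move: ((k + r * k.+1)%:R) (c ^+ r) (c ^+ (k + r * k)) ((c + theta) ^+ _) ((k%:R * mu) ^+ _) (lambda ^+ r) ('C(_, _)%:R).
move: (k%:R * mu) => km N u v x y z w n0 u0 v0 x0 km0; field.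
by rewrite n0 u0 v0 x0 km0.
Qed.
End first_passage.

(** * Transfer along the inverse subordinator *)

Section sandwich.
Context {R : realType}.
Local Notation mu := (@lebesgue_measure R).
Let Rp := (`[0%R, +oo[%classic : set R).

(** The kernels are left abstract to serve twice: [K j] is the distribution function of sigma(j eps)
    in one use, and that of the constant j eps in the other. *)
Lemma laplace_sandwich (F : R -> R) (K : nat -> R -> R) (p l : nat -> R) (J : nat) (v : R) :
  measurable_fun Rp F -> (forall j, measurable_fun Rp (K j)) ->
  (forall t, 0 <= t -> 0 <= F t) -> (forall j t, 0 <= t -> 0 <= K j t) -> (forall j, 0 <= p j) ->
  (forall j, \int[mu]_(t in Rp) (expR (- (v * t)) * K j t)%:E = (l j)%:E)%E ->
  (forall t, 0 <= t -> \sum_(j < J) p j * K j.+1 t <= F t <= \sum_(j < J) p j * K j t + K J t) ->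
  \sum_(j < J) p j * l j.+1 <= laplace F v <= \sum_(j < J) p j * l j + l J.
Proof.
move=> mF mK F0 K0 p0 HK HF.
have mRp : measurable Rp by exact: measurable_itv.
pose e j t := (expR (- (v * t)) * K j t)%:E.
have me j : measurable_fun Rp (e j).
  by apply/measurable_EFinP; apply: measurable_funM => //; exact: measurable_expRN.
have e0 j t : Rp t -> (0 <= e j t)%E.
  by rewrite /Rp/= in_itv/= andbT => t0; rewrite lee_fin mulr_ge0 ?expR_ge0 ?K0.
have pe0 (i j : nat) t : Rp t -> (0 <= (p i)%:E * e j t)%E.
  by move=> Rt; apply: mule_ge0; [rewrite lee_fin|exact: e0].
have Isum (h : nat -> nat) : (\int[mu]_(t in Rp) (\sum_(j < J) (p j)%:E * e (h j) t) =
    (\sum_(j < J) p j * l (h j))%R%:E)%E.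
  rewrite ge0_integral_sum//.
  - rewrite -sumEFin; apply: eq_bigr => j _.
    have k0 : (0 <= (p j)%:E)%E by rewrite lee_fin.
    by rewrite (ge0_integralZl mu mRp (me (h j)) (e0 (h j)) k0) HK EFinM.
  - by move=> j; apply: measurable_funeM; exact: me.
  - by move=> j t Rt; exact: pe0.
have esum t (h : nat -> nat) : (\sum_(j < J) (p j)%:E * e (h j) t =
    (expR (- (v * t)) * \sum_(j < J) p j * K (h j) t)%:E)%E.
  rewrite mulr_sumr -sumEFin; apply: eq_bigr => j _.
  by rewrite /e -EFinM; congr EFin; ring.
have mFe : measurable_fun Rp (fun t => (expR (- (v * t)) * F t)%:E).
  by apply/measurable_EFinP; apply: measurable_funM => //; exact: measurable_expRN.
have lo : ((\sum_(j < J) p j * l j.+1)%R%:E <= \int[mu]_(t in Rp) (expR (- (v * t)) * F t)%:E)%E.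
  rewrite -(Isum S); apply: ge0_le_integral => //.
  - by move=> t Rt; apply: sume_ge0 => j _; exact: pe0.
  - by apply: emeasurable_sum => j; apply: measurable_funeM; exact: me.
  - move=> t; rewrite /Rp/= in_itv/= andbT => t0; rewrite esum lee_fin ler_wpM2l ?expR_ge0//.
    by have /andP[] := HF _ t0.
have hi : (\int[mu]_(t in Rp) (expR (- (v * t)) * F t)%:E <= (\sum_(j < J) p j * l j + l J)%R%:E)%E.
  rewrite EFinD -(Isum id) -HK -ge0_integralD//; last 4 first.
  - by move=> t Rt; apply: sume_ge0 => j _; exact: pe0.
  - by apply: emeasurable_sum => j; apply: measurable_funeM; exact: me.
  - by move=> t Rt; exact: e0.
  - exact: me.
  apply: ge0_le_integral => //.
  - by move=> t; rewrite /Rp/= in_itv/= andbT => t0; rewrite lee_fin mulr_ge0 ?expR_ge0 ?F0.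
  - apply: emeasurable_funD; last exact: me.
    by apply: emeasurable_sum => j; apply: measurable_funeM; exact: me.
  - move=> t; rewrite /Rp/= in_itv/= andbT => t0; rewrite (esum t id) -EFinD -mulrDr lee_fin ler_wpM2l ?expR_ge0//.
    by have /andP[] := HF _ t0.
have fin : (\int[mu]_(t in Rp) (expR (- (v * t)) * F t)%:E)%E \is a fin_num.
  by rewrite fin_numElt (lt_le_trans _ lo) ?ltNyr// (le_lt_trans hi)// ltry.
by rewrite -!lee_fin /laplace /Rintegral fineK// lo hi.
Qed.

(* The upper and lower sums differ by at most
   1 - exp (- eps theta) + exp (- J eps theta). *)
Lemma grid_squeeze (x y theta : R) (p : R -> nat -> R) : 0 < theta ->
  (forall eps j, 0 <= p eps j) -> (forall eps J, 0 < eps -> \sum_(j < J) p eps j <= 1) ->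
  (forall eps J, 0 < eps ->
    \sum_(j < J) p eps j * expR (- (j.+1%:R * eps * theta)) <= x <=
    \sum_(j < J) p eps j * expR (- (j%:R * eps * theta)) + expR (- (J%:R * eps * theta))) ->
  (forall eps J, 0 < eps ->
    \sum_(j < J) p eps j * expR (- (j.+1%:R * eps * theta)) <= y <=
    \sum_(j < J) p eps j * expR (- (j%:R * eps * theta)) + expR (- (J%:R * eps * theta))) ->
  x = y.
Proof.
move=> t0 p0 p1 Hx Hy.
have key a J : 0 < a -> (0 < J)%N -> `|x - y| <= a + (J%:R * a)^-1.
  move=> a0 J0; pose eps := a / theta.
  have eps0 : 0 < eps by rewrite divr_gt0.
  have ea n : n%:R * eps * theta = n%:R * a by rewrite -mulrA divfK// gt_eqF.
  have := Hx eps J eps0; have := Hy eps J eps0.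
  set lo := \sum_(j < J) _; set hi := \sum_(j < J) _ => /andP[y1 y2] /andP[x1 x2].
  have hl : hi - lo <= a.
    rewrite /hi /lo -sumrB.
    apply: (@le_trans _ _ (\sum_(j < J) p eps j * a)).
      apply: ler_sum => j _; rewrite -mulrBr ler_wpM2l// !ea -natr1 mulrDl mul1r opprD expRD.
      rewrite -{1}[expR (- (j%:R * a))]mulr1 -mulrBr.
      have e1 : expR (- (j%:R * a)) <= 1.
        by rewrite -expR0 ler_expR oppr_le0 mulr_ge0// ltW.
      have e2 : 1 - expR (- a) <= a by have := expR_ge1Dx (- a); lra.
      have e3 : 0 <= 1 - expR (- a) by rewrite subr_ge0 -expR0 ler_expR oppr_le0 ltW.
      by rewrite (le_trans _ e2)// ler_piMl.
    by rewrite -mulr_suml -[leRHS]mul1r ler_wpM2r ?(ltW a0)// p1.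
  have Ja : 0 < J%:R * a by rewrite mulr_gt0// ltr0n.
  have tl : expR (- (J%:R * eps * theta)) <= (J%:R * a)^-1.
    rewrite ea expRN lef_pV2 ?posrE ?expR_gt0//.
    by have := expR_ge1Dx (J%:R * a); lra.
  by rewrite ler_norml; apply/andP; split; lra.
apply/eqP; rewrite -subr_eq0 -normr_eq0 eq_le normr_ge0 andbT leNgt; apply/negP => h0.
set eta := `|x - y| in key h0.
have e3 : 0 < eta / 3 by rewrite divr_gt0.
(* With a = eta / 3, this [J] exceeds a^(-2), so 1 / (J a) < a and [key] would give eta < 2 eta /
   3. *)
pose J := (Num.truncn ((eta / 3 * (eta / 3))^-1)).+1.
have := key (eta / 3) J e3 (ltn0Sn _).
have J1 : (eta / 3 * (eta / 3))^-1 < J%:R by exact: truncnS_gt.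
have : (J%:R * (eta / 3))^-1 < eta / 3.
  rewrite -[ltRHS]invrK ltf_pV2 ?posrE ?invr_gt0// ?mulr_gt0 ?ltr0n//.
  by rewrite -ltr_pdivrMr// -invfM.
lra.
Qed.
End sandwich.

Section probability_sandwich.
Context {R : realType} {d : measure_display} {Omega : measurableType d}.
Variable P : probability Omega R.
Local Notation mu := (@lebesgue_measure R).

Definition pr (A : set Omega) : R := fine (P A).

Lemma prE A : measurable A -> P A = (pr A)%:E.
Proof. by move=> mA; rewrite /pr fineK// fin_num_measure. Qed.

Lemma pr_ge0 A : 0 <= pr A. Proof. exact/fine_ge0. Qed.

Lemma pr_le1 A : measurable A -> pr A <= 1.
Proof. by move=> mA; rewrite -lee_fin -prE// probability_le1. Qed.

Lemma ae_le_pr (A B : set Omega) : measurable A -> measurable B ->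
  {ae P, forall w, A w -> B w} -> pr A <= pr B.
Proof.
move=> mA mB [N [mN N0 H]]; rewrite -lee_fin -!prE//.
apply: (@le_trans _ _ (P (B `|` N))).
  apply: le_measure; rewrite ?inE//; first exact: measurableU.
  move=> w Aw; have [Bw|Bw] := pselect (B w); first by left.
  by right; apply: H => /= /(_ Aw).
by rewrite measureU0.
Qed.

Lemma ae_eq_pr (A B : set Omega) : measurable A -> measurable B ->
  {ae P, forall w, A w <-> B w} -> pr A = pr B.
Proof.
move=> mA mB H; apply/eqP; rewrite eq_le; apply/andP; split; apply: ae_le_pr => //;
by apply: filterS H => w [].
Qed.

Lemma pr_bigsetU (A : nat -> set Omega) (J : nat) : (forall j, measurable (A j)) ->
  trivIset setT A -> pr (\big[setU/set0]_(j < J) A j) = \sum_(j < J) pr (A j).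
Proof.
move=> mA tA; apply: EFin_inj; rewrite -prE; last exact: bigsetU_measurable.
rewrite -sumEFin measure_bigsetU//; apply: eq_bigr => j _; exact: prE.
Qed.

(** To be read with [E j] the event that the queue empties between j eps and (j + 1) eps, [Z j] the
    event sigma(j eps) <= t, and [D] the event B <= t. If no [E j] with j < J occurs, the queue
    empties after J eps, which accounts for the last term. *)
Lemma pr_sandwich (D : set Omega) (E Z : nat -> set Omega) (J : nat) :
  measurable D -> (forall j, measurable (E j)) -> (forall j, measurable (Z j)) ->
  trivIset setT E -> (forall i j, pr (E i `&` Z j) = pr (E i) * pr (Z j)) ->
  {ae P, forall w, forall j, E j w -> Z j.+1 w -> D w} ->
  {ae P, forall w, forall j, E j w -> D w -> Z j w} ->
  {ae P, forall w, (forall j, (j < J)%N -> ~ E j w) -> D w -> Z J w} ->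
  \sum_(j < J) pr (E j) * pr (Z j.+1) <= pr D <= \sum_(j < J) pr (E j) * pr (Z j) + pr (Z J).
Proof.
move=> mD mE mZ tE EZ H1 H2 H3.
have tEZ (h : nat -> nat) : trivIset setT (fun j => E j `&` Z (h j)).
  apply/trivIsetP => i j _ _ ij; move/trivIsetP : tE => /(_ i j I I ij) EE.
  by rewrite setIACA EE set0I.
have mEZ (h : nat -> nat) j : measurable (E j `&` Z (h j)) by exact: measurableI.
have SE (h : nat -> nat) : \sum_(j < J) pr (E j) * pr (Z (h j)) =
    pr (\big[setU/set0]_(j < J) (E j `&` Z (h j))).
  rewrite (@pr_bigsetU (fun j => E j `&` Z (h j)))//.
  by apply: eq_bigr => j _; rewrite EZ.
rewrite (SE S) (SE id); apply/andP; split.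
  apply: ae_le_pr => //; first by apply: bigsetU_measurable => j _; exact: (mEZ S).
  apply: filterS H1 => w Hw; rewrite -(bigcup_mkord J (fun j => E j `&` Z j.+1)) => -[j _ [Ejw Zw]]; exact: Hw Ejw Zw.
have mU : measurable (\big[setU/set0]_(j < J) (E j `&` Z j)).
  by apply: bigsetU_measurable => j _; exact: (mEZ id).
apply: (@le_trans _ _ (pr ((\big[setU/set0]_(j < J) (E j `&` Z j)) `|` Z J))).
  apply: ae_le_pr => //; first exact: measurableU.
  apply: filterS2 H2 H3 => w H2 H3 Dw.
  have [[j jJ Ejw]|nE] := pselect (exists2 j, (j < J)%N & E j w).
    by left; rewrite -(bigcup_mkord J (fun j => E j `&` Z j)); exists j => //; split=> //; exact: H2.
  by right; apply: H3 => // j jJ Ejw; apply: nE; exists j.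
rewrite -lee_fin EFinD -!prE//; last exact: measurableU.
exact: measureU2.
Qed.

Lemma laplace_prob_layer (b : Omega -> bool) (X : Omega -> R) (theta : R) : 0 < theta ->
  measurable_fun setT b -> measurable_fun setT X -> (forall w, b w -> 0 <= X w) ->
  (theta%:E * \int[mu]_(s in `[0%R, +oo[) (expR (- (theta * s)) * pr [set w | b w && (X w <= s)%R])%:E =
   \int[P]_w ((b w)%:R * expR (- (theta * X w)))%:E)%E.
Proof.
move=> t0 mb mX bX.
have mset s : measurable_fun setT (fun w => b w && (X w <= s)).
  by apply: measurable_and => //; exact: measurable_fun_ler.
have msets s : measurable [set w | b w && (X w <= s)].
  exact/measurable_bool_set/mset.
have bX0 w : X w < 0 -> (b w)%:R = 0 :> R.
  by move=> Xw; have [/bX|//] := boolP (b w); rewrite leNgt Xw.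
rewrite -(@laplace_layer _ _ _ P (fun w => (b w)%:R) X theta t0 (measurable_bool_natr mb) mX
  (fun w => ler0n _ _) bX0).
have E s : (\int[P]_w ((b w)%:R * (X w <= s)%R%:R)%:E = (pr [set w | b w && (X w <= s)])%:E)%E.
  rewrite -prE// -integral_bool_natr//; apply: eq_integral => w _.
  by rewrite -natrM mulnb.
under [RHS]eq_integral do rewrite E -EFinM -mulrA EFinM.
have nd : {homo (fun s => pr [set w | b w && (X w <= s)]) : s t / s <= t}.
  move=> s t st; apply: ae_le_pr => //; apply: aeW => w /= /andP[-> /=] /le_trans; exact.
rewrite ge0_integralZl//.
- apply/measurable_EFinP; apply: measurable_funM; first exact: measurable_expRN.
  by apply: measurable_funTS; exact: nondecreasing_measurable.
- by move=> s _; rewrite lee_fin mulr_ge0 ?expR_ge0 ?pr_ge0.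
- by rewrite lee_fin ltW.
Qed.
End probability_sandwich.

(** * Pathwise properties of the time change and of jump paths *)

Section deterministic_paths.
Context {R : realType}.

Section time_change.
Variables (T : Type) (sig : R -> R) (X : R -> T) (x : T).
Let inv_sig t := inf [set s | 0 <= s /\ t < sig s].
Let hit := ereal_inf [set t%:E | t in [set t : R | 0 <= t /\ X (inv_sig t) = x]].

(** For t < sig s the inverse at [t] lies between 0 and [s], where [X] avoids [x]. *)
Lemma time_changed_hit_ge (s : R) : 0 <= s ->
  (forall u, 0 <= u <= s -> X u <> x) -> ((sig s)%:E <= hit)%E.
Proof.
move=> s0 Xs; apply: le_ereal_inf_tmp => _ /= [t [t0 Xt] <-]; rewrite lee_fin leNgt.
apply/negP => ts; apply: Xs Xt.
have S0 : [set s | 0 <= s /\ t < sig s] s by split.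
apply/andP; split.
  by apply: lb_le_inf; [exists s|move=> u []].
by apply: ge_inf => //; exists 0 => u [].
Qed.

(** Strict monotonicity makes the inverse at sig u equal to [u], so the time-changed path is at [x]
    at time sig u, which is nonnegative because sig 0 = 0. *)
Lemma time_changed_hit_le (u s : R) : 0 <= u -> u <= s -> X u = x ->
  sig 0 = 0 -> (forall a b, 0 <= a -> a < b -> sig a < sig b) -> (hit <= (sig s)%:E)%E.
Proof.
move=> u0 us Xu sig0 sigS.
have sigW a b : 0 <= a -> a <= b -> sig a <= sig b.
  by move=> a0; rewrite le_eqVlt => /predU1P[->//|ab]; apply/ltW/sigS.
apply: (@le_trans _ _ (sig u)%:E); last by rewrite lee_fin sigW.
apply: ereal_inf_lbound => /=; exists (sig u) => //; split.
  by rewrite -sig0 sigW.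
suff -> : inv_sig (sig u) = u by [].
have inS e : 0 < e -> [set s | 0 <= s /\ sig u < sig s] (u + e).
  by move=> e0; split; [rewrite addr_ge0// ltW|apply: sigS; rewrite ?ltrDl].
apply/eqP; rewrite eq_le; apply/andP; split.
  apply/ler_addgt0Pr => e e0; apply: ge_inf; last exact: inS.
  by exists 0 => v [].
apply: lb_le_inf; first by exists (u + 1); exact: inS.
by move=> v [v0 uv]; rewrite leNgt; apply/negP => /ltW/(sigW _ _ v0); rewrite leNgt uv.
Qed.
End time_change.

Section jump_path.
Variables (T : eqType) (z : T) (Q : R -> T) (Y : nat -> T) (W : nat -> R).
Let S n := \sum_(i < n) W i.
Hypothesis W0 : forall n, 0 < W n.
Hypothesis QY : forall (n : nat) (t : R), S n <= t < S n.+1 -> Q t = Y n.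
Hypothesis Sy : (forall n, Y n <> z) -> forall M : nat, exists n, M%:R < S n.

Definition first_hit n := all (fun i => Y i != z) (iota 0 n) && (Y n == z).

Lemma jump_timeS n : S n.+1 = S n + W n.
Proof. by rewrite /S big_ord_recr. Qed.

Lemma jump_time_le m n : (m <= n)%N -> S m <= S n.
Proof.
move=> /subnKC <-; elim: (n - m)%N => [|j IH]; first by rewrite addn0.
by rewrite addnS jump_timeS (le_trans IH)// lerDl ltW.
Qed.

Lemma first_hit_exists n : Y n = z -> exists2 m, (m <= n)%N & first_hit m.
Proof.
move=> Yn; have [m /eqP Ym Hm] := @ex_minnP (fun m => Y m == z) (ex_intro _ n (introT eqP Yn)).
exists m; first by apply: Hm; apply/eqP.
rewrite /first_hit Ym eqxx andbT; apply/allP => i; rewrite mem_iota add0n => /andP[_ im].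
by apply/negP => /Hm; rewrite leqNgt im.
Qed.

(** Where the jump times pass [u], the value of [Q] is read from [Y]. If they all stay below [u],
    then [Q] is unspecified at [u], but [Sy] forces [Y] to visit [z], and the time of that visit is
    at most [u] anyway. *)
Lemma visit_after_first_hit u : 0 <= u -> Q u = z -> exists2 n, first_hit n & S n <= u.
Proof.
move=> u0 Qu.
have [H|] := pselect (exists n, u < S n); last first.
  move=> H; have HS n : S n <= u by rewrite leNgt; apply/negP => un; apply: H; exists n.
  have [[n Yn]|Yz] := pselect (exists n, Y n = z).
    by have [m mn hm] := first_hit_exists Yn; exists m.
  have [n Hn] := Sy (fun n Yn => Yz (ex_intro _ n Yn)) (Num.truncn u).+1.
  exfalso; have := lt_trans (truncnS_gt u) Hn; by rewrite ltNge HS.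
have [n un Hn] := ex_minnP H.
case: n un Hn => [|n] un Hn; first by exfalso; move: un; rewrite /S big_ord0 ltNge u0.
have Snu : S n <= u by rewrite leNgt; apply/negP => /Hn; rewrite ltnn.
have Yn : Y n = z by rewrite -(QY (n := n) (t := u))// Snu un.
have [m mn hm] := first_hit_exists Yn; exists m => //.
exact: le_trans (jump_time_le mn) Snu.
Qed.

Lemma hit_interval n t : first_hit n -> S n <= t < S n.+1 -> Q t = z.
Proof. by move=> /andP[_ /eqP Yn] /QY ->. Qed.
End jump_path.

(* A visited state is held for a positive time, so a visit before s is also seen
   at a rational time or at s itself; this puts the event that the queue has
   emptied by s in the sigma-algebra generated by Q. *)
Definition observation_time (s : R) (n : nat) : R :=
  if (unpickle n : option rat) is Some r then
    if 0 <= (ratr r : R) <= s then ratr r else s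
  else s.

Lemma observation_time_bound s n : 0 <= s -> 0 <= observation_time s n <= s.
Proof.
by move=> s0; rewrite /observation_time; case: unpickle => [r|]; [case: ifP => //|]; rewrite s0 lexx.
Qed.

Lemma observation_time_ratr s (r : rat) : 0 <= (ratr r : R) <= s ->
  observation_time s (pickle r) = ratr r.
Proof. by move=> rs; rewrite /observation_time pickleK rs. Qed.

Lemma observation_time_self s : exists n, observation_time s n = s.
Proof.
exists (pickle (-1 : rat)); rewrite /observation_time pickleK.
by rewrite rmorphN1 lerNr oppr0 ler10.
Qed.
End deterministic_paths.

Section almost_everywhere.
Context {R : realType} {d : measure_display} {Omega : measurableType d}.
Variable P : probability Omega R.

Lemma ae_forall_countable (I : countType) (Pr : I -> Omega -> Prop) :
  (forall i, {ae P, forall w, Pr i w}) -> {ae P, forall w, forall i, Pr i w}.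
Proof.
move=> H.
have : {ae P, forall w (n : nat), if unpickle n is Some i then Pr i w else True}.
  apply: ae_foralln => n; case: unpickle => [i|]; [exact: H|exact: aeW].
by apply: filterS => w Hw i; have := Hw (pickle i); rewrite pickleK.
Qed.

Lemma pr0_ae (A : set Omega) : measurable A -> pr P A = 0 -> {ae P, forall w, ~ A w}.
Proof.
move=> mA A0; exists A; split => //; first by rewrite prE// A0.
by move=> w /= /contrapT.
Qed.

(** * Positivity, strict monotonicity and transforms of the stable subordinator *)

Section subordinator.
Variables (nu : R) (sigma : R -> Omega -> R).
Hypothesis nu0 : 0 < nu.
Hypothesis hsigma : stable_subordinator P nu sigma.

Lemma subordinator_integral (t v : R) : 0 <= t -> 0 < v ->
  (\int[P]_w (expR (- (v * sigma t w)))%:E = (expR (- (t * v `^ nu)))%:E)%E.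
Proof. by move=> t0 v0; rewrite -(subordinator_laplace hsigma t0 v0) unlock. Qed.

(** On this event exp (- v sigma(t)) is at least 1, so its probability is at most exp (- t v^nu); v
    is chosen with v^nu = n + 1, and n is arbitrary. *)
Lemma subordinator_gt0 (t : R) : 0 < t -> pr P [set w | sigma t w <= 0] = 0.
Proof.
move=> t0.
have ms := subordinator_measurable hsigma (ltW t0).
have mb : measurable_fun setT (fun w => sigma t w <= 0) by exact: measurable_fun_ler.
have mA : measurable [set w | sigma t w <= 0].
  exact: measurable_bool_set.
have key n : pr P [set w | sigma t w <= 0] * (t * n.+1%:R) <= 1.
  pose v := n.+1%:R `^ nu^-1 : R.
  have v0 : 0 < v by rewrite powR_gt0.
  have vnu : v `^ nu = n.+1%:R by rewrite -powRrM mulVf ?gt_eqF// powRr1.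
  have H : pr P [set w | sigma t w <= 0] <= expR (- (t * n.+1%:R)).
    rewrite -lee_fin -prE// -vnu -subordinator_integral// ?(ltW t0)//.
    rewrite -integral_bool_natr//; apply: ge0_le_integral => //.
    - by apply/measurable_EFinP; exact: measurable_bool_natr.
    - apply/measurable_EFinP; exact: (measurableT_comp (@measurable_expRN R v setT)).
    - move=> w _; rewrite lee_fin; case: (leP (sigma t w) 0) => st; last exact: expR_ge0.
      by rewrite -expR0 ler_expR oppr_ge0 mulr_ge0_le0// ltW.
  have tn : 0 < t * n.+1%:R by rewrite mulr_gt0.
  rewrite -ler_pdivlMr// mul1r (le_trans H)// expRN lef_pV2 ?posrE ?expR_gt0//.
  by have := expR_ge1Dx (t * n.+1%:R); lra.
apply/eqP; rewrite eq_le pr_ge0 andbT leNgt; apply/negP => p0.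
have := key (Num.truncn ((pr P [set w | sigma t w <= 0] * t)^-1)).
rewrite mulrA leNgt => /negP; apply.
by rewrite -ltr_pdivrMl ?mulr_gt0// mulr1; exact: truncnS_gt.
Qed.

(** Stationarity and [subordinator_gt0] give strictness for each pair of rational times, hence for
    all such pairs at once. Any interval contains two rationals, and monotonicity does the rest. *)
Lemma subordinator_increasing : {ae P, forall w, forall a b : R,
  0 <= a -> a < b -> sigma a w < sigma b w}.
Proof.
have H : {ae P, forall w (pq : rat * rat), 0 <= ratr pq.1 :> R -> pq.1 < pq.2 ->
    sigma (ratr pq.1) w < sigma (ratr pq.2) w}.
  apply: ae_forall_countable => -[p q]/=.
  have [p0|p0] := boolP (0 <= ratr p :> R); last exact: aeW.
  have [pq|pq] := boolP (p < q); last exact: aeW.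
  pose t : R := ratr q - ratr p.
  have t0 : 0 < t by rewrite subr_gt0 ltr_rat.
  have qE : ratr q = ratr p + t by rewrite addrC subrK.
  have q0 : 0 <= ratr q :> R by rewrite qE addr_ge0// ltW.
  have mb : measurable_fun setT (fun w => sigma (ratr p + t) w - sigma (ratr p) w <= 0).
    apply: measurable_fun_ler => //; apply: measurable_funB.
      by rewrite -qE; exact: (subordinator_measurable hsigma).
    exact: (subordinator_measurable hsigma).
  have mA : measurable [set w | sigma (ratr p + t) w - sigma (ratr p) w <= 0].
    exact: measurable_bool_set.
  have pA : pr P [set w | sigma (ratr p + t) w - sigma (ratr p) w <= 0] = 0.
    rewrite -[RHS](subordinator_gt0 t0) /pr; congr fine.
    have := subordinator_stationary_increments hsigma p0 (ltW t0) (measurable_itv `]-oo, 0]).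
    have E (f : Omega -> R) : [set w | `]-oo, 0]%classic (f w)] = [set w | f w <= 0].
      by apply/seteqP; split => w /=; rewrite in_itv.
    by rewrite (E (fun w => sigma (ratr p + t) w - sigma (ratr p) w)) (E (sigma t)).
  apply: filterS (pr0_ae mA pA) => w Hw _ _.
  by rewrite qE -subr_gt0 ltNge; apply/negP.
apply: filterS2 H (subordinator_nondecreasing hsigma) => w H nd a b a0 ab.
have [p] := rat_in_itvoo ab; rewrite in_itv/= => /andP[ap pb].
have [q] := rat_in_itvoo pb; rewrite in_itv/= => /andP[pq qb].
have p0 : 0 <= ratr p :> R by rewrite (le_trans a0)// ltW.
have pq' : p < q by rewrite -(ltr_rat R).
have q0 : 0 <= ratr q :> R by rewrite (le_trans p0)// ltW.
apply: (@le_lt_trans _ _ (sigma (ratr p) w)); first by apply: nd => //; exact: ltW.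
apply: (@lt_le_trans _ _ (sigma (ratr q) w)); first exact: (H (p, q)).
by apply: nd => //; exact: ltW.
Qed.

Lemma subordinator_ge0 : {ae P, forall w, forall t : R, 0 <= t -> 0 <= sigma t w}.
Proof.
apply: filterS2 (subordinator_start hsigma) (subordinator_nondecreasing hsigma) => w s0 nd t t0.
by rewrite -s0 nd.
Qed.

Lemma laplace_subordinator_cdf (s v : R) : 0 <= s -> 0 < v ->
  (\int[lebesgue_measure]_(t in `[0%R, +oo[)
     (expR (- (v * t)) * pr P [set w | (sigma s w <= t)%R])%:E =
   (expR (- (s * v `^ nu)) / v)%:E)%E.
Proof.
move=> s0 v0; have ms := subordinator_measurable hsigma s0.
pose b w := 0 <= sigma s w.
have mb : measurable_fun setT b by exact: measurable_fun_ler.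
have aeb : {ae P, forall w, b w} by apply: filterS subordinator_ge0 => w; exact.
have := laplace_prob_layer P v0 mb ms (fun w bw => bw).
have -> : (\int[P]_w ((b w)%:R * expR (- (v * sigma s w)))%:E = (expR (- (s * v `^ nu)))%:E)%E.
  rewrite -subordinator_integral//; apply: ge0_ae_eq_integral => //.
  - apply/measurable_EFinP; apply: measurable_funM; first exact: measurable_bool_natr.
    exact: (measurableT_comp (@measurable_expRN R v setT)).
  - apply/measurable_EFinP; exact: (measurableT_comp (@measurable_expRN R v setT)).
  - by apply: filterS aeb => w bw _; rewrite bw mul1r.
have -> : (\int[lebesgue_measure]_(t in `[0%R, +oo[)
     (expR (- (v * t)) * pr P [set w | b w && (sigma s w <= t)%R])%:E =
   \int[lebesgue_measure]_(t in `[0%R, +oo[)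
     (expR (- (v * t)) * pr P [set w | (sigma s w <= t)%R])%:E)%E.
  apply: eq_integral => t _; congr (_ * _)%:E.
  have m1 : measurable [set w | (sigma s w <= t)%R].
    have mf : measurable_fun setT (fun w => sigma s w <= t) by exact: measurable_fun_ler.
    exact: measurable_bool_set.
  have m2 : measurable [set w | b w].
    exact: measurable_bool_set.
  apply: ae_eq_pr => //.
    rewrite (_ : [set w | _] = [set w | b w] `&` [set w | (sigma s w <= t)%R]); first exact: measurableI.
    by apply/seteqP; split => w /=; [move=> /andP[]|move=> [-> ->]].
  by apply: filterS aeb => w /= ->.
move=> H; rewrite -[LHS]mul1e -(mulVf (lt0r_neq0 v0)) EFinM -muleA H -EFinM.
by rewrite mulrC.
Qed.
End subordinator.
End almost_everywhere.

Lemma ae_and {R : realType} {d : measure_display} {Omega : measurableType d}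
    (P : probability Omega R) (p1 p2 : Omega -> Prop) :
  {ae P, forall w, p1 w} -> {ae P, forall w, p2 w} -> {ae P, forall w, p1 w /\ p2 w}.
Proof. by move=> H1 H2; apply: filterS2 H1 H2 => w. Qed.

(** * The emptying time of the queue and the busy period of the fractional queue *)

Section busy_period.
Context {R : realType} {d : measure_display} {Omega : measurableType d}.
Variable P : probability Omega R.
Variables (lambda mu : R) (k : nat).
Hypotheses (lambda0 : 0 < lambda) (mu0 : 0 < mu) (k1 : (1 <= k)%N).
Variables (Y : nat -> Omega -> nat * nat) (W : nat -> Omega -> R).
Hypothesis mY : forall n, measurable_fun setT (Y n).
Hypothesis mW : forall n, measurable_fun setT (W n).
Hypothesis joint : forall (n : nat) (y : nat -> nat * nat) (s : nat -> R), (forall i, 0 <= s i) ->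
  P [set w | (forall i, (i <= n)%N -> Y i w = y i) /\ (forall i, (i < n)%N -> s i < W i w)] =
  ((y 0%N == (1%N, k))%:R * \prod_(i < n) (erlang_rate lambda mu k (y i) (y i.+1)
     / exit_rate (erlang_rate lambda mu k) (y i)
     * expR (- (exit_rate (erlang_rate lambda mu k) (y i) * s i))))%:E.
Local Notation c := (lambda + k%:R * mu).
Local Notation empty := (0%N, 0%N).
Local Notation leb := (@lebesgue_measure R).

Let S n w := \sum_(i < n) W i w.
Let posW n w := [forall i : 'I_n, 0 < W i w].
Let busy n w := all (fun i => Y i w != empty) (iota 0 n).
Let emptied n w := first_hit empty (Y^~ w) n && posW n w.

Let mS n : measurable_fun setT (S n).
Proof. by apply: measurable_sum. Qed.

Let mposW n : measurable_fun setT (posW n).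
Proof. by apply: measurable_fun_forall_ord => i; exact: measurable_fun_ltr. Qed.

Let mYb n y : measurable_fun setT (fun w => Y n w == y).
Proof. exact: measurable_eq_state. Qed.

Let mbusy n : measurable_fun setT (busy n).
Proof.
rewrite /busy; elim: (iota 0 n) => [|i s IH]//=; apply: measurable_and => //.
exact: measurable_neg.
Qed.

Let memptied n : measurable_fun setT (emptied n).
Proof.
apply: measurable_and; last exact: mposW.
by apply: measurable_and; [exact: mbusy|exact: mYb].
Qed.

Let mle (f : Omega -> R) s : measurable_fun setT f -> measurable_fun setT (fun w => f w <= s).
Proof. by move=> mf; exact: measurable_fun_ler. Qed.

Let prod_killed theta n w :
  \prod_(i < n) killed_exp theta (W i w) = (posW n w)%:R * expR (- (theta * S n w)).
Proof.
case: (boolP (posW n w)) => [/forallP H|]; last first.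
  by rewrite negb_forall => /existsP[i /negbTE Wi]; rewrite (bigD1 i)//= /killed_exp Wi !mul0r.
rewrite mul1r /S mulr_sumr -sumrN expR_sum; apply: eq_bigr => i _.
by rewrite /killed_exp H.
Qed.

Let emptied_by n s := [set w | emptied n w && (S n w <= s)].

Let memptied_by n s : measurable (emptied_by n s).
Proof. by apply: measurable_bool_set; apply: measurable_and => //; exact: mle. Qed.

Let trivIset_emptied_by s : trivIset setT (emptied_by^~ s).
Proof.
have ltF n m w : (n < m)%N -> emptied n w -> emptied m w -> False.
  move=> nm /andP[/andP[_ Yn] _] /andP[/andP[/allP Ym _] _].
  by have := Ym n; rewrite mem_iota add0n nm Yn => /(_ isT).
apply/trivIsetP => n m _ _ nm; apply/seteqP; split => // w [/andP[En _] /andP[Em _]].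
by move: nm; rewrite neq_ltn => /orP[] nm; [exact: ltF nm En Em|exact: ltF nm Em En].
Qed.

(** The event T <= s expressed by [Y] and [W], suited to computing its law. Independence from
    [sigma] is instead applied to [seen_empty], which is expressed by [Q] and agrees with it almost
    surely. *)
Definition queue_emptied (s : R) := \bigcup_n emptied_by n s.

Lemma measurable_queue_emptied s : measurable (queue_emptied s).
Proof. by apply: bigcup_measurable. Qed.

Lemma queue_emptied_mono s t : s <= t -> queue_emptied s `<=` queue_emptied t.
Proof.
by move=> st w [n _ /andP[En Sn]]; exists n => //; apply/andP; split => //; exact: le_trans st.
Qed.

Let H s := pr P (queue_emptied s).

Lemma queue_emptied_cdf_nd : {homo (fun s => pr P (queue_emptied s)) : s t / s <= t}.
Proof.
move=> s t st; apply: ae_le_pr; [exact: measurable_queue_emptied|exact: measurable_queue_emptied|].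
by apply: aeW; exact: queue_emptied_mono.
Qed.

Let mg : forall n, measurable_fun setT ((fun x : nat * nat => (x == empty)%:R : R) \o Y n).
Proof. by move=> n; apply: measurable_bool_natr; exact: mYb. Qed.

Let passage theta n := (c / (c + theta)) ^+ n *
  iter n (backward lambda mu k) (fun x => (x == empty)%:R) (1%N, k).

Let laplace_emptied_by theta n : 0 < theta ->
  (theta%:E * \int[leb]_(s in `[0%R, +oo[) (expR (- (theta * s)) * pr P (emptied_by n s))%:E =
   (passage theta n)%:E)%E.
Proof.
move=> t0; rewrite laplace_prob_layer//; last first.
  by move=> w /andP[_ /forallP Wn]; apply: sumr_ge0 => i _; apply: ltW; exact: Wn.
rewrite -(integral_killed lambda0 mu0 k1 mY mW joint t0 n (fun x => ler0n _ _) mg).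
apply: eq_integral => w _; rewrite prod_killed /emptied /first_hit mulrA; congr (_ * _)%:E.
by rewrite -!natrM !mulnb.
Qed.

(** The events that the queue empties at step n are disjoint in n, so the distribution function of T
    is a series of nonnegative functions, which may be integrated term by term. *)
Lemma queue_emptied_series theta : 0 < theta ->
  series (passage theta) @ \oo --> theta * laplace (fun s => pr P (queue_emptied s)) theta.
Proof.
move=> t0.
have mRp : measurable (`[0%R, +oo[%classic : set R) by exact: measurable_itv.
have nd n : {homo (fun s => pr P (emptied_by n s)) : s t / s <= t}.
  move=> s t st; apply: ae_le_pr => //; apply: aeW => w /andP[En Sn].
  by apply/andP; split => //; exact: le_trans st.
have x0 n : 0 <= passage theta n.
  rewrite -lee_fin -laplace_emptied_by// mule_ge0 ?lee_fin ?(ltW t0)//.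
  by apply: integral_ge0 => s _; rewrite lee_fin mulr_ge0 ?expR_ge0 ?pr_ge0.
have fin : (\int[leb]_(s in `[0%R, +oo[) (expR (- (theta * s)) * H s)%:E)%E \is a fin_num.
  apply: integrable_fin_num => //; apply: le_integrable (integrable_expR t0) => //.
    apply/measurable_EFinP; apply: measurable_funM; first exact: measurable_expRN.
    by apply: measurable_funTS; apply: nondecreasing_measurable => //; exact: queue_emptied_cdf_nd.
  move=> s _; rewrite /= lee_fin !ger0_norm ?mulr_ge0 ?expR_ge0 ?pr_ge0//.
  by rewrite ler_piMr ?expR_ge0// pr_le1//; exact: measurable_queue_emptied.
have key : (\sum_(n <oo) (passage theta n)%:E = (theta * laplace H theta)%:E)%E.
  rewrite EFinM /laplace /Rintegral fineK//.
  transitivity (\sum_(n <oo) (theta%:E * \int[leb]_(s in `[0%R, +oo[) (expR (- (theta * s)) * pr P (emptied_by n s))%:E))%E.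
    by apply: eq_eseriesr => n _; rewrite laplace_emptied_by.
  rewrite nneseriesZl; last first.
    by move=> n _; apply: integral_ge0 => s _; rewrite lee_fin mulr_ge0 ?expR_ge0 ?pr_ge0.
  congr (_ * _)%E; rewrite -integral_nneseries//; last 2 first.
  - move=> n; apply/measurable_EFinP; apply: measurable_funM; first exact: measurable_expRN.
    by apply: measurable_funTS; exact: nondecreasing_measurable.
  - by move=> n s _; rewrite lee_fin mulr_ge0 ?expR_ge0 ?pr_ge0.
  apply: eq_integral => s _.
  rewrite EFinM -prE; last exact: measurable_queue_emptied.
  have -> : (P (queue_emptied s) = \sum_(n <oo) (pr P (emptied_by n s))%:E)%E.
    rewrite /queue_emptied measure_bigcup//.
    by rewrite eseries_mkcond; apply: eq_eseriesr => n _; rewrite mem_setT/= prE.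
  rewrite -nneseriesZl; first by apply: eq_eseriesr => n _; rewrite EFinM.
  by move=> n _; rewrite lee_fin pr_ge0.
have cv : (fun n => \sum_(0 <= i < n) (passage theta i)%:E)%E @ \oo --> (theta * laplace H theta)%:E.
  by rewrite -key; apply: is_cvg_nneseries => n _ _; rewrite lee_fin.
rewrite (_ : series _ = fine \o (fun n => \sum_(0 <= i < n) (passage theta i)%:E)%E).
  exact: fine_cvg.
by apply/funext => n /=; rewrite sumEFin.
Qed.

(* As long as the queue is busy all the rates equal c, so that the probability of
   n jumps before time M is at most e^M (c / (c + 1))^n. *)
Lemma no_explosion : {ae P, forall w, (forall n, 0 < W n w) -> (forall n, Y n w <> empty) ->
  forall M : nat, exists n, M%:R < S n w}.
Proof.
suff H0 (M : nat) : {ae P, forall w, (forall n, 0 < W n w) -> (forall n, Y n w <> empty) ->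
    exists n, M%:R < S n w}.
  by apply: filterS (ae_foralln H0) => w Hw W0 Y0 M; exact: Hw.
pose E n := [set w | (busy n w && posW n w) && (S n w <= M%:R)].
have mE n : measurable (E n).
  apply: measurable_bool_set; apply: measurable_and; last exact: mle.
  exact: measurable_and.
have c0 : 0 < c by rewrite addr_gt0// mulr_gt0// ltr0n.
pose kap := c / (c + 1).
have c1 : 0 < c + 1 by exact: addr_gt0 c0 ltr01.
have kap0 : 0 <= kap by apply/ltW/divr_gt0.
have kap1 : kap < 1 by rewrite ltr_pdivrMr// mul1r ltrDl.
have PE n : pr P (E n) <= expR M%:R * kap ^+ n.
  have /andP[u0 u1] := iter_backward_le1 lambda0 mu0 k1 n (1%N, k).
  have mcst : forall n, measurable_fun setT ((fun=> 1 : R) \o Y n) by move=> n'; exact: measurable_cst.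
  have IK n' := integral_killed lambda0 mu0 k1 mY mW joint ltr01 n' (fun=> ler01) mcst.
  have mI : measurable_fun setT (fun w => (busy n w)%:R * 1 * \prod_(i < n) killed_exp 1 (W i w)).
    apply: measurable_funM; first by apply: measurable_funM => //; exact: measurable_bool_natr.
    by apply: measurable_prod => i _; exact: measurable_killed_exp.
  have I0 w : 0 <= (busy n w)%:R * 1 * \prod_(i < n) killed_exp 1 (W i w).
    by rewrite !mulr_ge0// prodr_ge0// => i _; exact: killed_exp_ge0.
  apply: (@le_trans _ _ (expR M%:R * (kap ^+ n * iter n (backward lambda mu k) (fun=> 1) (1%N, k)))); last first.
    by rewrite ler_wpM2l ?expR_ge0// ler_piMr// exprn_ge0.
  have mIE : measurable_fun setT (fun w => ((busy n w)%:R * 1 * \prod_(i < n) killed_exp 1 (W i w))%:E).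
    by apply/measurable_EFinP.
  have I0E w : setT w -> (0 <= ((busy n w)%:R * 1 * \prod_(i < n) killed_exp 1 (W i w))%:E)%E.
    by move=> _; rewrite lee_fin; exact: I0.
  have eM : (0 <= (expR M%:R : R)%:E)%E by rewrite lee_fin expR_ge0.
  rewrite -lee_fin -prE// EFinM -(IK n) -(ge0_integralZl P measurableT mIE I0E eM).
  have mEb : measurable_fun setT (fun w => (busy n w && posW n w) && (S n w <= M%:R)).
    by apply: measurable_and; [exact: measurable_and|exact: mle].
  rewrite -(integral_bool_natr P mEb); apply: ge0_le_integral => //.
  - by apply/measurable_EFinP; exact: measurable_bool_natr.
  - by apply: measurable_funeM; exact: mIE.
  move=> w _; rewrite -EFinM lee_fin prod_killed mulr1 mul1r.
  case: (busy n w) => /=; last by rewrite !mul0r mulr0.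
  case: (posW n w) => /=; last by rewrite !mul0r mulr0 mulr0.
  rewrite !mul1r -expRD; case: (leP (S n w) M%:R) => SM; last exact: expR_ge0.
  by rewrite mulr1n -[leLHS]expR0 ler_expR ?mul1r subr_ge0.
have E0 : pr P (\bigcap_n E n) = 0.
  apply/eqP; rewrite eq_le pr_ge0 andbT.
  have mI : measurable (\bigcap_n E n) by exact: bigcap_measurable.
  have cv : (fun n => expR M%:R * kap ^+ n) @ \oo --> (0 : R).
    rewrite -[X in _ --> X](mulr0 (expR M%:R)); apply: cvgM; first exact: cvg_cst.
    by apply: cvg_expr; rewrite ger0_norm.
  rewrite -(cvg_lim _ cv)//; apply: limr_ge; first by apply/cvg_ex; eexists; exact: cv.
  apply: nearW => n; apply: le_trans (PE n); apply: ae_le_pr => //.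
  by apply: aeW => w; exact.
have mI : measurable (\bigcap_n E n) by exact: bigcap_measurable.
apply: filterS (pr0_ae mI E0) => w Hw W0 Y0; apply: contrapT => nS; apply: Hw => n _.
apply/andP; split; first (apply/andP; split).
- by apply/allP => i _; apply/eqP; exact: Y0.
- by apply/forallP => i; exact: W0.
- by rewrite leNgt; apply/negP => SM; apply: nS; exists n.
Qed.

Section fractional.
Variables (Q : R -> Omega -> nat * nat) (sigma : R -> Omega -> R) (B : Omega -> \bar R) (nu : R).
Hypothesis nu0 : 0 < nu.
Hypothesis mQ : forall t : R, 0 <= t -> measurable_fun setT (Q t).
Hypothesis QY : {ae P, forall w, forall (n : nat) (t : R),
  \sum_(i < n) W i w <= t < \sum_(i < n.+1) W i w -> Q t w = Y n w}.
Hypothesis hsigma : stable_subordinator P nu sigma.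
Hypothesis hindep : independent_processes P Q sigma.
Hypothesis mB : measurable_fun [set: Omega] B.
Hypothesis hB : {ae P, forall w,
  B w = hitting_time (time_change Q (inverse_subordinator sigma)) empty w}.

Definition seen_empty (s : R) := \bigcup_n [set w | Q (observation_time s n) w = empty].

(** The pathwise content of B = sigma(T-), in the form used by the sandwich: T <= s implies B <=
    sigma(s), and T > s implies sigma(s) <= B. *)
Let good w := [/\ forall s, 0 <= s -> (seen_empty s w <-> queue_emptied s w),
  forall s, 0 <= s -> seen_empty s w -> (B w <= (sigma s w)%:E)%E,
  forall s, 0 <= s -> ~ seen_empty s w -> ((sigma s w)%:E <= B w)%E &
  sigma 0 w = 0].

Let good_ae : {ae P, forall w, good w}.
Proof.
have C := chain_valid lambda0 mu0 k1 mY mW joint.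
have C2 := ae_and (ae_and C no_explosion) QY.
have C3 := ae_and (ae_and (subordinator_increasing nu0 hsigma) (subordinator_start hsigma)) hB.
apply: filterS (ae_and C2 C3) => w [[[[Y0 Hstep] Hne] HQ] [[sinc s0] HB]].
have W0 n : 0 < W n w by have [] := Hstep n.
have Sy : (forall n, Y n w <> empty) -> forall M : nat, exists n, M%:R < \sum_(i < n) W i w.
  exact: Hne.
have HQ' n t : \sum_(i < n) W i w <= t < \sum_(i < n.+1) W i w -> Q t w = Y n w by exact: HQ.
have toA' u s : 0 <= u -> u <= s -> Q u w = empty -> queue_emptied s w.
  move=> u0 us Qu.
  have [n hn Sn] := @visit_after_first_hit _ _ empty (Q^~ w) (Y^~ w) (W^~ w) W0 HQ' Sy u u0 Qu.
  exists n => //; apply/andP; split; last exact: le_trans us.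
  by apply/andP; split=> //; apply/forallP => i.
have AA s : 0 <= s -> (seen_empty s w <-> queue_emptied s w).
  move=> s0'; split.
    move=> [n _ Qn]; have /andP [q0 qs] := observation_time_bound n s0'.
    exact: toA' q0 qs Qn.
  move=> [n _ /andP[/andP[hn _] Sn]].
  have Sn1 : S n w < S n.+1 w by rewrite /S big_ord_recr/= ltrDl.
  have Sn0 : 0 <= S n w by rewrite /S sumr_ge0// => i _; apply/ltW/W0.
  have hQ t : S n w <= t < S n.+1 w -> Q t w = empty.
    exact: (@hit_interval _ _ empty (Q^~ w) (Y^~ w) (W^~ w) HQ' n t hn).
  move: Sn; rewrite le_eqVlt => /predU1P[Sn|Sn].
    have [m mE] := observation_time_self s; exists m => //=; rewrite mE -Sn.
    by apply: hQ; rewrite lexx.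
  have lt_m : S n w < Num.min s (S n.+1 w) by rewrite lt_min Sn.
  have [r] := rat_in_itvoo lt_m; rewrite in_itv/= lt_min => /andP[Sr /andP[rs rS]].
  exists (pickle r) => //=; rewrite observation_time_ratr ?hQ ?(ltW Sr)//.
  by rewrite (le_trans Sn0 (ltW Sr)) ltW.
split => //.
- move=> s s0' As; rewrite HB.
  have [n _ Qn] := As; have /andP[q0 qs] := observation_time_bound n s0'.
  exact: (@time_changed_hit_le _ _ (sigma^~ w) (Q^~ w) empty _ s q0 qs Qn s0 sinc).
- move=> s s0' As; rewrite HB.
  apply: (@time_changed_hit_ge _ _ (sigma^~ w) (Q^~ w) empty s s0') => u /andP[u0 us] Qu.
  by apply: As; apply/AA => //; exact: toA' Qu.
Qed.

Let Qempty_preimage t : [set w | Q t w = empty] = Q t @^-1` ([set 0%N] `*` [set 0%N]).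
Proof.
apply/seteqP; split => w /=; first by move=> ->.
by case: (Q t w) => a b [/= -> ->].
Qed.

Let mQempty t : 0 <= t -> measurable [set w | Q t w = empty].
Proof.
move=> t0; rewrite Qempty_preimage -[X in measurable X]setTI.
by apply: mQ => //; exact: measurableX.
Qed.

Let mA s : 0 <= s -> measurable (seen_empty s).
Proof.
move=> s0; apply: bigcup_measurable => n _; apply: mQempty.
by have /andP[] := observation_time_bound n s0.
Qed.

Let sQ := [set A | exists (t : R) (C : set (nat * nat)), [/\ 0 <= t, measurable C & A = Q t @^-1` C]].

Let gA s : 0 <= s -> generated_sigma Q (seen_empty s).
Proof.
(* Membership in the generated sigma-algebra is read as measurability for [g_sigma_algebraType sQ],
   so that the closure lemmas for measurable sets apply to it. *)
move=> s0; rewrite -[generated_sigma Q _]/(@measurable _ (g_sigma_algebraType sQ) (seen_empty s)).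
apply: bigcup_measurable => n _; apply: sub_sigma_algebra.
exists (observation_time s n), ([set 0%N] `*` [set 0%N]); split.
- by have /andP[] := observation_time_bound n s0.
- exact: measurableX.
- exact: Qempty_preimage.
Qed.

(** The shift by one makes [E eps j], up to a null set, the event j eps < T <= (j + 1) eps, with no
    lower constraint for j = 0. *)
Let grid eps (j : nat) := seen_empty (j.+1%:R * eps).
Let E eps := seqDU (grid eps).

Let grid_ge0 (eps : R) (j : nat) : 0 < eps -> 0 <= j%:R * eps.
Proof. by move=> e0; rewrite mulr_ge0// ltW. Qed.

Let mE (eps : R) j : 0 < eps -> measurable (E eps j).
Proof.
move=> e0; apply: measurableD; first exact: mA (grid_ge0 _ e0).
by apply: bigsetU_measurable => i _; exact: mA (grid_ge0 _ e0).
Qed.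

Let gE (eps : R) j : 0 < eps -> generated_sigma Q (E eps j).
Proof.
move=> e0; rewrite -[generated_sigma Q _]/(@measurable _ (g_sigma_algebraType sQ) (E eps j)).
apply: measurableD; first exact: gA (grid_ge0 _ e0).
by apply: bigsetU_measurable => i _; exact: gA (grid_ge0 _ e0).
Qed.

Let sum_E_le1 (eps : R) J : 0 < eps -> \sum_(j < J) pr P (E eps j) <= 1.
Proof.
move=> e0; rewrite -pr_bigsetU; [|by move=> j; exact: mE|exact: trivIset_seqDU].
by apply: pr_le1; apply: bigsetU_measurable => j _; exact: mE.
Qed.

Let E_prev (eps : R) j w : E eps j.+1 w -> ~ seen_empty (j.+1%:R * eps) w.
Proof.
move=> [_ nE] Aw; apply: nE; rewrite -(bigcup_mkord _ (grid eps)).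
by exists j => //=.
Qed.

Let E_none (eps : R) J w : (forall j, (j < J.+1)%N -> ~ E eps j w) -> ~ seen_empty (J.+1%:R * eps) w.
Proof.
move=> nE Aw.
have : (\big[setU/set0]_(j < J.+1) grid eps j) w by rewrite big_ord_recr/=; right.
by rewrite bigsetU_seqDU -(bigcup_mkord _ (E eps)) => -[j jJ Ej]; exact: (nE j jJ).
Qed.

Let Bcdf t := pr P [set w | (B w <= t%:E)%E].

Lemma measurable_le_busy_period t : measurable [set w | (B w <= t%:E)%E].
Proof.
rewrite -[X in measurable X]setTI (_ : [set w | _] = B @^-1` `]-oo, t%:E]%classic).
  by apply: mB => //; exact: emeasurable_itv.
by apply/seteqP; split => w /=; rewrite in_itv.
Qed.

Lemma Bcdf_nd : {homo (fun t => pr P [set w | (B w <= t%:E)%E]) : s t / s <= t}.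
Proof.
move=> s t st; apply: ae_le_pr; try exact: measurable_le_busy_period.
apply: aeW => w /= /le_trans; apply.
by rewrite lee_fin.
Qed.

Let msig s t : 0 <= s -> measurable [set w | sigma s w <= t].
Proof.
by move=> s0; apply: measurable_bool_set; apply: mle; exact: (subordinator_measurable hsigma).
Qed.

(** [E eps j] depends on [Q] and sigma(j eps) <= t on [sigma], so the probabilities multiply; the
    transform in [t] of the second factor is exp (- j eps v^nu) / v. *)
Let Bcdf_grid (v eps : R) J : 0 < v -> 0 < eps ->
  \sum_(j < J) pr P (E eps j) * expR (- (j.+1%:R * eps * v `^ nu)) <= v * laplace Bcdf v <=
  \sum_(j < J) pr P (E eps j) * expR (- (j%:R * eps * v `^ nu)) + expR (- (J%:R * eps * v `^ nu)).
Proof.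
move=> v0 e0.
have := @laplace_sandwich R Bcdf (fun j t => pr P [set w | sigma (j%:R * eps) w <= t])
  (fun j => pr P (E eps j)) (fun j => expR (- (j%:R * eps * v `^ nu)) / v) J v.
have -> : \sum_(j < J) pr P (E eps j) * (expR (- (j.+1%:R * eps * v `^ nu)) / v) =
    v^-1 * (\sum_(j < J) pr P (E eps j) * expR (- (j.+1%:R * eps * v `^ nu))).
  by rewrite mulr_sumr; apply: eq_bigr => j _; ring.
have -> : \sum_(j < J) pr P (E eps j) * (expR (- (j%:R * eps * v `^ nu)) / v)
      + expR (- (J%:R * eps * v `^ nu)) / v =
    v^-1 * (\sum_(j < J) pr P (E eps j) * expR (- (j%:R * eps * v `^ nu)) + expR (- (J%:R * eps * v `^ nu))).
  by rewrite mulrDr mulr_sumr; congr (_ + _); [apply: eq_bigr => j _; ring|ring].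
rewrite ler_pdivrMl// ler_pdivlMl//; apply.
- by apply: measurable_funTS; apply: nondecreasing_measurable => //; exact: Bcdf_nd.
- move=> j; apply: measurable_funTS; apply: nondecreasing_measurable => // s t st.
  by apply: ae_le_pr; [exact: msig (grid_ge0 _ e0)|exact: msig (grid_ge0 _ e0)|apply: aeW => w /= /le_trans; exact].
- by move=> t _; exact: pr_ge0.
- by move=> j t _; exact: pr_ge0.
- by move=> j; exact: pr_ge0.
- by move=> j; apply: laplace_subordinator_cdf => //; exact: grid_ge0.
move=> t t0; apply: (@pr_sandwich _ _ _ P [set w | (B w <= t%:E)%E] (E eps)
  (fun j => [set w | sigma (j%:R * eps) w <= t])).
- exact: measurable_le_busy_period.
- by move=> j; exact: mE.
- by move=> j; exact: msig (grid_ge0 _ e0).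
- exact: trivIset_seqDU.
- move=> i j; rewrite /pr hindep ?fineM//; [exact: fin_num_measure (mE _ e0)| |exact: gE|].
    exact: fin_num_measure (msig _ (grid_ge0 _ e0)).
  apply: sub_sigma_algebra; exists (j%:R * eps), [set x | x <= t]; split => //.
    exact: grid_ge0.
  rewrite (_ : [set x | _] = `]-oo, t]%classic); first exact: measurable_itv.
  by apply/seteqP; split => x /=; rewrite in_itv.
- apply: filterS good_ae => w [_ H1 _ _] j [Ej _] st /=.
  by apply: le_trans (H1 _ (grid_ge0 _ e0) Ej) _; rewrite lee_fin.
(* For j = 0 no earlier grid time is available; the claim is then 0 <= t, since sigma(0) = 0. *)
- apply: filterS good_ae => w [_ _ H2 s0] [|j] Ej Bt /=; first by rewrite mul0r s0.
  by rewrite -lee_fin; apply: le_trans (H2 _ (grid_ge0 _ e0) (E_prev Ej)) Bt.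
- apply: filterS good_ae => w [_ _ H2 s0]; case: J => [|J] nE Bt /=; first by rewrite mul0r s0.
  by rewrite -lee_fin; apply: le_trans (H2 _ (grid_ge0 _ e0) (E_none nE)) Bt.
Qed.

(** The same sandwich with sigma(j eps) replaced by the constant j eps. The events [Z t j] are then
    the whole space or empty, so they are independent of every [E eps j], and the bounds have the
    shape of [Bcdf_grid] with theta in place of v^nu. *)
Let emptied_grid (theta eps : R) J : 0 < theta -> 0 < eps ->
  \sum_(j < J) pr P (E eps j) * expR (- (j.+1%:R * eps * theta)) <= theta * laplace H theta <=
  \sum_(j < J) pr P (E eps j) * expR (- (j%:R * eps * theta)) + expR (- (J%:R * eps * theta)).
Proof.
move=> v0 e0; pose Z t j : set Omega := if j%:R * eps <= t then setT else set0.
have prZ t j : pr P (Z t j) = (j%:R * eps <= t)%R%:R.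
  by rewrite /Z /pr; case: ifP => _; rewrite ?probability_setT ?measure0.
have mZ t j : measurable (Z t j) by rewrite /Z; case: ifP.
have := @laplace_sandwich R H (fun j t => pr P (Z t j))
  (fun j => pr P (E eps j)) (fun j => expR (- (j%:R * eps * theta)) / theta) J theta.
have -> : \sum_(j < J) pr P (E eps j) * (expR (- (j.+1%:R * eps * theta)) / theta) =
    theta^-1 * (\sum_(j < J) pr P (E eps j) * expR (- (j.+1%:R * eps * theta))).
  by rewrite mulr_sumr; apply: eq_bigr => j _; ring.
have -> : \sum_(j < J) pr P (E eps j) * (expR (- (j%:R * eps * theta)) / theta)
      + expR (- (J%:R * eps * theta)) / theta =
    theta^-1 * (\sum_(j < J) pr P (E eps j) * expR (- (j%:R * eps * theta)) + expR (- (J%:R * eps * theta))).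
  by rewrite mulrDr mulr_sumr; congr (_ + _); [apply: eq_bigr => j _; ring|ring].
rewrite ler_pdivrMl// ler_pdivlMl//; apply.
- by apply: measurable_funTS; apply: nondecreasing_measurable => //; exact: queue_emptied_cdf_nd.
- move=> j; apply: measurable_funTS; apply: nondecreasing_measurable => // s t st.
  rewrite !prZ ler_nat; case: (leP (j%:R * eps) s) => // js.
  by rewrite (le_trans js st).
- by move=> t _; exact: pr_ge0.
- by move=> j t _; exact: pr_ge0.
- by move=> j; exact: pr_ge0.
- move=> j; have := @laplace_prob_layer R d Omega P xpredT (fun=> j%:R * eps) theta v0
    (measurable_cst _) (measurable_cst _) (fun _ _ => grid_ge0 j e0).
  have -> : (\int[P]_w ((xpredT w)%:R * expR (- (theta * (j%:R * eps))))%:E =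
      (expR (- (j%:R * eps * theta)))%:E)%E.
    rewrite (@integral_cst _ _ _ P setT measurableT (_%:E)).
    by rewrite [X in (_ * X)%E](@probability_setT _ _ _ P) mule1 mul1r [theta * _]mulrC.
  move=> H1.
  rewrite -[LHS]mul1e (_ : 1%E = (theta^-1 * theta)%:E); last by rewrite mulVf ?gt_eqF.
  rewrite EFinM -muleA.
  rewrite (_ : (theta%:E * _)%E = (expR (- (j%:R * eps * theta)))%:E); first by rewrite -EFinM mulrC.
  rewrite -H1; congr (_ * _)%E; apply: eq_integral => t _; congr (_ * _)%:E.
  by rewrite /Z; congr (pr P _); case: ifP => h; apply/seteqP; split => w //=; rewrite h.
move=> t t0; apply: (@pr_sandwich _ _ _ P (queue_emptied t) (E eps) (Z t)) => //.
- exact: measurable_queue_emptied.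
- by move=> j; exact: mE.
- exact: trivIset_seqDU.
- move=> i j; rewrite prZ /Z; case: ifP => _; first by rewrite setIT mulr1.
  by rewrite setI0 /pr measure0 mulr0.
- apply: filterS good_ae => w [AA _ _ _] j [Ej _]; rewrite /Z; case: ifP => // jt _.
  exact: (queue_emptied_mono jt) ((AA _ (grid_ge0 _ e0)).1 Ej).
- apply: filterS good_ae => w [AA _ _ _] [|j] Ej Dw; rewrite /Z; case: leP => //.
    by rewrite mul0r ltNge t0.
  move=> tj; apply: (E_prev Ej); apply/AA; first exact: grid_ge0.
  exact: (queue_emptied_mono (ltW tj)).
- apply: filterS good_ae => w [AA _ _ _]; case: J => [|J] nE Dw; rewrite /Z; case: leP => //.
    by rewrite mul0r ltNge t0.
  move=> tj; apply: (E_none nE); apply/AA; first exact: grid_ge0.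
  exact: (queue_emptied_mono (ltW tj)).
Qed.

Lemma laplace_busy_period v : 0 < v ->
  series (fun r => CB lambda mu k r / v / (c + v `^ nu) ^+ deltaB k r) @ \oo
    --> laplace (fun t => pr P [set w | (B w <= t%:E)%E]) v.
Proof.
move=> v0; have t0 : 0 < v `^ nu by rewrite powR_gt0.
have E1 : v * laplace Bcdf v = v `^ nu * laplace H (v `^ nu).
  apply: (@grid_squeeze _ _ _ _ (fun eps j => pr P (E eps j)) t0).
  - by move=> eps j; exact: pr_ge0.
  - exact: sum_E_le1.
  - by move=> eps J; exact: Bcdf_grid.
  - by move=> eps J; exact: emptied_grid.
have := passage_series lambda0 mu0 k1 (ltW t0) (queue_emptied_series t0).
rewrite -E1 => L.
rewrite (_ : series _ = fun n => v^-1 * series (fun r => CB lambda mu k r / (c + v `^ nu) ^+ deltaB k r) n).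
  rewrite -[X in _ --> X](mulKf (lt0r_neq0 v0)).
  by apply: cvgM; [exact: cvg_cst|exact: L].
apply/funext => n; rewrite /series/= mulr_sumr; apply: eq_bigr => r _; ring.
Qed.

End fractional.
End busy_period.

Lemma CB_ge0 {R : realType} (lambda mu : R) (k r : nat) :
  0 < lambda -> 0 < mu -> 0 <= CB lambda mu k r.
Proof.
move=> l0 m0; rewrite /CB /C0 !mulr_ge0 ?exprn_ge0 ?mulr_ge0 ?invr_ge0//; exact: ltW.
Qed.

Theorem theorem6p3 (R : realType) (d : measure_display)
    (Omega : measurableType d) (P : probability Omega R)
    (lambda mu nu : R) (k : nat)
    (Q : R -> Omega -> nat * nat) (sigma : R -> Omega -> R)
    (B : Omega -> \bar R)
    (hlambda : 0 < lambda) (hmu : 0 < mu) (hk : (1 <= k)%N)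
    (hnu : 0 < nu < 1)
    (hQ : continuous_time_markov_chain P (erlang_rate lambda mu k) (1%N, k) Q)
    (hsigma : stable_subordinator P nu sigma)
    (hindep : independent_processes P Q sigma)
    (mB : measurable_fun [set: Omega] B)
    (hB : {ae P, forall w,
       B w = hitting_time (time_change Q (inverse_subordinator sigma))
               (0%N, 0%N) w}) :
  let Bcdf (t : R) := fine (P [set w | (B w <= t%:E)%E]) in
  (forall t : R, 0 <= t ->
     series (fun r : nat =>
       CB lambda mu k r * t `^ (gammaB k nu r - 1)
         * mittag_leffler3 nu (gammaB k nu r) (deltaB k r)%:R
             (- ((lambda + k%:R * mu) * t `^ nu))) @ \oo
       --> Bcdf t) /\
  (forall v : R, 0 < v ->
     series (fun r : nat =>
       CB lambda mu k r * v `^ (nu * (deltaB k r)%:R - gammaB k nu r)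
         / (lambda + k%:R * mu + v `^ nu) ^+ deltaB k r) @ \oo
       --> laplace Bcdf v).
Proof.
have /andP[nu0 _] := hnu.
have [mQ [Y [W [mY mW joint QY]]]] := hQ.
have LB v : 0 < v -> series (fun r => CB lambda mu k r / v / (lambda + k%:R * mu + v `^ nu) ^+ deltaB k r) @ \oo
    --> laplace (fun t => pr P [set w | (B w <= t%:E)%E]) v.
  exact: (laplace_busy_period hlambda hmu hk mY mW joint nu0 mQ QY hsigma hindep mB hB).
have c0 : 0 < lambda + k%:R * mu by rewrite addr_gt0// mulr_gt0// ltr0n.
move=> Bcdf; split.
  apply: (@mittag_leffler_inversion R nu _ (CB lambda mu k) (deltaB k) Bcdf nu0 c0).
  - by move=> r; exact: CB_ge0.
  - by move=> r; rewrite /deltaB /delta0 addn_gt0 hk.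
  - exact: Bcdf_nd.
  - move=> t; rewrite pr_ge0 pr_le1//; exact: measurable_le_busy_period.
  - exact: LB.
move=> v v0; rewrite (_ : (fun r => _) =
    (fun r => CB lambda mu k r / v / (lambda + k%:R * mu + v `^ nu) ^+ deltaB k r)); first exact: LB.
(* Since gamma = nu delta + 1, the power of [v] is -1 for every r. *)
apply/funext => r; rewrite /gammaB (_ : _ - _ = -1) ?powR_inv1 ?(ltW v0)//.
by rewrite /deltaB opprD addrA subrr add0r.
Qed.
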